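(* Assume the setting and Assumptions 1–5 described in the context, and suppose $\theta>r_B$. Then there exists $\varepsilon_0>0$ such that, as $k\to\infty$, \[ \bar x(k)=\frac{k^{m_B-1}}{(m_B-1)!}\,\frac{1}{r_B^k}\,\xi(k)+\begin{cases}O\big((r_B+\varepsilon_0)^{-k}\big)e^{\rm t},& m_B=1,\\ O\big(k^{m_B-2}r_B^{-k}\big)e^{\rm t},& m_B\ge2,\end{cases} \] where \[ \xi(k)=\sum_{n=0}^{N-1}\frac{1}{\zeta_n^k}\,\frac{x(0)\tilde B(r_B\zeta_n)}{r_B\zeta_n-1}\big[I-\Gamma_A^*(r_B\zeta_n)\big]^{-1}. \] Further, $\limsup_{k\to\infty}\xi(k)>0$ (componentwise) and $\xi(k)\ge0$ for all $k=0,1,\dots$.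
   Context: Let $M_0,M$ be positive integers. Consider a discrete-time Markov chain of M/G/1 type with state space $\{(0,j):1\le j\le M_0\}\cup\{(k,j):k\ge1,1\le j\le M\}$ (states with first coordinate $k$ form level $k$), with transition matrix in lexicographic order \[ T=\begin{pmatrix}B(0)&B(1)&B(2)&\cdots\\ C(0)&A(1)&A(2)&\cdots\\ O&A(0)&A(1)&\cdots\\ O&O&A(0)&\cdots\\ \vdots&\vdots&\vdots&\ddots\end{pmatrix}, \] where $A(k)$ ($k\ge0$) are nonnegative $M\times M$, $B(0)$ is $M_0\times M_0$, $B(k)$ ($k\ge1$) are $M_0\times M$, $C(0)$ is $M\times M_0$, all nonnegative; $A=\sum_{k\ge0}A(k)$ is stochastic, $B(0)e+\sum_{k\ge1}B(k)e=e$ ($e$ a column of ones), $\pi A=\pi$, $\pi e=1$. Let $A^*(z)=\sum_{k\ge0}z^kA(k)$, $B^*(z)=\sum_{k\ge1}z^kB(k)$ with convergence radii $r_A,r_B$, and $\Gamma_A^*(z)=z^{-1}A^*(z)$. For a square complex matrix $X$, $\delta(X)$ is a maximum-modulus eigenvalue with nonnegative argument and maximal real part among maximum-modulus eigenvalues (the Perron–Frobenius eigenvalue for nonnegative irreducible $X$). Assumption 1: (a) $T$ irreducible; (b) $A$ irreducible; (c) $\pi\sum_{k\ge1}kA(k)e<1$; (d) $\sum_{k\ge1}kB(k)e$ finite. Assumption 2: $r_A>1$, $r_B>1$. Assumption 3: there is a finite $\theta$ with $1<\theta<r_A$ and $\theta=\delta(A^*(\theta))$. Assumption 4: $B^*(z)$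 is meromorphic in an open set containing $\{z:|z|\le r_B\}$, and there exist a positive integer $m_B$ and a finite nonnegative matrix $\tilde B(r_B)\neq O$ with $\lim_{z\to r_B}(1-z/r_B)^{m_B}B^*(z)=\tilde B(r_B)$. Assumption 5: there exist exactly $N\ge1$ complex numbers $\zeta_0,\dots,\zeta_{N-1}$ with $|\zeta_n|=1$, $0=\arg\zeta_0<\arg\zeta_1<\cdots<\arg\zeta_{N-1}<2\pi$, such that $\lim_{z\to r_B\zeta_n}(1-z/(r_B\zeta_n))^{m_B}B^*(z)=\tilde B(r_B\zeta_n)$ is a finite nonzero matrix. $x=(x(0),x(1),\dots)$ is the stationary probability vector partitioned by levels, $\bar x(k)=\sum_{l\ge k+1}x(l)$; $O(g(k))e^{\rm t}$ denotes a row vector with entries $O(g(k))$. *)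

(* Defs.v *)
From HB Require Import structures.
From Stdlib Require Import Relations.
From mathcomp Require Import all_boot all_order all_algebra.
From mathcomp Require Import all_classical all_reals all_analysis.
From mathcomp Require Import complex.
Import Order.TTheory GRing.Theory Num.Theory.
Import numFieldNormedType.Exports.

Set Implicit Arguments.
Unset Strict Implicit.
Unset Printing Implicit Defensive.

Local Open Scope ring_scope.
Local Open Scope classical_set_scope.
Local Open Scope complex_scope.

Definition nonneg_mx (R : realType) (m n : nat) (X : 'M[R]_(m, n)) : Prop :=
  forall i j, 0 <= X i j.

Definition irreducible_mx (R : realType) (n : nat) (X : 'M[R]_n) : Prop :=
  forall i j, clos_refl_trans_1n _ (fun a b => 0 < X a b) i j.

(** States of the M/G/1-type chain: [inl i] is state (0,i) (level 0, phase i);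
    [inr (k, j)] is state (k+1, j) (level k+1, phase j). *)
Definition state (M0 M : nat) := ('I_M0 + (nat * 'I_M))%type.

(** The transition matrix T, entrywise, in block form.
    B0 = B(0) (M0 x M0), B k = B(k) for k >= 1 (M0 x M; B 0 is not used),
    C0 = C(0) (M x M0), A k = A(k) (M x M). *)
Definition Tmat (R : realType) (M0 M : nat) (B0 : 'M[R]_M0)
  (B : nat -> 'M[R]_(M0, M)) (C0 : 'M[R]_(M, M0)) (A : nat -> 'M[R]_M)
  (s t : state M0 M) : R :=
  match s, t with
  | inl i, inl i' => B0 i i'
  | inl i, inr (l, j) => B l.+1 i j
  | inr (k, j), inl i' => if k == 0%N then C0 j i' else 0
  | inr (k, j), inr (l, j') => if (k <= l.+1)%N then A (l.+1 - k)%N j j' else 0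
  end.

Definition irreducible_T (R : realType) (M0 M : nat) (B0 : 'M[R]_M0)
  (B : nat -> 'M[R]_(M0, M)) (C0 : 'M[R]_(M, M0)) (A : nat -> 'M[R]_M) : Prop :=
  forall s t : state M0 M,
    clos_refl_trans_1n _ (fun a b => 0 < Tmat B0 B C0 A a b) s t.

Definition mx_series_sum (R : realType) (m n : nat) (F : nat -> 'M[R]_(m, n))
  : 'M[R]_(m, n) := \matrix_(i, j) limn (series (fun k => F k i j)).

(** The sequence (B(k))_{k>=0} with B(0) replaced by the zero M0 x M block, so
    that B^*(z) = sum_{k>=1} z^k B(k) = sum_{k>=0} z^k (Bext B k). *)
Definition Bext (R : realType) (M0 M : nat) (B : nat -> 'M[R]_(M0, M)) (k : nat)
  : 'M[R]_(M0, M) := if k is 0%N then 0 else B k.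

Definition radius_mx (R : realType) (m n : nat) (F : nat -> 'M[R]_(m, n)) : \bar R :=
  ereal_sup [set r%:E | r in [set r : R | 0 <= r /\
     forall i j, cvgn (series (fun k => F k i j * r ^+ k))]].

Definition gen_fun (R : realType) (m n : nat) (F : nat -> 'M[R]_(m, n)) (z : R[i])
  : 'M[R[i]]_(m, n) :=
  \matrix_(i, j) (limn (series (fun k => ((F k i j)%:C * z ^+ k : (R[i])^o))) : R[i]).

Definition is_delta (R : realType) (n : nat) (X : 'M[R[i]]_n) (d : R[i]) : Prop :=
  [/\ eigenvalue X d,
      0 <= complex.Im d,
      (forall l, eigenvalue X l -> `|l| <= `|d|) &
      (forall l, eigenvalue X l -> `|l| = `|d| -> complex.Re l <= complex.Re d)].

Definition meromorphic_on (R : realType) (U : set (R[i])^o) (f : (R[i])^o -> (R[i])^o)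
  : Prop :=
  exists P : set (R[i])^o,
    [/\ P `<=` U,
        (forall z, U z -> \forall w \near z^', ~ P w),
        (forall z, U z -> ~ P z -> derivable f z 1) &
        (forall p, P p -> exists (m : nat) (L : (R[i])^o),
            (fun z => (z - p) ^+ m * f z) @ p^' --> L)].

Definition pole_coef (R : realType) (m1 n1 : nat) (F : R[i] -> 'M[R[i]]_(m1, n1))
  (p : R[i]) (m : nat) (L : 'M[R[i]]_(m1, n1)) : Prop :=
  forall i j, (fun z : (R[i])^o => ((1 - z / p) ^+ m * F z i j : (R[i])^o))
                @ (p : (R[i])^o)^' --> (L i j : (R[i])^o).

(** Stationary probability vector of T, in block form: x0 = x(0), x k = x(k)
    for k >= 1 (x 0 is not used).  The block equations are exactly x T = x
    (each block column of T has finitely many nonzero blocks). *)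
Definition stationary_prob (R : realType) (M0 M : nat) (B0 : 'M[R]_M0)
  (B : nat -> 'M[R]_(M0, M)) (C0 : 'M[R]_(M, M0)) (A : nat -> 'M[R]_M)
  (x0 : 'rV[R]_M0) (x : nat -> 'rV[R]_M) : Prop :=
  [/\ (forall j, 0 <= x0 0 j) /\ (forall k j, (0 < k)%N -> 0 <= x k 0 j),
      x0 = x0 *m B0 + x 1%N *m C0,
      (forall k, (0 < k)%N ->
         x k = x0 *m B k + \sum_(l < k.+1) x l.+1 *m A (k - l)%N),
      cvgn (series (fun k => \sum_j x k.+1 0 j)) &
      \sum_j x0 0 j + limn (series (fun k => \sum_j x k.+1 0 j)) = 1].

Definition xbar (R : realType) (M : nat) (x : nat -> 'rV[R]_M) (k : nat) : 'rV[R]_M :=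
  \row_j limn (series (fun n => x (n + k.+1)%N 0 j)).

Definition expi (R : realType) (a : R) : R[i] := (cos a) +i* (sin a).

(** xi(k) = sum_n zeta_n^{-k} x(0) Bt(r_B zeta_n) / (r_B zeta_n - 1)
             [I - Gamma_A^*(r_B zeta_n)]^{-1},   Gamma_A^*(z) = z^{-1} A^*(z). *)
Definition xi (R : realType) (M0 M N : nat) (A : nat -> 'M[R]_M) (x0 : 'rV[R]_M0)
  (rB : R) (zeta : 'I_N -> R[i]) (Bt : 'I_N -> 'M[R[i]]_(M0, M)) (k : nat)
  : 'rV[R[i]]_M :=
  \sum_(n < N)
    ((zeta n) ^- k / (rB%:C * zeta n - 1)) *:
      (map_mx (real_complex R) x0 *m Bt n
        *m invmx (1%:M - (rB%:C * zeta n)^-1 *: gen_fun A (rB%:C * zeta n))).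

(* Main.v *)
(** For 1 < |z| < rB the block equations give (1 - z) X(z) = X(0) - V(z) for the generating
    function X of the tails, where V(z) = z (x(0) B^*(z) - x(1) A(0)) (z I - A^*(z))^-1 is that of
    the levels.  Geometric convexity of the Perron root, in the form of positive vectors w with
    A^*(r) w < r w for 1 < r < theta, makes z I - A^*(z) invertible on 1 < |z| < theta; the same
    vectors are Lyapunov functions showing that x(k) = O(r^-k) for every r < rB.  Since rB < theta,
    the only singularities of X near |z| = rB are the poles of B^*: they are finitely many, and of
    order at most mB because B has nonnegative entries.  Once X is multiplied by the product of the
    (1 - z / p)^mB over these poles it is holomorphic in a larger annulus, so its coefficients decay
    faster by Cauchy's estimate, and partial fractions yield the expansion, with xi(k) a
    trigonometric sum in the zeta_n^-k.  By simultaneous recurrence of the zeta_n^k to 1, each xi(k)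
    is approximated by normalised tails, hence nonnegative; its Cesaro mean is the term n = 0, which
    is positive by irreducibility of A. *)

Require Import Defs.
From HB Require Import structures.
From Stdlib Require Import Relations.
From mathcomp Require Import all_boot all_order all_algebra.
From mathcomp Require Import all_classical all_reals all_analysis.
From mathcomp Require Import complex.
From mathcomp Require Import ring lra zify.
Import Order.TTheory GRing.Theory Num.Theory.
Import numFieldNormedType.Exports.
Set Implicit Arguments.
Unset Strict Implicit.
Unset Printing Implicit Defensive.

Local Open Scope ring_scope.
Local Open Scope classical_set_scope.
Local Open Scope complex_scope.

(* [`|z|] is [R[i]]-valued; [nc z] is the same modulus in [R]. *)
Local Notation nc := (@ComplexField.Normc.normc _).
Local Notation cfun R := ((R[i])^o -> (R[i])^o).

(** Coefficients come first and functions second: a power series is its coefficient sequence,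
    holomorphy in a disc is recorded as a bound on |a_k| s^k, and every continuation ends as a bound
    of this kind. The point z = 1 shapes the proof. Since A is stochastic, z I - A^*(z) is singular
    there, so the formula for V lives on annuli 1 < |z| < r only. An annulus tells something about
    coefficients only if the series already converges somewhere in it; hence the Lyapunov bound,
    obtained from the equations alone, has to precede all analysis. The drift condition acts through
    strictness: it excludes equality in the convexity inequality. Passing from levels to tails
    divides by 1 - z, the origin of the factor 1 / (r_B zeta_n - 1). Further poles of B^* on the
    circle may exist, but Assumption 5 makes their coefficient at order m_B vanish, so they reach at
    most the error term k^(m_B-2) r_B^-k. For m_B = 1 no such term is left, and eps0 is the margin
    up to a radius below theta and below the next singularities of B^*. *)

(** * Moduli and polar form of complex numbers *)

Section ComplexModulus.
Context {R : realType}.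
Implicit Types (z w : R[i]) (x : R).

Lemma normcC z : `|z| = (nc z)%:C. Proof. by []. Qed.

Lemma nc_ge0 z : 0 <= nc z.
Proof. by rewrite -lecR -normcC normr_ge0. Qed.

Lemma ncD z w : nc (z + w) <= nc z + nc w.
Proof. by rewrite -lecR rmorphD /= -!normcC ler_normD. Qed.

Lemma ncM z w : nc (z * w) = nc z * nc w.
Proof. exact: ComplexField.Normc.normcM. Qed.

Lemma ncN z : nc (- z) = nc z.
Proof. by apply: complexI; rewrite -!normcC normrN. Qed.

Lemma ncBC z w : nc (z - w) = nc (w - z).
Proof. by rewrite -ncN opprB. Qed.

Lemma ncB z w : nc (z - w) <= nc z + nc w.
Proof. by rewrite -(ncN w) ncD. Qed.

Lemma nc0 : nc (0 : R[i]) = 0. Proof. exact: ComplexField.Normc.normc0. Qed.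

Lemma nc1 : nc (1 : R[i]) = 1. Proof. exact: ComplexField.Normc.normc1. Qed.

Lemma ncX z n : nc (z ^+ n) = nc z ^+ n.
Proof. by elim: n => [|n IH]; rewrite ?expr0 ?nc1 // !exprS ncM IH. Qed.

Lemma ncV z : nc z^-1 = (nc z)^-1.
Proof. exact: ComplexField.Normc.normcV. Qed.

Lemma nc_eq0 z : (nc z == 0) = (z == 0).
Proof.
apply/eqP/eqP => [|->]; [exact: ComplexField.Normc.eq0_normc | exact: nc0].
Qed.

Lemma nc_gt0 z : (0 < nc z) = (z != 0).
Proof. by rewrite lt_def nc_ge0 andbT nc_eq0. Qed.

Lemma nc_real x : nc x%:C = `|x|.
Proof. by rewrite /= expr0n /= addr0 sqrtr_sqr. Qed.

Lemma nc_nat n : nc (n%:R : R[i]) = n%:R.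
Proof.
have -> : (n%:R : R[i]) = (n%:R : R)%:C by rewrite rmorph_nat.
by rewrite nc_real ger0_norm.
Qed.

Lemma nc_sum (I : Type) (r : seq I) (P : pred I) (F : I -> R[i]) :
  nc (\sum_(i <- r | P i) F i) <= \sum_(i <- r | P i) nc (F i).
Proof.
elim/big_rec2: _ => [|i u v _ h]; first by rewrite nc0.
by apply: (le_trans (ncD _ _)); rewrite lerD2l.
Qed.

Lemma nc_prod (I : Type) (r : seq I) (P : pred I) (F : I -> R[i]) :
  nc (\prod_(i <- r | P i) F i) = \prod_(i <- r | P i) nc (F i).
Proof. by elim/big_rec2: _ => [|i u v _ h]; rewrite ?nc1 // ncM h. Qed.

Lemma ler_ncB z w : nc z - nc w <= nc (z - w).
Proof. by rewrite lerBlDr; apply: le_trans (ncD _ _); rewrite subrK. Qed.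

Lemma nc_le_sub z w : nc z <= nc (z - w) + nc w.
Proof. by rewrite -lerBlDr ler_ncB. Qed.

Lemma Re_le_nc z : `|complex.Re z| <= nc z.
Proof. by rewrite -lecR -normcC normc_ge_Re. Qed.

Lemma Im_le_nc z : `|complex.Im z| <= nc z.
Proof.
have := Re_le_nc (z * 'i); rewrite ReiNIm normrN ncM /=.
by rewrite expr0n /= expr1n add0r sqrtr1 mulr1.
Qed.

Lemma nc_le_ReIm z : nc z <= `|complex.Re z| + `|complex.Im z|.
Proof.
rewrite [in leLHS](complexE z); apply: (le_trans (ncD _ _)).
rewrite ncM !nc_real lerD2l /= expr0n /= expr1n add0r sqrtr1 mul1r //.
Qed.

Lemma complex_gt0P (e : R[i]) : 0 < e -> exists2 x, 0 < x & e = x%:C.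
Proof.
case: e => a b; rewrite ltcE /= => /andP[/eqP -> a0].
by exists a.
Qed.

Lemma nc_expi x : nc (expi x) = 1.
Proof. by rewrite /expi /= cos2Dsin2 sqrtr1. Qed.

Lemma expiD x y : expi (x + y) = expi x * expi y :> R[i].
Proof.
by rewrite /expi sinD cosD [sin x * _ + _]addrC.
Qed.

Lemma expi0 : expi 0 = 1 :> R[i].
Proof. by rewrite /expi sin0 cos0. Qed.

Lemma expi_neq0 x : expi x != 0 :> R[i].
Proof. by rewrite -nc_gt0 nc_expi. Qed.

Lemma expiMn x n : expi (x *+ n) = expi x ^+ n :> R[i].
Proof.
by elim: n => [|n IH]; rewrite ?mulr0n ?expi0 // mulrS expiD IH exprS.
Qed.

Lemma expi2pi : expi (pi *+ 2) = 1 :> R[i].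
Proof. by rewrite /expi cos2pi sin2pi. Qed.

Lemma cos_lt1 x : 0 < x < pi *+ 2 -> cos x < 1.
Proof.
move=> /andP[x0 x2]; have [xpi|xpi] := leP x pi.
  by rewrite -cos0 ltr_cos // in_itv /= ?lexx ?pi_ge0 ?(ltW x0).
have -> : cos x = cos (pi *+ 2 - x) by rewrite cosB cos2pi sin2pi mul1r mul0r addr0.
rewrite mulr2n in x2 *.
rewrite -cos0 ltr_cos ?in_itv /= ?lexx ?pi_ge0 //; first by lra.
by apply/andP; split; lra.
Qed.

Lemma expi_neq1 x : 0 < x < pi *+ 2 -> expi x != 1 :> R[i].
Proof.
move=> /cos_lt1 h; apply/eqP => /(congr1 (@complex.Re R)) /= e.
by rewrite e ltxx in h.
Qed.

(** The angle is the [acos] of the real part of z / |z|, reflected to 2 pi minus it when the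
    imaginary part is negative. Angles in the compact interval [0, 2 pi] are what the extreme value
    theorem and the covering arguments on circles take as input. *)
Lemma polar z : exists2 t, 0 <= t <= pi *+ 2 & z = (nc z)%:C * expi t.
Proof.
have [->|z0] := eqVneq z 0.
  exists 0; last by rewrite nc0 mul0r.
  by rewrite lexx mulr2n addr_ge0 ?pi_ge0.
have n0 : 0 < nc z by rewrite nc_gt0.
set w := z / (nc z)%:C.
have w1 : nc w = 1.
  by rewrite ncM ncV nc_real ger0_norm ?nc_ge0 // divff // gt_eqF.
have zw : z = (nc z)%:C * w.
  by rewrite mulrC divfK // -nc_eq0 nc_real normr_eq0 gt_eqF.
have sq : complex.Re w ^+ 2 + complex.Im w ^+ 2 = 1.
  move: w1; case: (w) => a b /= h.
  have h0 : 0 <= a ^+ 2 + b ^+ 2 by rewrite addr_ge0 ?sqr_ge0.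
  by rewrite -(sqr_sqrtr h0) h expr1n.
have Rew : -1 <= complex.Re w <= 1.
  by rewrite -ler_norml -w1 Re_le_nc.
have sinE : sin (acos (complex.Re w)) = `|complex.Im w|.
  by rewrite sin_acos // -sq addrAC subrr add0r sqrtr_sqr.
have [a0 ap] : 0 <= acos (complex.Re w) /\ acos (complex.Re w) <= pi.
  by rewrite acos_ge0 // acos_lepi.
have ce : cos (acos (complex.Re w)) = complex.Re w by rewrite acosK // in_itv.
have pi0 := pi_ge0 R.
have [im|im] := leP 0 (complex.Im w).
  exists (acos (complex.Re w)); first by rewrite mulr2n; lra.
  rewrite {1}zw; congr (_ * _); rewrite /expi ce sinE ger0_norm //.
  by case: (w).
exists (pi *+ 2 - acos (complex.Re w)); first by rewrite mulr2n; lra.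
rewrite {1}zw; congr (_ * _); rewrite /expi cosB sinB cos2pi sin2pi ce sinE.
rewrite ltr0_norm // !mul0r mul1r addr0 sub0r mul1r opprK.
by case: (w).
Qed.

End ComplexModulus.

(** * Limits in the complex plane with real radii *)

Section ComplexLimits.
Context {R : realType}.

Lemma cvg_nc (T : Type) (F : set_system T) (FF : Filter F)
    (f : T -> (R[i])^o) (l : (R[i])^o) :
  (f @ F --> l) <-> forall e : R, 0 < e -> \forall t \near F, nc (f t - l) < e.
Proof.
split => [/cvgrPdist_lt h e e0|h].
  have /h : (0 : R[i]) < e%:C by rewrite ltcR.
  by apply: filterS => t; rewrite normcC ltcR ncBC.
apply/cvgrPdist_lt => _ /complex_gt0P[e e0 ->].
by apply: filterS (h e e0) => t; rewrite normcC ltcR ncBC.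
Qed.

Lemma nearC (z : (R[i])^o) (P : (R[i])^o -> Prop) :
  (\forall w \near z, P w) <->
  exists2 e : R, 0 < e & forall w, nc (w - z) < e -> P w.
Proof.
split => [/nbhs_ballP[_ /complex_gt0P[e e0 ->] h]|[e e0 h]].
  exists e => // w wz; apply: h; rewrite -ball_normE /ball_ /=.
  by rewrite normcC ltcR ncBC.
apply/nbhs_ballP; exists e%:C => /=; first by rewrite ltcR.
move=> w; rewrite -ball_normE /ball_ /= normcC ltcR ncBC; exact: h.
Qed.

Lemma dnearC (z : (R[i])^o) (P : (R[i])^o -> Prop) :
  (\forall w \near z^', P w) <->
  exists2 e : R, 0 < e & forall w, nc (w - z) < e -> w != z -> P w.
Proof.
change ((\forall w \near z, w != z -> P w) <->
  exists2 e : R, 0 < e & forall w, nc (w - z) < e -> w != z -> P w).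
by rewrite nearC.
Qed.

Lemma cvg_dnbhsC (f : cfun R) (p l : (R[i])^o) :
  (f @ p^' --> l) <-> forall e : R, 0 < e -> exists2 d : R, 0 < d &
     forall w, nc (w - p) < d -> w != p -> nc (f w - l) < e.
Proof.
rewrite cvg_nc; split => h e /h.
  by move/dnearC.
by move=> h'; apply/dnearC.
Qed.

End ComplexLimits.

(** * Complex series dominated by a geometric series *)

Section ComplexSeries.
Context {R : realType}.
Implicit Types (u : nat -> R[i]) (l : R[i]).

Lemma geo_partial_le (q : R) m n : 0 <= q < 1 -> (n <= m)%N ->
  \sum_(n <= k < m) q ^+ k <= q ^+ n / (1 - q).
Proof.
move=> /andP[q0 q1] nm; rewrite ler_pdivlMr ?subr_gt0 //.
have -> : (\sum_(n <= k < m) q ^+ k) * (1 - q) = q ^+ n - q ^+ m.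
  rewrite mulr_suml -[RHS]opprB -(telescope_sumr (fun k => q ^+ k) nm) -sumrN.
  by apply: eq_bigr => k _; rewrite exprS; ring.
by rewrite gerBl exprn_ge0.
Qed.

Lemma limn_series u l :
  (forall e : R, 0 < e -> exists N, forall n, (N <= n)%N -> nc (\sum_(k < n) u k - l) < e) ->
  limn (series (u : nat -> (R[i])^o)) = l.
Proof.
move=> h; apply: (cvg_lim (@norm_hausdorff _ (R[i])^o)).
by apply/cvg_nc => e /h[N hN]; exists N => // n /= Nn; rewrite seriesEord /=; exact: hN.
Qed.

Lemma real_normed_geo_cvg (v : nat -> R) (C q : R) : 0 <= q < 1 ->
  (forall k, `|v k| <= C * q ^+ k) -> cvgn (series v).
Proof.
move=> /andP[q0 q1] hv; apply: normed_cvg.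
apply: (@series_le_cvg R _ (geometric C q)) => [n|n|n|]; rewrite /=.
- exact: normr_ge0.
- by apply: le_trans (hv n); exact: normr_ge0.
- exact: hv.
- by apply: is_cvg_geometric_series; rewrite ger0_norm.
Qed.

(** Real and imaginary parts converge separately. The tail bound is read off from a partial sum so
    far out that it is within e of the limit, which leaves a finite geometric sum to estimate. *)
Lemma complex_geo_cvg u (C q : R) : 0 <= q < 1 ->
  (forall k, nc (u k) <= C * q ^+ k) -> exists l,
    forall n, nc (\sum_(k < n) u k - l) <= C * (q ^+ n / (1 - q)).
Proof.
move=> q01 hu.
have /(real_normed_geo_cvg q01) cR : forall k, `|complex.Re (u k)| <= C * q ^+ k.
  by move=> k; exact: le_trans (Re_le_nc _) (hu k).
have /(real_normed_geo_cvg q01) cI : forall k, `|complex.Im (u k)| <= C * q ^+ k.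
  by move=> k; exact: le_trans (Im_le_nc _) (hu k).
set a := limn _ in cR; set b := limn _ in cI.
exists (a +i* b) => n; apply/ler_addgt0Pr => e e0.
have e2 : 0 < e / 2 by rewrite divr_gt0.
have /cvgrPdist_lt/(_ _ e2)[N1 _ h1] : series (fun k => complex.Re (u k)) @ \oo --> a := cR.
have /cvgrPdist_lt/(_ _ e2)[N2 _ h2] : series (fun k => complex.Im (u k)) @ \oo --> b := cI.
pose m := maxn n (maxn N1 N2).
have nm : (n <= m)%N by rewrite leq_maxl.
have {}h1 : `|a - \sum_(k < m) complex.Re (u k)| < e / 2.
  by have := h1 m; rewrite /= seriesEord /=; apply; rewrite /= /m !leq_max leqnn !orbT.
have {}h2 : `|b - \sum_(k < m) complex.Im (u k)| < e / 2.
  by have := h2 m; rewrite /= seriesEord /=; apply; rewrite /= /m !leq_max leqnn !orbT.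
have hm : nc (\sum_(k < m) u k - (a +i* b)) < e.
  apply: (le_lt_trans (nc_le_ReIm _)); rewrite [ltRHS](splitr e); apply: ltrD.
    by move: h1; rewrite distrC -raddf_sum; case: (\sum_(k < m) _).
  by move: h2; rewrite distrC -raddf_sum; case: (\sum_(k < m) _).
have -> : \sum_(k < n) u k - (a +i* b) =
    (\sum_(k < m) u k - (a +i* b)) - \sum_(n <= k < m) u k.
  rewrite -[in RHS](big_mkord xpredT u) (big_cat_nat (n := n)) //= big_mkord.
  by rewrite addrAC addrK.
apply: (le_trans (ncB _ _)); rewrite [leLHS]addrC; apply: lerD; last exact: ltW.
apply: (le_trans (nc_sum _ _ _)).
apply: (@le_trans _ _ (\sum_(n <= k < m) C * q ^+ k)); first exact: ler_sum.
rewrite -mulr_sumr; apply: ler_wpM2l; last exact: geo_partial_le.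
by have := le_trans (nc_ge0 _) (hu 0%N); rewrite expr0 mulr1.
Qed.

Lemma geo_to0 (C q : R) : 0 <= q < 1 -> forall e, 0 < e ->
  exists N, forall n, (N <= n)%N -> C * q ^+ n < e.
Proof.
move=> /andP[q0 q1] e e0.
have : geometric C q @ \oo --> (0 : R) by apply: cvg_geometric; rewrite ger0_norm.
move=> /cvgrPdist_lt/(_ _ e0)[N _ h]; exists N => n Nn.
by have := h n Nn; rewrite /= sub0r normrN; apply: le_lt_trans; exact: ler_norm.
Qed.

End ComplexSeries.

(** * Power series as coefficient sequences *)

Section PowerSeries.
Context {R : realType}.
Implicit Types (a b : nat -> R[i]) (z p : R[i]) (s : R).

(** This bound gives absolute convergence for |z| < s and nothing on the circle |z| = s, whence the
    strict inequalities on [nc z] below. It is closed under the operations used here, and it is the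
    form in which continuation to a larger disc is stated. *)
Definition decay s a := exists C : R, forall k, nc (a k) * s ^+ k <= C.

Definition ev a z : R[i] := limn (series (fun k => (a k * z ^+ k : (R[i])^o))).

Lemma decay_pos s a : decay s a -> exists2 C : R, 0 < C & forall k, nc (a k) * s ^+ k <= C.
Proof.
move=> [C hC]; exists (`|C| + 1) => [|k]; first by rewrite ltr_wpDl.
by apply: (le_trans (hC k)); rewrite ler_wpDr // ler_norm.
Qed.

Lemma decay_le s t a : 0 <= s -> s <= t -> decay t a -> decay s a.
Proof.
move=> s0 st [C hC]; exists C => k; apply: le_trans (hC k).
by apply: ler_wpM2l; [exact: nc_ge0 | apply: lerXn2r => //; rewrite nnegrE // (le_trans s0)].
Qed.

Lemma decay_term s a C z : 0 < s -> (forall k, nc (a k) * s ^+ k <= C) ->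
  forall k, nc (a k * z ^+ k) <= C * (nc z / s) ^+ k.
Proof.
move=> s0 hC k; rewrite ncM ncX expr_div_n mulrA ler_pdivlMr ?exprn_gt0 //.
by rewrite mulrAC ler_wpM2r // exprn_ge0 // nc_ge0.
Qed.

Lemma ratio01 s z : 0 < s -> nc z < s -> 0 <= nc z / s < 1.
Proof. by move=> s0 zs; rewrite divr_ge0 ?nc_ge0 ?ltW //= ltr_pdivrMr // mul1r. Qed.

Lemma ev_tail s a C z : 0 < s -> nc z < s -> (forall k, nc (a k) * s ^+ k <= C) ->
  forall n, nc (\sum_(k < n) a k * z ^+ k - ev a z) <= C * ((nc z / s) ^+ n / (1 - nc z / s)).
Proof.
move=> s0 zs hC; have q01 := ratio01 s0 zs.
have [l hl] := complex_geo_cvg q01 (decay_term z s0 hC).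
suff -> : ev a z = l by [].
apply: limn_series => e e0; have [N hN] := geo_to0 (C / (1 - nc z / s)) q01 e0.
exists N => n Nn; apply: le_lt_trans (hl n) _.
by have := hN n Nn; rewrite mulrAC mulrA.
Qed.

Lemma ev_eps s a z : 0 < s -> nc z < s -> decay s a -> forall e : R, 0 < e ->
  exists N, forall n, (N <= n)%N -> nc (\sum_(k < n) a k * z ^+ k - ev a z) < e.
Proof.
move=> s0 zs [C hC] e e0; have q01 := ratio01 s0 zs.
have [N hN] := geo_to0 (C / (1 - nc z / s)) q01 e0.
exists N => n Nn; apply: le_lt_trans (ev_tail s0 zs hC n) _.
by have := hN n Nn; rewrite mulrAC mulrA.
Qed.

Lemma ev_bound s a C z : 0 < s -> nc z < s -> (forall k, nc (a k) * s ^+ k <= C) ->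
  nc (ev a z) <= C / (1 - nc z / s).
Proof.
move=> s0 zs hC; have := ev_tail s0 zs hC 0.
by rewrite big_ord0 sub0r ncN expr0 mul1r.
Qed.

Lemma decayD s a b : 0 <= s -> decay s a -> decay s b -> decay s (fun k => a k + b k).
Proof.
move=> s0 [C hC] [D hD]; exists (C + D) => k.
apply: le_trans (lerD (hC k) (hD k)).
by rewrite -mulrDl ler_wpM2r ?exprn_ge0 // ncD.
Qed.

Lemma decayZ s c a : decay s a -> decay s (fun k => c * a k).
Proof.
by move=> [C hC]; exists (nc c * C) => k; rewrite ncM -mulrA ler_wpM2l ?nc_ge0.
Qed.

Lemma decayB s a b : 0 <= s -> decay s a -> decay s b -> decay s (fun k => a k - b k).
Proof.
move=> s0 ha hb; have := decayD s0 ha (decayZ (-1) hb).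
by congr decay; apply/funext => k; rewrite mulN1r.
Qed.

Lemma decay_sum s (I : Type) (r : seq I) (P : pred I) (F : I -> nat -> R[i]) : 0 <= s ->
  (forall i, P i -> decay s (F i)) -> decay s (fun k => \sum_(i <- r | P i) F i k).
Proof.
move=> s0 h; elim: r => [|i r IH].
  by exists 0 => k; rewrite big_nil nc0 mul0r.
have [Pi|nPi] := boolP (P i).
  have := decayD s0 (h i Pi) IH.
  by congr decay; apply/funext => k; rewrite big_cons Pi.
by move: IH; congr decay; apply/funext => k; rewrite big_cons (negPf nPi).
Qed.

Lemma evZ s c a z : 0 < s -> nc z < s -> decay s a -> ev (fun k => c * a k) z = c * ev a z.
Proof.
move=> s0 zs ha; apply: limn_series => e e0.
have e1 : 0 < e / (nc c + 1) by rewrite divr_gt0 // ltr_wpDl // nc_ge0.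
have [N hN] := ev_eps s0 zs ha e1; exists N => n /hN h.
have -> : \sum_(k < n) c * a k * z ^+ k - c * ev a z = c * (\sum_(k < n) a k * z ^+ k - ev a z).
  by rewrite mulrBr mulr_sumr; congr (_ - _); apply: eq_bigr => k _; rewrite mulrA.
rewrite ncM; move: h; rewrite ltr_pdivlMr ?ltr_wpDl ?nc_ge0 //.
by apply: le_lt_trans; rewrite mulrDr mulr1 [X in _ <= X + _]mulrC lerDl nc_ge0.
Qed.

Lemma evD s a b z : 0 < s -> nc z < s -> decay s a -> decay s b ->
  ev (fun k => a k + b k) z = ev a z + ev b z.
Proof.
move=> s0 zs ha hb; apply: limn_series => e e0.
have e2 : 0 < e / 2 by rewrite divr_gt0.
have [N1 h1] := ev_eps s0 zs ha e2; have [N2 h2] := ev_eps s0 zs hb e2.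
exists (maxn N1 N2) => n; rewrite geq_max => /andP[/h1 {}h1 /h2 {}h2].
have -> : \sum_(k < n) (a k + b k) * z ^+ k - (ev a z + ev b z) =
   (\sum_(k < n) a k * z ^+ k - ev a z) + (\sum_(k < n) b k * z ^+ k - ev b z).
  rewrite addrACA -opprD -big_split /=; congr (_ - _).
  by apply: eq_bigr => k _; rewrite mulrDl.
by apply: le_lt_trans (ncD _ _) _; rewrite (splitr e) ltrD.
Qed.

Lemma evB s a b z : 0 < s -> nc z < s -> decay s a -> decay s b ->
  ev (fun k => a k - b k) z = ev a z - ev b z.
Proof.
move=> s0 zs ha hb; rewrite -mulN1r -(evZ _ s0 zs hb) -(evD s0 zs ha) //; last exact: decayZ.
by congr ev; apply/funext => k; rewrite mulN1r.
Qed.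

Lemma ev_sum s (I : Type) (r : seq I) (P : pred I) (F : I -> nat -> R[i]) z : 0 < s -> nc z < s ->
  (forall i, P i -> decay s (F i)) ->
  ev (fun k => \sum_(i <- r | P i) F i k) z = \sum_(i <- r | P i) ev (F i) z.
Proof.
move=> s0 zs h; elim: r => [|i r IH].
  rewrite big_nil; apply: limn_series => e e0; exists 0%N => n _.
  by rewrite big1 ?subrr ?nc0 // => k _; rewrite big_nil mul0r.
have hr := decay_sum r (ltW s0) h.
rewrite big_cons; have [Pi|nPi] := boolP (P i).
  rewrite -IH -(evD s0 zs (h i Pi) hr).
  by congr ev; apply/funext => k; rewrite big_cons Pi.
by rewrite -IH; congr ev; apply/funext => k; rewrite big_cons (negPf nPi).
Qed.

Definition conv a b (k : nat) : R[i] := \sum_(i < k.+1) a i * b (k - i)%N.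

Definition coefs (P : {poly R[i]}) (k : nat) : R[i] := P`_k.

(** The linear factor with root [p], normalised to constant term 1. It is thus invertible as a
    formal power series, so it can be cancelled without any convergence hypothesis. *)
Definition lin p : {poly R[i]} := 1 - p^-1 *: 'X.

(** Truncating both sequences to polynomials transfers the ring laws of [{poly}] to [conv]. *)
Lemma convE a b n k : (k < n)%N ->
  conv a b k = ((\poly_(i < n) a i) * (\poly_(i < n) b i))`_k.
Proof.
move=> kn; rewrite coefM; apply: eq_bigr => i _; rewrite !coef_poly.
by rewrite (leq_trans (ltn_ord i) kn) (leq_ltn_trans (leq_subr i k) kn).
Qed.

Lemma convC a b : conv a b = conv b a.
Proof. by apply/funext => k; rewrite !(convE _ _ (ltnSn k)) mulrC. Qed.

Lemma convA a b c : conv a (conv b c) = conv (conv a b) c.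
Proof.
apply/funext => k.
have -> : conv a (conv b c) k =
    ((\poly_(i < k.+1) a i) * ((\poly_(i < k.+1) b i) * (\poly_(i < k.+1) c i)))`_k.
  rewrite coefM; apply: eq_bigr => i _; rewrite coef_poly ltn_ord.
  by rewrite -convE // ltnS leq_subr.
have -> : conv (conv a b) c k =
    ((\poly_(i < k.+1) a i) * (\poly_(i < k.+1) b i) * (\poly_(i < k.+1) c i))`_k.
  rewrite coefM; apply: eq_bigr => i _; rewrite -convE //; congr (_ * _).
  by rewrite coef_poly ltnS leq_subr.
by rewrite mulrA.
Qed.

Lemma conv_coefs P Q : conv (coefs P) (coefs Q) = coefs (P * Q).
Proof. by apply/funext => k; rewrite /coefs coefM. Qed.

Lemma conv1 a : conv (coefs 1) a = a.
Proof.
apply/funext => k; rewrite /conv big_ord_recl /= /coefs coef1 /= mul1r subn0.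
by rewrite big1 ?addr0 // => i _; rewrite coef1 /= mul0r.
Qed.

Lemma convZr a b x : conv a (fun k => x * b k) = (fun k => x * conv a b k).
Proof. by apply/funext => k; rewrite /conv mulr_sumr; apply: eq_bigr => i _; rewrite mulrCA. Qed.

Lemma convBr a b c : conv a (fun k => b k - c k) = (fun k => conv a b k - conv a c k).
Proof. by apply/funext => k; rewrite /conv -sumrB; apply: eq_bigr => i _; rewrite mulrBr. Qed.

Lemma conv_sumr a (I : Type) (r : seq I) (P : pred I) (F : I -> nat -> R[i]) :
  conv a (fun k => \sum_(i <- r | P i) F i k) = (fun k => \sum_(i <- r | P i) conv a (F i) k).
Proof.
apply/funext => k; rewrite /conv exchange_big /=; apply: eq_bigr => i _.
by rewrite mulr_sumr.
Qed.

Lemma conv_lin0 p a : conv (coefs (lin p)) a 0 = a 0%N.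
Proof.
by rewrite /conv big_ord_recl big_ord0 addr0 /coefs /lin coefB coefZ coef1 coefX mulr0 subr0 mul1r.
Qed.

Lemma conv_linS p a k : conv (coefs (lin p)) a k.+1 = a k.+1 - p^-1 * a k.
Proof.
rewrite /conv !big_ord_recl /coefs /lin !coefB !coefZ !coef1 !coefX /= mulr0 subr0 mul1r.
rewrite mulr1 sub0r big1 ?addr0 ?subn0; last first.
  by move=> i _; rewrite coefB coefZ coef1 coefX /= mulr0 subrr mul0r.
by rewrite mulNr; congr (_ - _ * a _); rewrite /bump /= addn0 subn1.
Qed.

Lemma conv_lin_inj p a b : conv (coefs (lin p)) a = conv (coefs (lin p)) b -> a = b.
Proof.
move=> h; apply/funext; elim=> [|k IH].
  by rewrite -(conv_lin0 p a) h conv_lin0.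
have := congr1 (fun f => f k.+1) h; rewrite !conv_linS IH.
by move/addIr.
Qed.

Lemma decay_coefs s P : decay s (coefs P).
Proof.
exists (\sum_(k < size P) `|nc P`_k * s ^+ k|) => k.
have [kn|kn] := ltnP k (size P); last first.
  by rewrite /coefs nth_default // nc0 mul0r sumr_ge0.
rewrite (bigD1 (Ordinal kn)) //=; apply: (le_trans (ler_norm _)).
by rewrite lerDl sumr_ge0.
Qed.

Lemma ev_coefs P z : ev (coefs P) z = P.[z].
Proof.
apply: limn_series => e e0; exists (size P) => n Pn.
rewrite horner_coef (_ : \sum_(k < n) _ = \sum_(i < size P) P`_i * z ^+ i) ?subrr ?nc0 //.
rewrite -!(big_mkord xpredT (fun i => P`_i * z ^+ i)) (big_cat_nat (n := size P)) //=.
rewrite [X in _ + X]big1_seq ?addr0 // => i; rewrite mem_index_iota => /andP[_ /andP[Pi _]].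
by rewrite nth_default // mul0r.
Qed.

(** With both factors at the same radius the k + 1 terms would only give a bound linear in k. The
    gap s < t turns their sum into a geometric one. *)
Lemma decay_conv s t a b : 0 < s -> s < t -> decay s a -> decay t b -> decay s (conv a b).
Proof.
move=> s0 st /decay_pos[C C0 hC] /decay_pos[D D0 hD]; have t0 : 0 < t by exact: lt_trans st.
pose q := s / t; have q01 : 0 <= q < 1.
  by rewrite divr_ge0 ?ltW //= ltr_pdivrMr // mul1r.
exists (C * D * (q ^+ 0 / (1 - q))) => k.
apply: (@le_trans _ _ (\sum_(i < k.+1) C * D * q ^+ (k - i))).
  apply: (@le_trans _ _ ((\sum_(i < k.+1) nc (a i * b (k - i)%N)) * s ^+ k)).
    by rewrite ler_wpM2r ?exprn_ge0 ?(ltW s0) // nc_sum.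
  rewrite mulr_suml; apply: ler_sum => i _.
  have -> : s ^+ k = s ^+ i * s ^+ (k - i) by rewrite -exprD subnKC // -ltnS.
  rewrite ncM mulrACA -[C * D * _]mulrA.
  apply: ler_pM; [| |exact: hC|]; rewrite ?mulr_ge0 ?nc_ge0 ?exprn_ge0 ?(ltW s0) //.
  rewrite /q expr_div_n mulrA ler_pdivlMr ?exprn_gt0 // mulrAC.
  by rewrite ler_wpM2r // exprn_ge0 // ltW.
rewrite -mulr_sumr; apply: ler_wpM2l; first by rewrite mulr_ge0 // ltW.
rewrite (reindex_inj rev_ord_inj) /=.
rewrite (eq_bigr (fun i : 'I_k.+1 => q ^+ i)); last first.
  by move=> i _; rewrite subSS subKn // -ltnS.
by rewrite -(big_mkord xpredT (fun i => q ^+ i)); exact: geo_partial_le.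
Qed.

(** Mertens' argument: the partial sums of the product regroup as a_i z^i times partial sums of [b]
    of length n - i, so the error consists of tails of [b] weighted by a_i z^i. *)
Lemma ev_conv s a b z : 0 < s -> nc z < s -> decay s a -> decay s b ->
  ev (conv a b) z = ev a z * ev b z.
Proof.
move=> s0 zs ha hb.
have [C C0 hC] := decay_pos ha; have [D D0 hD] := decay_pos hb.
set q := nc z / s; have /andP[q0 q1] := ratio01 s0 zs.
(* The weighted tails sum up to about n q^n; a ratio [rho] strictly between q and 1 absorbs the
   factor n. *)
have [qr r1] := midf_lt q1; set rho := _ / 2 in qr r1.
have r0 : 0 < rho by exact: le_lt_trans q0 qr.
pose E := C * (D / (1 - q)) / (1 - q / rho).
have qr01 : 0 <= q / rho < 1 by rewrite divr_ge0 ?(ltW r0) //= ltr_pdivrMr // mul1r.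
have bd n : nc (\sum_(k < n) conv a b k * z ^+ k - (\sum_(k < n) a k * z ^+ k) * ev b z)
     <= E * rho ^+ n.
  have -> : \sum_(k < n) conv a b k * z ^+ k =
     \sum_(i < n) a i * z ^+ i * \sum_(j < n - i) b j * z ^+ j.
    elim: n => [|n IH]; first by rewrite !big_ord0.
    rewrite big_ord_recr /= IH [RHS]big_ord_recr /= subSnn big_ord1 expr0 mulr1.
    transitivity (\sum_(i < n) (a i * z ^+ i * \sum_(j < n - i) b j * z ^+ j
                    + a i * b (n - i)%N * z ^+ n) + a n * z ^+ n * b 0%N); last first.
      congr (_ + _); apply: eq_bigr => i _.
      have ilen : (i <= n)%N by apply: ltnW.
      rewrite subSn // big_ord_recr /= mulrDr; congr (_ + _).
      have -> : z ^+ n = z ^+ i * z ^+ (n - i) by rewrite -exprD subnKC.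
      by ring.
    rewrite big_split /= -addrA; congr (_ + _).
    rewrite /conv big_ord_recr /= mulrDl mulr_suml subnn; congr (_ + _); ring.
  rewrite mulr_suml -sumrB; apply: (le_trans (nc_sum _ _ _)).
  apply: (@le_trans _ _ (\sum_(i < n) C * (D / (1 - q)) * ((q / rho) ^+ i * rho ^+ n))).
    apply: ler_sum => i _; rewrite -mulrBr ncM -mulrA.
    have ilen : (i <= n)%N by apply: ltnW.
    have -> : C * (D / (1 - q) * ((q / rho) ^+ i * rho ^+ n)) =
        (C * q ^+ i) * (D * (rho ^+ (n - i) / (1 - q))).
      have -> : rho ^+ n = rho ^+ i * rho ^+ (n - i) by rewrite -exprD subnKC.
      rewrite expr_div_n; move: (rho ^+ (n - i)) => rn.
      by field; rewrite expf_neq0 ?gt_eqF // subr_gt0.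
    apply: ler_pM; rewrite ?nc_ge0 //; first exact: decay_term.
    apply: (le_trans (ev_tail s0 zs hD _)); rewrite ler_wpM2l ?(ltW D0) //.
    rewrite ler_wpM2r ?invr_ge0 ?subr_ge0 ?(ltW q1) //.
    by apply: lerXn2r; rewrite ?nnegrE ?(ltW qr) ?(ltW r0).
  rewrite -mulr_sumr -mulr_suml /E -[leRHS]mulrA; apply: ler_wpM2l.
    by rewrite mulr_ge0 ?divr_ge0 ?subr_ge0 ?ltW.
  rewrite ler_wpM2r ?exprn_ge0 ?(ltW r0) //.
  rewrite -(big_mkord xpredT (fun i => (q / rho) ^+ i)).
  by apply: (le_trans (geo_partial_le qr01 (leq0n n))); rewrite expr0 mul1r.
apply: limn_series => e e0; have e2 : 0 < e / 2 by rewrite divr_gt0.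
have e3 : 0 < e / 2 / (nc (ev b z) + 1) by rewrite divr_gt0 // ltr_wpDl // nc_ge0.
have r01 : 0 <= rho < 1 by rewrite (ltW r0).
have [N1 h1] := geo_to0 E r01 e2; have [N2 h2] := ev_eps s0 zs ha e3.
exists (maxn N1 N2) => n; rewrite geq_max => /andP[/h1 {}h1 /h2 {}h2].
rewrite -(subrK ((\sum_(k < n) a k * z ^+ k) * ev b z) (\sum_(k < n) conv a b k * z ^+ k)) -addrA.
apply: (le_lt_trans (ncD _ _)); rewrite [ltRHS]splitr; apply: ltrD.
  exact: le_lt_trans (bd n) h1.
rewrite -mulrBl ncM; move: h2; rewrite ltr_pdivlMr ?ltr_wpDl ?nc_ge0 //.
by apply: le_lt_trans; rewrite mulrDr mulr1 lerDl nc_ge0.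
Qed.

Lemma horner_lin p z : (lin p).[z] = 1 - z / p.
Proof. by rewrite /lin !hornerE mulrC. Qed.

Lemma ev_lin s p a z : 0 < s -> nc z < s -> decay s a ->
  ev (conv (coefs (lin p)) a) z = (1 - z / p) * ev a z.
Proof.
by move=> s0 zs ha; rewrite (ev_conv s0 zs (decay_coefs _ _) ha) ev_coefs horner_lin.
Qed.

Lemma ev_poly s P a z : 0 < s -> nc z < s -> decay s a ->
  ev (conv (coefs P) a) z = P.[z] * ev a z.
Proof.
by move=> s0 zs ha; rewrite (ev_conv s0 zs (decay_coefs _ _) ha) ev_coefs.
Qed.

Lemma decay_poly s P a : 0 < s -> decay s a -> decay s (conv (coefs P) a).
Proof.
move=> s0 ha; rewrite convC; apply: (@decay_conv _ (s + 1)) => //; first by rewrite ltrDl.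
exact: decay_coefs.
Qed.

(** The quotient has coefficients p^-k times the partial sums of [a] at p. As the full sum is 0,
    each partial sum is minus a tail, of size (|p| / s)^k; this restores decay at the same radius
    [s]. *)
Lemma divide_root s a p : 0 < s -> p != 0 -> nc p < s -> decay s a -> ev a p = 0 ->
  exists2 q, decay s q & a = conv (coefs (lin p)) q.
Proof.
move=> s0 p0 ps [C hC] ap0.
exists (fun k => p ^- k * \sum_(j < k.+1) a j * p ^+ j); last first.
  apply/funext => -[|k]; rewrite ?conv_lin0 ?conv_linS.
    by rewrite expr0 invr1 mul1r big_ord1 expr0 mulr1.
  rewrite [in RHS]big_ord_recr /= mulrDr (mulrCA _ (a _)) mulVf ?expf_neq0 // mulr1.
  rewrite exprS invfM; ring.
have /andP[r0 r1] := ratio01 s0 ps; set rho := nc p / s in r0 r1.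
exists (C * (rho / (1 - rho))) => k.
have := ev_tail s0 ps hC k.+1; rewrite ap0 subr0 => h.
have np : 0 < nc p by rewrite nc_gt0.
rewrite ncM ncV ncX mulrAC -ler_pdivlMl; last first.
  by rewrite mulr_gt0 ?invr_gt0 ?exprn_gt0.
apply: (le_trans h); rewrite -/rho invfM invrK.
rewrite (_ : _ * (C * _) = C * ((nc p ^+ k / s ^+ k) * (rho / (1 - rho)))); last by ring.
by rewrite -expr_div_n -/rho exprSr -!mulrA; exact: lexx.
Qed.

(** Exact division of [ev a z - ev a z0] by z - z0, from which continuity and differentiability of
    [ev] both follow. The point 0 is treated apart, by a shift of coefficients, because [lin 0] has
    no root. *)
Lemma ev_factor s a z0 : 0 < s -> nc z0 < s -> decay s a ->
  exists2 q, decay s q & forall z, nc z < s -> ev a z - ev a z0 = (z - z0) * ev q z.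
Proof.
move=> s0 z0s ha; have [->|z00] := eqVneq z0 0.
  have hS : decay s (fun k => a k.+1).
    have [C hC] := ha; exists (C / s) => k.
    by rewrite ler_pdivlMr // -mulrA -exprSr.
  exists (fun k => a k.+1) => // z zs.
  have aE : a = fun k => coefs (a 0%N)%:P k + conv (coefs 'X) (fun k => a k.+1) k.
    apply/funext => -[|k]; rewrite /conv /coefs coefC /=.
      by rewrite big_ord_recl big_ord0 coefX mul0r !addr0.
    rewrite !big_ord_recl !coefX /= mul0r mul1r big1 ?addr0 ?add0r.
      by rewrite /bump /= addn0 subn1.
    by move=> i _; rewrite coefX mul0r.
  have evE w : nc w < s -> ev a w = a 0%N + w * ev (fun k => a k.+1) w.
    move=> ws; rewrite {1}aE (evD s0 ws (decay_coefs _ _) (decay_poly _ s0 hS)).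
    by rewrite ev_coefs hornerC (ev_poly _ s0 ws hS) hornerX.
  by rewrite (evE z) // (evE 0) ?nc0 // mul0r addr0 subr0 addrAC subrr add0r.
pose b := fun k => a k - coefs (ev a z0)%:P k.
have hb : decay s b by apply: decayB; [exact: ltW | | exact: decay_coefs].
have evb z : nc z < s -> ev b z = ev a z - ev a z0.
  by move=> zs; rewrite (evB s0 zs ha (decay_coefs _ _)) ev_coefs hornerC.
have [|q hq bE] := divide_root s0 z00 z0s hb; first by rewrite evb // subrr.
exists (fun k => (- z0^-1) * q k); first exact: decayZ.
move=> z zs; rewrite -evb // bE (ev_lin _ s0 zs hq) (evZ _ s0 zs hq).
by field.
Qed.

Lemma ev_continuous s a z0 : 0 < s -> nc z0 < s -> decay s a ->
  forall e : R, 0 < e -> exists2 d : R, 0 < d &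
    forall z, nc (z - z0) < d -> nc z < s /\ nc (ev a z - ev a z0) < e.
Proof.
move=> s0 z0s ha e e0; have [q hq qE] := ev_factor s0 z0s ha.
have [C C0 hC] := decay_pos hq.
pose t := (s + nc z0) / 2; have [z0t ts] : nc z0 < t /\ t < s by rewrite /t; split; lra.
have t0 : 0 < t by apply: le_lt_trans z0t; exact: nc_ge0.
have ts1 : 0 < 1 - t / s by rewrite subr_gt0 ltr_pdivrMr // mul1r.
pose B := C / (1 - t / s); have B0 : 0 < B by rewrite divr_gt0.
exists (Num.min (t - nc z0) (e / B)); first by rewrite lt_min subr_gt0 z0t divr_gt0.
move=> z; rewrite lt_min => /andP[h1 h2].
have zt : nc z < t by have := ler_ncB z z0; lra.
have zs := lt_trans zt ts; split => //.
rewrite qE // ncM; move: h2; rewrite ltr_pdivlMr //; apply: le_lt_trans.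
rewrite ler_wpM2l ?nc_ge0 //; apply: (le_trans (ev_bound s0 zs hC)).
rewrite ler_wpM2l ?(ltW C0) // lef_pV2 ?posrE //; last first.
  by rewrite subr_gt0 ltr_pdivrMr // mul1r.
by rewrite lerD2l lerN2 ler_wpM2r ?invr_ge0 ?(ltW s0) ?(ltW zt).
Qed.

End PowerSeries.

(** * Complex differentiability in increment form *)

Section ComplexDerivative.
Context {R : realType}.
Implicit Types (f g : cfun R) (z : (R[i])^o).

(** Without division and with a non-strict bound the condition also covers w = z, so no punctured
    neighbourhood has to be carried along. *)
Lemma derivable_epsP f z : derivable f z 1 <->
  exists d : R[i], forall e : R, 0 < e -> exists2 r : R, 0 < r &
    forall w : R[i], nc (w - z) < r -> nc (f w - f z - d * (w - z)) <= e * nc (w - z).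
Proof.
split => [/cvg_ex[/= d /cvg_dnbhsC h]|[d h]].
  exists d => e e0; have [r r0 hr] := h e e0; exists r => // w wz.
  have [->|wnz] := eqVneq (w : R[i]) z; first by rewrite !subrr mulr0 subrr nc0 mulr0.
  have wz0 : w - z != 0 by rewrite subr_eq0.
  have := hr (w - z); rewrite subr0 => /(_ wz wz0) /ltW.
  rewrite /GRing.scale /= mulr1 subrK => h1.
  have -> : f w - f z - d * (w - z) = ((w - z)^-1 * (f w - f z) - d) * (w - z).
    by rewrite mulrBl mulrAC mulVf // mul1r.
  by rewrite ncM ler_wpM2r // nc_ge0.
apply/cvg_ex; exists d; apply/cvg_dnbhsC => e e0.
have e2 : 0 < e / 2 by rewrite divr_gt0.
have [r r0 hr] := h _ e2; exists r => // w; rewrite subr0 => wr w0.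
have := hr (w + z); rewrite addrK => /(_ wr) h1.
rewrite /GRing.scale /= mulr1.
have -> : w^-1 * (f (w + z) - f z) - d = (f (w + z) - f z - d * w) / w.
  by rewrite [RHS]mulrBl mulfK // mulrC.
rewrite ncM ncV; apply: (@le_lt_trans _ _ (e / 2)); last by lra.
by rewrite ler_pdivrMr // nc_gt0.
Qed.

Lemma derivable_eps_continuous f z : derivable f z 1 ->
  forall e : R, 0 < e -> exists2 r : R, 0 < r &
    forall w : R[i], nc (w - z) < r -> nc (f w - f z) < e.
Proof.
move=> /derivable_epsP[d h] e e0; have [r r0 hr] := h 1 ltr01.
have K0 : 0 < nc d + 1 by rewrite ltr_wpDl ?nc_ge0.
exists (Num.min r (e / (nc d + 1))); first by rewrite lt_min r0 divr_gt0.
move=> w; rewrite lt_min => /andP[wr]; rewrite ltr_pdivlMr // => we.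
rewrite -(subrK (d * (w - z)) (f w - f z)); apply: (le_lt_trans (ncD _ _)).
rewrite ncM; apply: (le_lt_trans _ we); rewrite [leRHS]mulrDr mulr1 [leRHS]addrC.
by rewrite [X in _ <= _ + X]mulrC lerD2r -[leRHS]mul1r; exact: hr.
Qed.

Lemma eq_near_derivable f g z (r : R) : 0 < r ->
  (forall w : R[i], nc (w - z) < r -> f w = g w) -> derivable f z 1 -> derivable g z 1.
Proof.
move=> r0 fg /derivable_epsP[d h]; apply/derivable_epsP; exists d => e e0.
have [r' r'0 hr] := h e e0; exists (Num.min r r'); first by rewrite lt_min r0.
move=> w; rewrite lt_min => /andP[w1 w2]; rewrite -!fg // ?subrr ?nc0 //.
exact: hr.
Qed.

Lemma derivable_ev s (a : nat -> R[i]) z : 0 < s -> nc z < s -> decay s a ->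
  derivable (ev a : cfun R) z 1.
Proof.
move=> s0 zs ha; have [q hq qE] := ev_factor s0 zs ha.
apply/derivable_epsP; exists (ev q z) => e e0.
have [r r0 hr] := ev_continuous s0 zs hq e0; exists r => // w /hr[ws h].
by rewrite qE // mulrC -mulrBl ncM ler_wpM2r ?nc_ge0 // ltW.
Qed.

Lemma derivable_big (op : R[i] -> R[i] -> R[i]) x0 z (I : Type) (r : seq I) (P : pred I) (F : I -> cfun R) :
  (forall f g : cfun R, derivable f z 1 -> derivable g z 1 ->
     derivable ((fun w => op (f w) (g w)) : cfun R) z 1) ->
  (forall i, P i -> derivable (F i) z 1) ->
  derivable ((fun w => \big[op/x0]_(i <- r | P i) F i w) : cfun R) z 1.
Proof.
move=> hop h; elim: r => [|i r IH].
  by under [X in derivable X]eq_fun do rewrite big_nil; exact: derivable_cst.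
have [Pi|nPi] := boolP (P i).
  by under [X in derivable X]eq_fun do rewrite big_cons Pi; exact: hop (h i Pi) IH.
by under [X in derivable X]eq_fun do rewrite big_cons (negPf nPi).
Qed.

Lemma derivable_bigsum (I : Type) (r : seq I) (P : pred I) (F : I -> cfun R) z :
  (forall i, P i -> derivable (F i) z 1) ->
  derivable ((fun w => \sum_(i <- r | P i) F i w) : cfun R) z 1.
Proof. by apply: (@derivable_big +%R) => f g; exact: derivableD. Qed.

Lemma derivable_mul f g z : derivable f z 1 -> derivable g z 1 ->
  derivable ((fun w => f w * g w) : cfun R) z 1.
Proof. exact: derivableM. Qed.

Lemma derivable_horner (P : {poly R[i]}) z :
  derivable ((fun w => P.[w]) : cfun R) z 1.
Proof.
have s0 : 0 < nc (z : R[i]) + 1 by rewrite ltr_wpDl ?nc_ge0.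
have := derivable_ev s0 _ (decay_coefs (nc (z : R[i]) + 1) P).
move=> /(_ z); rewrite ltrDl ltr01 => /(_ isT).
by congr (derivable _ z 1); apply/funext => w; rewrite ev_coefs.
Qed.

Lemma derivable_det n (A : (R[i])^o -> 'M[R[i]]_n) z :
  (forall i j, derivable ((fun w => A w i j) : cfun R) z 1) ->
  derivable ((fun w => \det (A w)) : cfun R) z 1.
Proof.
move=> h; rewrite /determinant; apply: derivable_bigsum => s _.
apply: derivable_mul; first exact: derivable_cst.
by apply: (@derivable_big *%R) => [f g|i _]; [exact: derivable_mul | exact: h].
Qed.

(** The inverse is written by Cramer's formula because [invmx] switches to a default value at
    singular matrices, whereas this expression is the same at every w. *)
Lemma derivable_invmx n (A : (R[i])^o -> 'M[R[i]]_n) z :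
  (forall i j, derivable ((fun w => A w i j) : cfun R) z 1) ->
  A z \in unitmx -> forall i j,
  derivable ((fun w => (\det (A w))^-1 * \adj (A w) i j) : cfun R) z 1.
Proof.
move=> h; rewrite unitmxE unitfE => dA i j.
apply: derivable_mul; first by apply: derivableV => //; exact: derivable_det.
rewrite (_ : (fun w => _) = (fun w => (-1) ^+ (j + i) * \det (row' j (col' i (A w))))).
  apply: derivable_mul; first exact: derivable_cst.
  by apply: derivable_det => k l; under [X in derivable X]eq_fun do rewrite !mxE; exact: h.
by apply/funext => w; rewrite !mxE.
Qed.

End ComplexDerivative.

(** * Goursat's theorem on rectangles *)

Section Goursat.
Context {R : realType}.
Implicit Types (u t hu ht x y : R) (F : R -> R[i]) (G : R -> R -> R[i]).

Definition riem F x (h : R) (n : nat) : R[i] :=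
  \sum_(j < n) F (x + h * j%:R / n%:R) * (h / n%:R)%:C.

(* Riemann sum of [G dz] along the boundary of the rectangle [u, u + hu] x [t, t + ht]. *)
Definition cell G u t hu ht n : R[i] :=
  riem (fun x => G x t) u hu n - riem (fun x => G x (t + ht)) u hu n
  + 'i * (riem (G (u + hu)) t ht n - riem (G u) t ht n).

Lemma riem_split F x h n : (0 < n)%N ->
  riem F x h (n + n) = riem F x (h / 2) n + riem F (x + h / 2) (h / 2) n.
Proof.
move=> n0; have nR : n%:R != 0 :> R by rewrite pnatr_eq0 -lt0n.
have n2 : (n + n)%:R = 2 * n%:R :> R by rewrite addnn -mul2n natrM.
rewrite /riem big_split_ord /= n2; congr (_ + _); apply: eq_bigr => j _.
  by congr (F _ * _%:C); field; rewrite nR.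
by congr (F _ * _%:C); rewrite ?natrD; field; rewrite nR.
Qed.

Lemma cell_quarter G u t hu ht n : (0 < n)%N ->
  cell G u t hu ht (n + n) =
    cell G u t (hu / 2) (ht / 2) n + cell G (u + hu / 2) t (hu / 2) (ht / 2) n +
    (cell G u (t + ht / 2) (hu / 2) (ht / 2) n +
     cell G (u + hu / 2) (t + ht / 2) (hu / 2) (ht / 2) n).
Proof.
move=> n0; rewrite /cell !riem_split //.
have h2 (a b : R) : a + b / 2 + b / 2 = a + b by field.
rewrite !h2; ring.
Qed.

Lemma riem_cst (c : R[i]) x h n : (0 < n)%N -> riem (fun _ => c) x h n = c * h%:C.
Proof.
move=> n0; have nR : n%:R != 0 :> R by rewrite pnatr_eq0 -lt0n.
rewrite /riem sumr_const card_ord -[LHS]mulr_natr -mulrA; congr (_ * _).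
have -> : (n%:R : R[i]) = (n%:R : R)%:C by rewrite rmorph_nat.
by rewrite -rmorphM /= divfK.
Qed.

Lemma riemB F F' x h n : riem (fun y => F y - F' y) x h n = riem F x h n - riem F' x h n.
Proof. by rewrite /riem -sumrB; apply: eq_bigr => j _; rewrite mulrBl. Qed.

Lemma riemD F F' x h n : riem (fun y => F y + F' y) x h n = riem F x h n + riem F' x h n.
Proof. by rewrite /riem -big_split; apply: eq_bigr => j _; rewrite mulrDl. Qed.

Lemma riem_le F x h n (e : R) : (0 < n)%N -> 0 <= h ->
  (forall y, x <= y <= x + h -> nc (F y) <= e) -> nc (riem F x h n) <= e * h.
Proof.
move=> n0 h0 hF; have nR : 0 < n%:R :> R by rewrite ltr0n.
apply: (le_trans (nc_sum _ _ _)).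
apply: (@le_trans _ _ (\sum_(j < n) e * (h / n%:R))).
  apply: ler_sum => j _; rewrite ncM nc_real ger0_norm ?divr_ge0 ?(ltW nR) //.
  rewrite ler_wpM2r ?divr_ge0 ?(ltW nR) //; apply: hF.
  rewrite lerDl divr_ge0 ?mulr_ge0 ?(ltW nR) //= lerD2l ler_pdivrMr //.
  by rewrite ler_wpM2l // ler_nat ltnW.
by rewrite sumr_const card_ord -[leLHS]mulr_natr -mulrA divfK ?gt_eqF.
Qed.

Lemma eq_riem F F' x h n : (forall y, F y = F' y) -> riem F x h n = riem F' x h n.
Proof. by move=> e; apply: eq_bigr => j _; rewrite e. Qed.

Lemma cellD G G' u t hu ht n :
  cell (fun x y => G x y + G' x y) u t hu ht n = cell G u t hu ht n + cell G' u t hu ht n.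
Proof. rewrite /cell !riemD; ring. Qed.

Lemma cell_affine (a b : R[i]) u t hu ht n : (0 < n)%N ->
  cell (fun x y => a + b * (x +i* y)) u t hu ht n = 0.
Proof.
move=> n0; rewrite /cell -!riemB.
rewrite (eq_riem _ _ _ (F' := fun=> - (b * 'i * ht%:C))); last first.
  move=> y; rewrite opprD addrACA subrr add0r -mulrBr -mulrA -mulrN; congr (_ * _).
  by apply/eqP; rewrite eq_complex /=; apply/andP; split; apply/eqP; ring.
rewrite (eq_riem t _ _ (F' := fun=> b * hu%:C)); last first.
  move=> y; rewrite opprD addrACA subrr add0r -mulrBr; congr (_ * _).
  by apply/eqP; rewrite eq_complex /=; apply/andP; split; apply/eqP; ring.
rewrite !riem_cst //; ring.
Qed.

Lemma cell_le G u t hu ht n (e : R) : (0 < n)%N -> 0 <= hu -> 0 <= ht ->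
  (forall x y, u <= x <= u + hu -> t <= y <= t + ht -> nc (G x y) <= e) ->
  nc (cell G u t hu ht n) <= 2 * e * (hu + ht).
Proof.
move=> n0 hu0 ht0 h.
have ui : u <= u <= u + hu by rewrite lexx lerDl.
have uj : u <= u + hu <= u + hu by rewrite lexx andbT lerDl.
have ti : t <= t <= t + ht by rewrite lexx lerDl.
have tj : t <= t + ht <= t + ht by rewrite lexx andbT lerDl.
have h1 : nc (riem (fun x => G x t) u hu n) <= e * hu.
  by apply: riem_le => // y hy; exact: h.
have h2 : nc (riem (fun x => G x (t + ht)) u hu n) <= e * hu.
  by apply: riem_le => // y hy; exact: h.
have h3 : nc (riem (G (u + hu)) t ht n) <= e * ht.
  by apply: riem_le => // y hy; exact: h.
have h4 : nc (riem (G u) t ht n) <= e * ht.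
  by apply: riem_le => // y hy; exact: h.
apply: (le_trans (ncD _ _)); rewrite ncM.
have -> : nc ('i : R[i]) = 1 by rewrite /= expr0n /= expr1n add0r sqrtr1.
rewrite mul1r.
have := ncB (riem (fun x => G x t) u hu n) (riem (fun x => G x (t + ht)) u hu n).
have := ncB (riem (G (u + hu)) t ht n) (riem (G u) t ht n).
lra.
Qed.

Lemma nested_point (v : nat -> R) (h : R) : 0 <= h ->
  (forall n, v n <= v n.+1 <= v n + h / 2 ^+ n.+1) ->
  exists x, forall n, v n <= x <= v n + h / 2 ^+ n.
Proof.
move=> h0 hv.
have inc : {homo v : m n / (m <= n)%N >-> m <= n}.
  by apply/nondecreasing_seqP => n; have /andP[] := hv n.
have dec : {homo (fun n => v n + h / 2 ^+ n) : m n / (m <= n)%N >-> n <= m}.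
  apply/nonincreasing_seqP => n; have /andP[_ h2] := hv n.
  have -> : h / 2 ^+ n = h / 2 ^+ n.+1 + h / 2 ^+ n.+1 by rewrite exprS; field; rewrite expf_neq0.
  by rewrite addrA lerD2r.
have bd m n : v m <= v n + h / 2 ^+ n.
  apply: (le_trans (inc _ _ (leq_maxl m n))); apply: le_trans (dec _ _ (leq_maxr m n)).
  by rewrite lerDl divr_ge0 // exprn_ge0.
exists (sup (range v)) => n; apply/andP; split.
  apply: ub_le_sup; last by exists n.
  by exists (v 0%N + h / 2 ^+ 0) => _ [m _ <-].
by apply: ge_sup; [exists (v 0%N); exists 0%N | move=> _ [m _ <-]].
Qed.

(** Compactness in the form of nested quarters: a rectangle where [P] fails has a quarter where it
    fails, and the nested sequence shrinks to a point at which the local hypothesis is violated. It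
    serves Goursat's theorem and, with rectangles of width 0, covering arguments on an interval of
    angles. *)
Lemma rectangle_induction (P : R -> R -> R -> R -> Prop) u t hu ht :
  0 <= hu -> 0 <= ht ->
  (forall u t hu ht, P u t (hu / 2) (ht / 2) -> P (u + hu / 2) t (hu / 2) (ht / 2) ->
     P u (t + ht / 2) (hu / 2) (ht / 2) -> P (u + hu / 2) (t + ht / 2) (hu / 2) (ht / 2) ->
     P u t hu ht) ->
  (forall x y, u <= x <= u + hu -> t <= y <= t + ht -> exists2 d : R, 0 < d &
     forall u' t' hu' ht', 0 <= hu' < d -> 0 <= ht' < d ->
       u' <= x <= u' + hu' -> t' <= y <= t' + ht' -> P u' t' hu' ht') ->
  P u t hu ht.
Proof.
move=> hu0 ht0 hq hloc; apply: contrapT => nP.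
pose nxt n (p : R * R) : R * R :=
  let a := hu / 2 ^+ n / 2 in let b := ht / 2 ^+ n / 2 in
  if ~~ `[<P p.1 p.2 a b>] then p else
  if ~~ `[<P (p.1 + a) p.2 a b>] then (p.1 + a, p.2) else
  if ~~ `[<P p.1 (p.2 + b) a b>] then (p.1, p.2 + b) else (p.1 + a, p.2 + b).
pose fix s n : R * R := if n is n'.+1 then nxt n' (s n') else (u, t).
have half (h : R) n : h / 2 ^+ n / 2 = h / 2 ^+ n.+1.
  by rewrite exprS; field; rewrite expf_neq0.
have sS n : s n.+1 = nxt n (s n) by [].
have inv n : ~ P (s n).1 (s n).2 (hu / 2 ^+ n) (ht / 2 ^+ n).
  elim: n => [|n IH]; first by rewrite !expr0 !divr1.
  rewrite sS /nxt -!half; case: asboolP => h1 //=; case: asboolP => h2 //=.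
  case: asboolP => h3 //= h4; apply: IH; exact: hq.
have hp (h : R) n : 0 <= h -> 0 <= h / 2 ^+ n.
  by move=> h0; rewrite divr_ge0 // exprn_ge0.
have [x hx] : exists x, forall n, (s n).1 <= x <= (s n).1 + hu / 2 ^+ n.
  apply: nested_point => // n; rewrite sS /nxt -half.
  have := hp hu n.+1 hu0; rewrite -half => h.
  by do ![case: ifP => _ /=]; rewrite ?lexx ?lerDl ?h.
have [y hy] : exists y, forall n, (s n).2 <= y <= (s n).2 + ht / 2 ^+ n.
  apply: nested_point => // n; rewrite sS /nxt -half.
  have := hp ht n.+1 ht0; rewrite -half => h.
  by do ![case: ifP => _ /=]; rewrite ?lexx ?lerDl ?h.
have := hx 0%N; have := hy 0%N; rewrite /= !expr0 !divr1 => hy0 hx0.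
have [d d0 hd] := hloc x y hx0 hy0.
have half01 : 0 <= (2^-1 : R) < 1 by rewrite invr_ge0 ler0n invf_lt1 ?ltr1n.
have [N1 hN1] := geo_to0 hu half01 d0; have [N2 hN2] := geo_to0 ht half01 d0.
pose n := maxn N1 N2.
apply: (inv n); apply: hd => //.
- by rewrite hp //= -exprVn; apply: hN1; rewrite leq_maxl.
- by rewrite hp //= -exprVn; apply: hN2; rewrite leq_maxr.
Qed.

(** Complex differentiability at x + i y of a function of two real coordinates. The error is
    measured in the l1 norm, which compares directly with the half perimeter hu + ht. *)
Definition cdiff G x y := exists d : R[i], forall e : R, 0 < e -> exists2 r : R, 0 < r &
  forall x' y', `|x' - x| < r -> `|y' - y| < r ->
   nc (G x' y' - G x y - d * ((x' - x) +i* (y' - y))) <= e * (`|x' - x| + `|y' - y|).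

(* Goursat's quartering argument on Riemann sums: the sums of resolution [2 ^ N.+1]
   over a rectangle are exactly the sums of resolution [2 ^ N] over its quarters,
   and they vanish on affine functions, so no integral is needed. *)
Lemma goursat G u t hu ht : 0 <= hu -> 0 <= ht ->
  (forall x y, u <= x <= u + hu -> t <= y <= t + ht -> cdiff G x y) ->
  forall c : R, 0 < c -> exists N0, forall N, (N0 <= N)%N ->
    nc (cell G u t hu ht (2 ^ N)) <= c * (hu + ht) ^+ 2.
Proof.
move=> hu0 ht0 hG c c0.
pose P u t hu ht := exists N0, forall N, (N0 <= N)%N ->
    nc (cell G u t hu ht (2 ^ N)) <= c * (hu + ht) ^+ 2.
apply: (@rectangle_induction P) => //.
  move=> u1 t1 hu1 ht1 [n1 h1] [n2 h2] [n3 h3] [n4 h4].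
  exists (maxn (maxn n1 n2) (maxn n3 n4)).+1 => -[//|N].
  rewrite ltnS !geq_max => /andP[/andP[/h1 {}h1 /h2 {}h2] /andP[/h3 {}h3 /h4 {}h4]].
  rewrite expnS mul2n -addnn cell_quarter ?expn_gt0 //.
  have e4 : c * (hu1 + ht1) ^+ 2 = c * (hu1 / 2 + ht1 / 2) ^+ 2 + c * (hu1 / 2 + ht1 / 2) ^+ 2 +
      (c * (hu1 / 2 + ht1 / 2) ^+ 2 + c * (hu1 / 2 + ht1 / 2) ^+ 2) by field.
  rewrite e4; apply: (le_trans (ncD _ _)); apply: lerD;
    by apply: (le_trans (ncD _ _)); apply: lerD.
(* Near the point, [G] is affine, with vanishing boundary sum, plus an error of at most c / 2 times
   the half perimeter. The factor 2 lost in [cell_le], for the two pairs of opposite sides, restores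
   c. *)
move=> x y hx hy; have [d hd] := hG x y hx hy.
have c2 : 0 < c / 2 by rewrite divr_gt0.
have [r r0 hr] := hd _ c2; exists r => // u' t' hu' ht' /andP[hu'0 hu'r] /andP[ht'0 ht'r] xu yt.
exists 0%N => N _.
have n0 : (0 < 2 ^ N)%N by rewrite expn_gt0.
pose a := G x y - d * (x +i* y).
have -> : G = fun x' y' => (a + d * (x' +i* y')) + (G x' y' - G x y - d * ((x' - x) +i* (y' - y))).
  apply/funext => x'; apply/funext => y'; rewrite /a.
  have -> : (x' - x) +i* (y' - y) = (x' +i* y') - (x +i* y) by [].
  ring.
rewrite cellD cell_affine // add0r.
have -> : c * (hu' + ht') ^+ 2 = 2 * (c / 2 * (hu' + ht')) * (hu' + ht') by field.
apply: cell_le => // x' y' hx' hy'.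
have xb : `|x' - x| <= hu' by rewrite ler_norml; lra.
have yb : `|y' - y| <= ht' by rewrite ler_norml; lra.
apply: (le_trans (hr _ _ (le_lt_trans xb hu'r) (le_lt_trans yb ht'r))).
by rewrite ler_wpM2l ?(ltW c2) // lerD.
Qed.

End Goursat.

(** * Exponential coordinates and sums over circles *)

Section LogCoordinates.
Context {R : realType}.
Implicit Types (f phi : cfun R) (x y r : R).

Definition cexp x y : R[i] := (expR x)%:C * expi y.

Lemma is_derive0_eps (g : R -> R) (d : R) : is_derive (0 : R) 1 g d ->
  forall e : R, 0 < e -> exists2 r, 0 < r & forall h, `|h| < r -> `|g h - g 0 - d * h| <= e * `|h|.
Proof.
move=> [dg gd] e e0.
have : h^-1 *: ((g \o shift (0 : R)) (h *: (1 : R)) - g 0) @[h --> 0^'] --> d.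
  by rewrite -gd; exact: dg.
move=> /cvgrPdist_lt/(_ _ e0); rewrite near_withinE => /nbhs_ballP[r /= r0 hr].
exists r => // h hlt; have [->|h0] := eqVneq h 0; first by rewrite subrr mulr0 subrr normr0 mulr0.
have := hr h; rewrite /ball /= sub0r normrN => /(_ hlt h0).
rewrite /GRing.scale /= mulr1 addr0 => /ltW h1.
have -> : g h - g 0 - d * h = - ((d - h^-1 * (g h - g 0)) * h).
  by rewrite mulrBl mulrAC mulVf // mul1r opprB.
by rewrite normrN normrM ler_wpM2r.
Qed.

Lemma cexpD x y x' y' : cexp (x + x') (y + y') = cexp x y * cexp x' y'.
Proof. by rewrite /cexp expRD expiD rmorphM /=; ring. Qed.

Lemma nc_cexp x y : nc (cexp x y) = expR x.
Proof. by rewrite /cexp ncM nc_expi mulr1 nc_real ger0_norm // expR_ge0. Qed.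

Lemma cexp_small (e : R) : 0 < e -> exists2 r, 0 < r & forall x y, `|x| < r -> `|y| < r ->
  nc (cexp x y - 1 - (x +i* y)) <= e * (`|x| + `|y|).
Proof.
move=> e0.
(* The errors below add up to at most e' |x| + 8 e' |y|, which explains e / 8. The cap 1 yields |exp
   x - 1| <= 2 |x| and |exp x| <= 3. *)
have [e' [e'0 e'e e'1]] : exists e', [/\ 0 < e', e' <= e / 8 & e' <= 1].
  exists (Num.min (e / 8) 1).
  by rewrite lt_min divr_gt0 // ltr01 !ge_min !lexx orbT.
have [r1 r10 h1] := is_derive0_eps (is_derive_expR 0) e'0.
have [r2 r20 h2] := is_derive0_eps (is_derive_sin 0) e'0.
have [r3 r30 h3] := is_derive0_eps (is_derive_cos 0) e'0.
exists (Num.min (Num.min r1 e') (Num.min r2 r3)); first by rewrite !lt_min r10 r20 r30 e'0.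
move=> x y; rewrite !lt_min => /andP[/andP[/h1 {}h1 xe] _] /andP[_ /andP[/h2 {}h2 /h3 {}h3]].
move: h1 h2 h3; rewrite expR0 mul1r sin0 cos0 mul1r subr0 oppr0 mul0r subr0 => h1 h2 h3.
set ax := `|x| in h1 xe *; set ay := `|y| in h2 h3 *.
have ax0 : 0 <= ax by rewrite normr_ge0.
have ay0 : 0 <= ay by rewrite normr_ge0.
have ex2 : `|expR x - 1| <= 2 * ax.
  have -> : expR x - 1 = (expR x - 1 - x) + x by ring.
  apply: (le_trans (ler_normD _ _)); rewrite -/ax.
  have : e' * ax <= 1 * ax by rewrite ler_wpM2r.
  lra.
have ex3 : `|expR x| <= 3.
  have -> : expR x = (expR x - 1) + 1 by ring.
  apply: (le_trans (ler_normD _ _)); rewrite normr1; lra.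
apply: (le_trans (nc_le_ReIm _)).
have -> : complex.Re (cexp x y - 1 - (x +i* y)) = (expR x - 1 - x) + expR x * (cos y - 1).
  by rewrite /cexp /=; ring.
have -> : complex.Im (cexp x y - 1 - (x +i* y)) = expR x * (sin y - y) + (expR x - 1) * y.
  by rewrite /cexp /=; ring.
have q1 : `|expR x * (cos y - 1)| <= 3 * (e' * ay) by rewrite normrM ler_pM.
have q2 : `|expR x * (sin y - y)| <= 3 * (e' * ay) by rewrite normrM ler_pM.
have q3 : `|(expR x - 1) * y| <= 2 * e' * ay.
  rewrite normrM; apply: ler_pM => //; apply: (le_trans ex2).
  by rewrite ler_wpM2l // ltW.
have := ler_normD (expR x - 1 - x) (expR x * (cos y - 1)).
have := ler_normD (expR x * (sin y - y)) ((expR x - 1) * y).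
have m1 : e' * ax <= e / 8 * ax by rewrite ler_wpM2r.
have m2 : e' * ay <= e / 8 * ay by rewrite ler_wpM2r.
have m3 : 0 <= e * ax by rewrite mulr_ge0 // ltW.
lra.
Qed.

Lemma cdiff_cexp phi x y : derivable phi (cexp x y) 1 ->
  cdiff (fun u t => phi (cexp u t)) x y.
Proof.
move=> /derivable_epsP[d hd]; set E := cexp x y in hd *.
have nE : 0 < nc E by rewrite nc_cexp expR_gt0.
exists (d * E) => e e0.
have e20 : 0 < e / (4 * nc E) by rewrite divr_gt0 // mulr_gt0.
have [r2 r20 h2] := hd _ e20.
pose D := nc d * nc E + 1.
have D0 : 0 < D by rewrite ltr_wpDl // mulr_ge0 ?nc_ge0.
pose e1 := Num.min 1 (e / (2 * D)).
have e10 : 0 < e1 by rewrite lt_min ltr01 divr_gt0 // mulr_gt0.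
have e11 : e1 <= 1 by rewrite ge_min lexx.
have e12 : e1 * D <= e / 2.
  rewrite -ler_pdivlMr // (_ : e / 2 / D = e / (2 * D)) ?ge_min ?lexx ?orbT //.
  by field; rewrite gt_eqF.
have [r1 r10 h1] := cexp_small e10.
exists (Num.min r1 (r2 / (4 * nc E))); first by rewrite lt_min r10 divr_gt0 // mulr_gt0.
move=> x' y'; rewrite !lt_min => /andP[xr1 xr2] /andP[yr1 yr2].
have {h1} := h1 _ _ xr1 yr1; set dl := (x' - x) +i* (y' - y).
set s := `|x' - x| + `|y' - y| => h1.
have s0 : 0 <= s by rewrite addr_ge0.
have dls : nc dl <= s by exact: nc_le_ReIm.
have dE : cexp x' y' - E = E * (cexp (x' - x) (y' - y) - 1).
  by rewrite mulrBr mulr1 -cexpD ![_ + (_ - _)]addrC !subrK.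
set rho := cexp (x' - x) (y' - y) - 1 - dl in h1.
have dE2 : cexp x' y' - E = E * (dl + rho) by rewrite dE /rho; ring.
have nE2 : nc (cexp x' y' - E) <= 2 * nc E * s.
  rewrite dE2 ncM -mulrA mulrCA ler_wpM2l ?nc_ge0 //.
  apply: (le_trans (ncD _ _)); have : e1 * s <= 1 * s by rewrite ler_wpM2r.
  lra.
have lt2 : nc (cexp x' y' - E) < r2.
  apply: (le_lt_trans nE2); rewrite -mulrA.
  move: xr2 yr2; rewrite !ltr_pdivlMr ?mulr_gt0 // /s; lra.
have -> : phi (cexp x' y') - phi E - d * E * dl =
   (phi (cexp x' y') - phi E - d * (cexp x' y' - E)) + d * E * rho.
  rewrite dE2; ring.
apply: (le_trans (ncD _ _)).
have a1 : nc (phi (cexp x' y') - phi E - d * (cexp x' y' - E)) <= e / 2 * s.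
  apply: (le_trans (h2 _ lt2)).
  apply: (le_trans (ler_wpM2l (ltW e20) nE2)).
  rewrite le_eqVlt; apply/orP; left; apply/eqP; field.
  by rewrite gt_eqF.
have a2 : nc (d * E * rho) <= e / 2 * s.
  rewrite ncM (ncM d); apply: (@le_trans _ _ (D * (e1 * s))).
    apply: ler_pM => //; first by rewrite mulr_ge0 ?nc_ge0.
      by rewrite nc_ge0.
    by rewrite /D lerDl.
  by rewrite mulrA (mulrC D) ler_wpM2r.
lra.
Qed.

Lemma expi_continuous y (e : R) : 0 < e -> exists2 r, 0 < r & forall y', `|y' - y| < r ->
  nc (expi y' - expi y) < e.
Proof.
move=> e0; have [r r0 h] := cexp_small ltr01.
exists (Num.min r (e / 2)); first by rewrite lt_min r0 divr_gt0.
move=> y'; rewrite lt_min => /andP[yr ye].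
have -> : expi y' - expi y = expi y * (expi (y' - y) - 1) :> R[i].
  by rewrite mulrBr mulr1 -expiD (addrC y) subrK.
rewrite ncM nc_expi mul1r.
have := h 0 (y' - y); rewrite normr0 add0r mul1r => /(_ r0 yr).
rewrite {1}/cexp expR0 mul1r => {}h.
have h' : nc (0 +i* (y' - y)) <= `|y' - y|.
  by have := nc_le_ReIm (0 +i* (y' - y)); rewrite /= normr0 add0r.
apply: (le_lt_trans (nc_le_sub _ (0 +i* (y' - y)))).
by lra.
Qed.

Lemma circle_pt_continuous r y (e : R) : 0 < e ->
  exists2 d : R, 0 < d & forall r' y', `|r' - r| < d -> `|y' - y| < d ->
    nc (r'%:C * expi y' - r%:C * expi y) < e.
Proof.
move=> e0.
have K0 : 0 < `|r| + 1 by rewrite ltr_wpDl.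
have e20 : 0 < e / 2 / (`|r| + 1) by rewrite !divr_gt0.
have [d d0 hd] := expi_continuous y e20.
exists (Num.min d (e / 2)); first by rewrite lt_min d0 divr_gt0.
move=> r' y'; rewrite !lt_min => /andP[_ re] /andP[/hd h _].
have -> : r'%:C * expi y' - r%:C * expi y = (r' - r)%:C * expi y' + r%:C * (expi y' - expi y) :> R[i].
  rewrite rmorphB /=; ring.
apply: (le_lt_trans (ncD _ _)); rewrite [ltRHS]splitr; apply: ltrD.
  by rewrite ncM nc_expi mulr1 nc_real.
rewrite ncM nc_real; move: h; rewrite ltr_pdivlMr //; apply: le_lt_trans.
by rewrite [leRHS]mulrC ler_wpM2r ?nc_ge0 // lerDl.
Qed.

(** One radius for the whole circle: the nested-quarters principle on the degenerate rectangle {0} x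
    [0, 2 pi]. *)
Lemma circle_uniform (P : R -> R -> Prop) r :
  (forall t, exists2 d : R, 0 < d & forall r' t', `|r' - r| < d -> `|t' - t| < d -> P r' t') ->
  exists2 d : R, 0 < d & forall r' t, `|r' - r| < d -> 0 <= t <= pi *+ 2 -> P r' t.
Proof.
move=> h.
pose Q (_ y _ hy : R) := exists2 d : R, 0 < d &
  forall r' t, `|r' - r| < d -> y <= t <= y + hy -> P r' t.
suff : Q 0 0 0 (pi *+ 2) by rewrite /Q add0r.
apply: rectangle_induction => //; first by rewrite mulrn_wge0 ?pi_ge0.
  move=> u0 y hu0 hy [d1 d10 h1] _ [d2 d20 h2] _.
  exists (Num.min d1 d2); first by rewrite lt_min d10.
  move=> r' t; rewrite lt_min => /andP[r1 r2] ht.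
  have [ty|ty] := leP t (y + hy / 2); first by apply: h1 => //; lra.
  by apply: h2 => //; lra.
move=> x y _ _; have [d d0 hd] := h y; exists d => // u t' hu ht _ /andP[ht0 htd] _ yt.
exists d => // r' t r'd tt; apply: hd => //.
by rewrite ltr_norml; lra.
Qed.

(** A discretisation of the integral of phi(z) dz / (i z), that is, of 2 pi times the mean of [phi]
    over the circle. *)
Definition circ phi r n := riem (fun t => phi (r%:C * expi t)) 0 (pi *+ 2) n.

(* In the coordinate [log z] the annulus is a rectangle whose horizontal sides cancel by
   periodicity. *)
Lemma circ_const phi r1 r2 : 0 < r1 -> r1 <= r2 ->
  (forall z, r1 <= nc z <= r2 -> derivable phi z 1) ->
  forall c : R, 0 < c -> exists N0, forall N, (N0 <= N)%N ->
    nc (circ phi r2 (2 ^ N) - circ phi r1 (2 ^ N)) <= c.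
Proof.
move=> r10 r12 hphi c c0; have r20 : 0 < r2 by exact: lt_le_trans r12.
have pi20 : 0 <= pi *+ 2 :> R by rewrite mulrn_wge0 ?pi_ge0.
have hu0 : 0 <= ln r2 - ln r1 by rewrite subr_ge0 ler_ln.
set L := ln r2 - ln r1 + pi *+ 2.
have L0 : 0 < L by rewrite /L ltr_wpDl // mulr2n addr_gt0 ?pi_gt0.
have c'0 : 0 < c / L ^+ 2 by rewrite divr_gt0 // exprn_gt0.
have [|N0 hN0] := @goursat R (fun u t => phi (cexp u t)) (ln r1) 0 _ _ hu0 pi20 _ _ c'0.
  move=> x y xr _; apply: cdiff_cexp; apply: hphi; rewrite nc_cexp.
  move: xr; rewrite addrC subrK => /andP[x1 x2].
  by rewrite -[r1]lnK // -[r2]lnK // !ler_expR x1.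
exists N0 => N /hN0; rewrite divfK ?expf_neq0 ?gt_eqF // /cell.
rewrite add0r (addrC (ln r1)) subrK.
rewrite (eq_riem _ _ _ (F' := fun x => phi (cexp x (pi *+ 2)))); last first.
  by move=> x; rewrite /cexp expi2pi expi0.
rewrite subrr add0r ncM.
have -> : nc ('i : R[i]) = 1 by rewrite /= expr0n /= expr1n add0r sqrtr1.
by rewrite mul1r /circ /cexp !lnK.
Qed.

Definition ceps phi z := forall e : R, 0 < e -> exists2 r : R, 0 < r &
    forall w : R[i], nc (w - z) < r -> nc (phi w - phi z) < e.

Lemma cepsM f g z : ceps f z -> ceps g z -> ceps (fun w => f w * g w) z.
Proof.
move=> hf hg e e0.
pose A := nc (f z) + 1; pose B := nc (g z) + 1.
have A0 : 0 < A by rewrite ltr_wpDl ?nc_ge0.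
have B0 : 0 < B by rewrite ltr_wpDl ?nc_ge0.
have ea : 0 < e / 2 / B by rewrite !divr_gt0.
have eb : 0 < e / 2 / A by rewrite !divr_gt0.
have [r1 r10 h1] := hf _ ea; have [r2 r20 h2] := hg _ eb; have [r3 r30 h3] := hf _ ltr01.
exists (Num.min r1 (Num.min r2 r3)); first by rewrite !lt_min r10 r20.
move=> w; rewrite !lt_min => /and3P[/h1 {}h1 /h2 {}h2 /h3 {}h3].
have -> : f w * g w - f z * g z = f w * (g w - g z) + (f w - f z) * g z by ring.
apply: (le_lt_trans (ncD _ _)); rewrite [ltRHS]splitr; apply: ltrD; rewrite ncM.
  move: h2; rewrite ltr_pdivlMr //; apply: le_lt_trans; rewrite mulrC ler_wpM2l ?nc_ge0 //.
  by have := ler_ncB (f w) (f z); rewrite /A; lra.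
move: h1; rewrite ltr_pdivlMr //; apply: le_lt_trans; rewrite ler_wpM2l ?nc_ge0 //.
by rewrite /B lerDl.
Qed.

Lemma circ_continuous phi r : 0 < r -> (forall z, nc z = r -> ceps phi z) ->
  forall c : R, 0 < c -> exists2 d : R, 0 < d & forall r', `|r' - r| < d -> forall n, (0 < n)%N ->
    nc (circ phi r' n - circ phi r n) <= c.
Proof.
move=> r0 hphi c c0.
have pi20 : 0 < pi *+ 2 :> R by rewrite mulr2n addr_gt0 ?pi_gt0.
pose c' := c / (pi *+ 2); have c'0 : 0 < c' by rewrite divr_gt0.
have [|d d0 hd] := @circle_uniform (fun r' t =>
   nc (phi (r'%:C * expi t) - phi (r%:C * expi t)) <= c') r.
  move=> t; have z1 : nc (r%:C * expi t) = r by rewrite ncM nc_expi mulr1 nc_real gtr0_norm.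
  have c20 : 0 < c' / 2 by rewrite divr_gt0.
  have [e e0 he] := hphi _ z1 _ c20; have [d d0 hd] := circle_pt_continuous r t e0.
  exists d => // r' t' r'd t'd.
  have a1 := he _ (hd _ _ r'd t'd).
  have a2 := he _ (hd r t' _ t'd); rewrite subrr normr0 in a2; have {}a2 := a2 d0.
  have -> : phi (r'%:C * expi t') - phi (r%:C * expi t') =
    (phi (r'%:C * expi t') - phi (r%:C * expi t)) - (phi (r%:C * expi t') - phi (r%:C * expi t)) by ring.
  by apply: (le_trans (ncB _ _)); lra.
exists d => // r' r'd n n0; rewrite /circ -riemB.
rewrite -[leRHS](divfK (lt0r_neq0 pi20)); apply: riem_le => //; first exact: ltW.
by move=> y; rewrite add0r; exact: hd.
Qed.

(** Both circles are compared with the circle of radius [rho]. Each is moved through its own side to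
    a radius close to [rho], and continuity bridges the remaining gap uniformly in the
    resolution. *)
Lemma circ_const_cross phi r1 r2 rho : 0 < r1 -> r1 <= r2 ->
  (forall z, r1 <= nc z <= r2 -> ceps phi z) ->
  (forall z, r1 <= nc z <= r2 -> nc z != rho -> derivable phi z 1) ->
  forall c : R, 0 < c -> exists N0, forall N, (N0 <= N)%N ->
    nc (circ phi r2 (2 ^ N) - circ phi r1 (2 ^ N)) <= c.
Proof.
move=> r10 r12 hc hd c c0; have r20 : 0 < r2 by exact: lt_le_trans r12.
have [rl|rl] := ltP rho r1.
  apply: circ_const => // z zr; apply: hd => //; rewrite gt_eqF //.
  by move: zr => /andP[z1 _]; exact: lt_le_trans z1.
have [rh|rh] := ltP r2 rho.
  apply: circ_const => // z zr; apply: hd => //; rewrite lt_eqF //.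
  by move: zr => /andP[_ z1]; exact: le_lt_trans rh.
have rho0 : 0 < rho by exact: lt_le_trans rl.
have half r : r1 <= r <= r2 -> exists N0, forall N, (N0 <= N)%N ->
    nc (circ phi r (2 ^ N) - circ phi rho (2 ^ N)) <= c / 2.
  move=> /andP[r1r rr2]; have c40 : 0 < c / 4 by rewrite divr_gt0.
  have [d d0 h] : exists2 d : R, 0 < d & forall r', `|r' - rho| < d -> forall n, (0 < n)%N ->
      nc (circ phi r' n - circ phi rho n) <= c / 4.
    by apply: circ_continuous => // z zr; apply: hc; rewrite zr rl.
  suff [r' rd [N0 hN]] : exists2 r', `|r' - rho| < d & exists N0, forall N, (N0 <= N)%N ->
      nc (circ phi r (2 ^ N) - circ phi r' (2 ^ N)) <= c / 4.
    exists N0 => N /hN; have := h r' rd (2 ^ N)%N; rewrite expn_gt0 => /(_ isT).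
    move=> h1 h2; rewrite -(subrK (circ phi r' (2 ^ N)) (circ phi r (2 ^ N))) -addrA.
    by apply: (le_trans (ncD _ _)); lra.
  have [r_rho|r_rho|->] := ltgtP r rho; last first.
  - by exists rho; [rewrite subrr normr0 | exists 0%N => N _; rewrite subrr nc0 ltW].
  - pose r' := Num.min r (rho + d / 2).
    have [h1 h2] : rho < r' /\ r' <= rho + d / 2 by rewrite lt_min r_rho ge_min lexx orbT; lra.
    exists r'; first by rewrite ltr_norml; lra.
    apply: circ_const => //; rewrite ?ge_min ?lexx //; first exact: lt_trans h1.
    move=> z /andP[z1 z2]; apply: hd; last by rewrite gt_eqF // (lt_le_trans h1).
    by rewrite (le_trans z2) // (le_trans rl) // (le_trans (ltW h1)).
  - pose r' := Num.max r (rho - d / 2).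
    have [h1 h2] : r' < rho /\ rho - d / 2 <= r' by rewrite gt_max r_rho le_max lexx orbT; lra.
    exists r'; first by rewrite ltr_norml; lra.
    have [|||N0 hN] := @circ_const phi r r' _ _ _ (c / 4) c40.
    + exact: lt_le_trans r1r.
    + by rewrite le_max lexx.
    + move=> z /andP[z1 z2]; apply: hd; last by rewrite lt_eqF // (le_lt_trans z2).
      by rewrite (le_trans r1r) // (le_trans z2) // (le_trans (ltW h1)).
    by exists N0 => N; rewrite ncBC; exact: hN.
have [|Na hNa] := half r1; first by rewrite lexx.
have [|Nb hNb] := half r2; first by rewrite lexx andbT.
exists (maxn Na Nb) => N; rewrite geq_max => /andP[/hNa {}hNa /hNb {}hNb].
rewrite -(subrK (circ phi rho (2 ^ N)) (circ phi r2 _)) -addrA -[circ phi rho _ - _]opprB.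
by apply: (le_trans (ncB _ _)); lra.
Qed.

End LogCoordinates.

(** * Cauchy's estimate and the identity theorem *)

Section CauchyEstimate.
Context {R : realType}.
Implicit Types (f phi : cfun R) (a : nat -> R[i]) (r s : R).

(** Orthogonality of the n-th roots of unity: the Riemann sum equals the integral exactly once both
    exponents are below the resolution. *)
Lemma circ_monomial r l k n : 0 < r -> (l < n)%N -> (k < n)%N ->
  circ (fun z => z ^+ l / z ^+ k) r n = if l == k then (pi *+ 2)%:C else 0.
Proof.
move=> r0 ln kn; have n0 : (0 < n)%N by exact: leq_ltn_trans ln.
have nR : n%:R != 0 :> R by rewrite pnatr_eq0 -lt0n.
have rC : r%:C != 0 :> R[i] by rewrite -nc_eq0 nc_real normr_eq0 gt_eqF.
pose w : R[i] := expi (pi *+ 2 / n%:R).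
have wj (j : nat) : expi (0 + pi *+ 2 * j%:R / n%:R) = w ^+ j :> R[i].
  by rewrite add0r /w -expiMn; congr expi; rewrite -[RHS]mulr_natr mulrAC.
have w0 : w != 0 by exact: expi_neq0.
have wn : w ^+ n = 1 by rewrite /w -expiMn -[X in expi X]mulr_natr divfK // expi2pi.
have [->|lk] := eqVneq l k.
  rewrite /circ (eq_riem _ _ _ (F' := fun=> 1)) ?riem_cst ?mul1r // => t.
  by rewrite divff // expf_neq0 // mulf_neq0 // expi_neq0.
rewrite /circ /riem -mulr_suml.
under eq_bigr => j _ do rewrite wj !exprMn invfM mulrACA (exprAC w) (exprAC w j) -expr_div_n.
rewrite -mulr_sumr; set x := w ^+ l / w ^+ k.
suff -> : \sum_(j < n) x ^+ j = 0 by rewrite mulr0 mul0r.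
have x1 : x - 1 != 0.
  rewrite subr_eq0 /x; apply/eqP => e.
  have {e} : w ^+ l = w ^+ k by rewrite -[LHS](divfK (expf_neq0 k w0)) e mul1r.
  have key i j : (i < j)%N -> (j < n)%N -> w ^+ i = w ^+ j -> False.
    move=> ij jn e; have : w ^+ (j - i) = 1.
      apply: (mulfI (expf_neq0 i w0)); rewrite -exprD subnKC ?(ltnW ij) // mulr1 e //.
    rewrite -expiMn; apply/eqP/expi_neq1.
    have pi0 : 0 < pi *+ 2 :> R by rewrite mulr2n addr_gt0 ?pi_gt0.
    have nR0 : 0 < n%:R :> R by rewrite ltr0n.
    rewrite -[_ / _ *+ _]mulr_natr mulr_gt0 ?divr_gt0 ?ltr0n ?subn_gt0 //=.
    rewrite mulrAC ltr_pdivrMr // ltr_pM2l // ltr_nat.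
    by apply: leq_ltn_trans jn; rewrite leq_subr.
  move: lk; rewrite neq_ltn => /orP[h|h] e; first exact: key h kn e.
  exact: key h ln (esym e).
apply: (mulfI x1); rewrite mulr0 -subrX1 /x expr_div_n -!exprM mulnC exprM wn.
by rewrite mulnC exprM wn !expr1n divr1 subrr.
Qed.

Lemma circZ c phi r n : circ (fun z => c * phi z) r n = c * circ phi r n.
Proof. by rewrite /circ /riem mulr_sumr; apply: eq_bigr => j _; rewrite mulrA. Qed.

Lemma circ_sum (I : Type) (q : seq I) (F : I -> cfun R) r n :
  circ (fun z => \sum_(i <- q) F i z) r n = \sum_(i <- q) circ (F i) r n.
Proof.
rewrite /circ /riem exchange_big /=; apply: eq_bigr => j _.
by rewrite mulr_suml.
Qed.

Lemma circ_le phi r n (e : R) : (0 < n)%N -> 0 < r ->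
  (forall z : R[i], nc z = r -> nc (phi z) <= e) -> nc (circ phi r n) <= e * (pi *+ 2).
Proof.
move=> n0 r0 h; apply: riem_le => //; first by rewrite mulrn_wge0 ?pi_ge0.
by move=> t _; apply: h; rewrite ncM nc_expi mulr1 nc_real gtr0_norm.
Qed.

Lemma circ_coef a r0 r k phi : 0 < r -> r < r0 -> decay r0 a ->
  (forall z : R[i], nc z = r -> phi z = ev a z) ->
  forall c : R, 0 < c -> exists N0, forall N, (N0 <= N)%N ->
    nc (circ (fun z => phi z / z ^+ k) r (2 ^ N) - a k * (pi *+ 2)%:C) <= c.
Proof.
move=> rp rr0 [C hC] phiE c c0; have r00 : 0 < r0 by exact: lt_trans rr0.
have pi0 : 0 < pi *+ 2 :> R by rewrite mulr2n addr_gt0 ?pi_gt0.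
have q01 : 0 <= r / r0 < 1 by rewrite divr_ge0 ?ltW //= ltr_pdivrMr // mul1r.
have c'0 : 0 < c / (pi *+ 2) * r ^+ k by rewrite mulr_gt0 ?divr_gt0 ?exprn_gt0.
have [N1 hN1] := geo_to0 (C / (1 - r / r0)) q01 c'0.
exists (maxn N1 k.+1) => N; rewrite geq_max => /andP[N1N kN].
have n0 : (0 < 2 ^ N)%N by rewrite expn_gt0.
have NN : (N <= 2 ^ N)%N by apply: ltnW; exact: ltn_expl.
set n := (2 ^ N)%N in n0 NN *.
have kn : (k < n)%N by exact: leq_trans NN.
pose pn : cfun R := fun z => \sum_(l < n) a l * (z ^+ l / z ^+ k).
have -> : a k * (pi *+ 2)%:C = circ pn r n.
  rewrite circ_sum (bigD1 (Ordinal kn)) //= circZ circ_monomial // eqxx.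
  rewrite big1 ?addr0 // => l lk; rewrite circZ circ_monomial // ifN ?mulr0 //.
rewrite /circ -riemB -[leRHS](divfK (lt0r_neq0 pi0)).
apply: (@circ_le (fun z => phi z / z ^+ k - pn z)) => // z zr.
have -> : phi z / z ^+ k - pn z = (ev a z - \sum_(l < n) a l * z ^+ l) / z ^+ k.
  by rewrite phiE // mulrBl mulr_suml; congr (_ - _); apply: eq_bigr => l _; rewrite mulrA.
rewrite ncM ncV ncX zr ler_pdivrMr ?exprn_gt0 // ncBC.
have zr0 : nc z < r0 by rewrite zr.
apply: (le_trans (ev_tail r00 zr0 hC n)); rewrite zr.
have := hN1 n (leq_trans N1N NN); rewrite mulrAC -mulrA => /ltW; apply: le_trans.
by rewrite mulrA lexx.
Qed.

Lemma bounded_on_circle phi r : 0 < r -> (forall z : R[i], nc z = r -> ceps phi z) ->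
  exists B : R, forall z : R[i], nc z = r -> nc (phi z) <= B.
Proof.
move=> r0 h.
have phic : continuous (fun t : R => nc (phi (r%:C * expi t))).
  move=> t; have z1 : nc (r%:C * expi t) = r by rewrite ncM nc_expi mulr1 nc_real gtr0_norm.
  apply/cvgrPdist_lt => e e0; have [d d0 hd] := h _ z1 _ e0.
  have [d' d'0 hd'] := circle_pt_continuous r t d0; apply/nbhs_ballP; exists d' => // t' tt.
  rewrite /= distrC; apply: (@le_lt_trans _ _ (nc (phi (r%:C * expi t') - phi (r%:C * expi t)))).
    by rewrite ler_norml ler_ncB andbT; have := ler_ncB (phi (r%:C * expi t)) (phi (r%:C * expi t')); rewrite ncBC; lra.
  by apply: hd; apply: hd'; rewrite ?subrr ?normr0 // distrC.
have [|c _ hc] := EVT_max _ (continuous_subspaceT phic) (a := 0) (b := pi *+ 2).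
  by rewrite mulrn_wge0 ?pi_ge0.
exists (nc (phi (r%:C * expi c))) => z zr; have [t ht ->] := polar z; rewrite zr; exact: hc.
Qed.

Lemma ceps_derivable phi z : derivable phi z 1 -> ceps phi z.
Proof. exact: derivable_eps_continuous. Qed.

Lemma derivable_powV k z : z != 0 -> derivable ((fun w => (w ^+ k)^-1) : cfun R) z 1.
Proof.
move=> z0; apply: derivableV; first by rewrite expf_neq0.
have := @derivable_horner R 'X^k z.
by congr (derivable _ z 1); apply/funext => w; rewrite hornerXn.
Qed.

(* The circle on which [f] is only continuous is needed for the difference quotient
   of [identity_theorem]. *)
Lemma cauchy_decay f a r1 r0 s rho : 0 < r1 -> r1 < r0 -> decay r0 a ->
  (forall z : R[i], r1 < nc z < s -> ceps f z) ->
  (forall z : R[i], r1 < nc z < s -> nc z != rho -> derivable f z 1) ->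
  (forall z : R[i], r1 < nc z < r0 -> f z = ev a z) ->
  forall s', 0 < s' < s -> decay s' a.
Proof.
move=> r10 r1r0 ha fc fd fE s' /andP[s'0 s's].
have r00 : 0 < r0 by exact: lt_trans r1r0.
have [s'r0|r0s'] := leP s' r0; first by apply: decay_le ha => //; exact: ltW.
have [rl rh] := midf_lt r1r0; set r := _ / 2 in rl rh.
have rp : 0 < r by exact: lt_trans rl.
have rs' : r <= s' by apply: ltW; exact: lt_trans r0s'.
have bnd z : r <= nc z <= s' -> r1 < nc z < s.
  by move=> /andP[z1 z2]; rewrite (lt_le_trans rl) // (le_lt_trans z2).
have z0P z : r <= nc z -> z != 0 by move=> zr; rewrite -nc_gt0 (lt_le_trans rp).
have [B hB] : exists B : R, forall z : R[i], nc z = s' -> nc (f z) <= B.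
  by apply: bounded_on_circle => // z zs; apply/fc/bnd; rewrite zs lexx rs'.
have pi0 : 0 < pi *+ 2 :> R by rewrite mulr2n addr_gt0 ?pi_gt0.
(* The circle sums of f(z) / z^k tend to 2 pi a_k at radius [r], where [f] is the series. At radius
   s' they are at most 2 pi B / s'^k, and the two radii have asymptotically equal sums. *)
exists B => k; rewrite -ler_pdivlMr ?exprn_gt0 //.
rewrite -(ler_pM2r pi0); apply/ler_addgt0Pr => e e0.
have e2 : 0 < e / 2 by rewrite divr_gt0.
have [||N1 h1] := @circ_const_cross R (fun z => f z / z ^+ k) r s' rho rp rs' _ _ _ e2.
- move=> z zr; apply: cepsM; first exact/fc/bnd.
  by apply/ceps_derivable/derivable_powV/z0P; have /andP[] := zr.
- move=> z zr zrho; apply: derivable_mul; first by apply: fd => //; exact: bnd.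
  by apply/derivable_powV/z0P; have /andP[] := zr.
have [|N2 h2] := @circ_coef a r0 r k f rp rh ha _ _ e2.
  by move=> z zr; apply: fE; rewrite zr rl rh.
pose N := maxn N1 N2; have n0 : (0 < 2 ^ N)%N by rewrite expn_gt0.
have {}h1 := h1 N (leq_maxl _ _); have {}h2 := h2 N (leq_maxr _ _).
have h3 : nc (circ (fun z => f z / z ^+ k) s' (2 ^ N)) <= B / s' ^+ k * (pi *+ 2).
  apply: circ_le => // z zs; rewrite ncM ncV ncX zs ler_wpM2r ?invr_ge0 ?exprn_ge0 ?(ltW s'0) //.
  exact: hB.
have -> : nc (a k) * (pi *+ 2) = nc (a k * (pi *+ 2)%:C).
  by rewrite ncM nc_real (gtr0_norm pi0).
move: h1 h2 h3; move: (circ _ s' _) (circ _ r _) (a k * _) => u v w h1 h2 h3.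
have := nc_le_sub w v; rewrite ncBC => h4; have := nc_le_sub v u; rewrite ncBC => h5.
lra.
Qed.

(** Near 0 the difference quotient of [g] at z0 is -g(z0) / (z - z0), with coefficients g(z0) /
    z0^(k+1). Given the derivative as its value at z0 it is continuous on the whole disc and
    differentiable off the circle through z0, so these coefficients decay at some s' > |z0|, which
    forces g(z0) = 0. *)
Lemma identity_theorem (g : cfun R) r0 s : 0 < r0 -> r0 <= s ->
  (forall z : R[i], nc z < s -> derivable g z 1) ->
  (forall z : R[i], nc z < r0 -> g z = 0) -> forall z : R[i], nc z < s -> g z = 0.
Proof.
move=> r00 r0s gd g0 z0 z0s; have [z0r|rz0] := ltP (nc z0) r0; first exact: g0.
have z00 : z0 != 0 by rewrite -nc_gt0 (lt_le_trans r00).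
have nz0 : 0 < nc z0 by rewrite nc_gt0.
have [d hd] := (derivable_epsP _ _).1 (gd _ z0s).
pose q : cfun R := fun z => if z == z0 then d else (g z - g z0) / (z - z0).
pose a k : R[i] := g z0 / z0 * (z0^-1) ^+ k.
have hq1 : decay (nc z0) (fun k => z0^-1 ^+ k).
  by exists 1 => k; rewrite ncX ncV exprVn mulVf // expf_neq0 // gt_eqF.
have ha : decay (nc z0) a by exact: decayZ.
have qd z : nc z < s -> z != z0 -> derivable q z 1.
  move=> zs zn; apply: (@eq_near_derivable _ (fun w => (g w - g z0) * (w - z0)^-1) q z (nc (z - z0))).
  - by rewrite nc_gt0 subr_eq0.
  - by move=> w wz; rewrite /q; case: eqP wz => // ->; rewrite ncBC ltxx.
  - apply: derivable_mul; first by apply: derivableB; [exact: gd | exact: derivable_cst].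
    apply: derivableV; first by rewrite subr_eq0.
    by apply: derivableB; [exact: derivable_id | exact: derivable_cst].
have qc z : nc z < s -> ceps q z.
  move=> zs; have [->|zn] := eqVneq z z0; last by apply: ceps_derivable; exact: qd.
  move=> e e0; have e2 : 0 < e / 2 by rewrite divr_gt0.
  have [r rp hr] := hd _ e2; exists r => // w wr; rewrite /q eqxx.
  case: eqP => [_|/eqP wn]; first by rewrite subrr nc0.
  have wn0 : w - z0 != 0 by rewrite subr_eq0.
  have -> : (g w - g z0) / (w - z0) - d = (g w - g z0 - d * (w - z0)) / (w - z0).
    by rewrite [RHS]mulrBl mulfK.
  rewrite ncM ncV; apply: (@le_lt_trans _ _ (e / 2)); last by lra.
  by rewrite ler_pdivrMr ?nc_gt0 //; exact: hr.
have [s'l s'h] := midf_lt z0s; set s' := _ / 2 in s'l s'h.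
have [|||||||C hC] := @cauchy_decay q a (r0 / 2) r0 s (nc z0) _ _ _ _ _ _ s'.
- by rewrite divr_gt0.
- by lra.
- by apply: decay_le ha => //; exact: ltW.
- by move=> z /andP[_ zs]; exact: qc.
- by move=> z /andP[_ zs] zz0; apply: qd => //; apply: contraNneq zz0 => ->.
- move=> z /andP[_ zr]; have zz0 : nc z < nc z0 by exact: lt_le_trans rz0.
  have zn : z != z0 by apply: contraTneq zz0 => ->; rewrite ltxx.
  rewrite /q (negPf zn) g0 // sub0r; symmetry.
  rewrite (@evZ _ (nc z0) (g z0 / z0) (fun k => z0^-1 ^+ k)) //.
  have u1 : 1 - z / z0 != 0.
    by rewrite subr_eq0; apply: contraNneq zn => /(congr1 (fun w => w * z0)); rewrite mul1r divfK // => ->.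
  have zz : z0 - z != 0 by rewrite subr_eq0 eq_sym.
  have zz' : z - z0 != 0 by rewrite subr_eq0.
  rewrite (_ : ev _ z = (1 - z / z0)^-1).
    by field; rewrite z00 zz zz'.
  apply: (mulfI u1); rewrite divff // -(ev_lin z0 nz0 zz0) //.
  rewrite (_ : conv _ _ = coefs 1) ?ev_coefs ?hornerC //.
  apply/funext => -[|k]; first by rewrite conv_lin0 /coefs coef1.
  by rewrite conv_linS /coefs coef1 exprS subrr.
- by rewrite s'h (lt_trans nz0).
have t1 : 1 < s' / nc z0 by rewrite ltr_pdivlMr // mul1r.
apply/eqP; apply: contraT => gz0.
have p0 : 0 < nc (g z0 / z0) by rewrite nc_gt0 mulf_neq0 // invr_eq0.
have q01 : 0 <= nc z0 / s' < 1 by rewrite divr_ge0 ?(ltW nz0) ?(ltW (lt_trans nz0 s'l)) //= ltr_pdivrMr ?mul1r // (lt_trans nz0).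
have [N hN] := geo_to0 C q01 p0.
have := hN N (leqnn N); have := hC N.
rewrite ncM ncX ncV -mulrA -exprMn.
have -> : ((nc z0)^-1 * s') = (nc z0 / s')^-1 by rewrite invf_div mulrC.
rewrite exprVn ler_pdivrMr; last by rewrite exprn_gt0 // divr_gt0 // (lt_trans nz0).
by move=> h1 h2; have := le_lt_trans h1 h2; rewrite ltxx.
Qed.

End CauchyEstimate.

(** * Partial fractions for poles on one circle *)

Section PartialFractions.
Context {R : realType}.
Implicit Types (y h : nat -> R[i]) (p q z : R[i]) (r s : R) (S : seq R[i]) (n k m : nat).

Lemma binomial_growth m : exists2 C : R, 0 < C & forall k, (0 < k)%N ->
  'C(k + m, m)%:R <= C * k%:R ^+ m.
Proof.
elim: m => [|m [C C0 IH]].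
  by exists 1 => // k _; rewrite bin0 expr0 mulr1.
exists (C * (m.+2)%:R); first by rewrite mulr_gt0.
move=> k k0; have := mul_bin_diag (k + m).+1 m; rewrite -addnS /= => e.
have : ('C(k + m.+1, m.+1)%:R : R) <= (k + m.+1)%:R * 'C(k + m, m)%:R.
  by rewrite -natrM addnS /= in e *; rewrite e ler_nat leq_pmull.
move=> h; apply: (le_trans h).
have h1 : ((k + m.+1)%:R : R) <= (m.+2)%:R * k%:R.
  rewrite -natrM ler_nat; nia.
apply: (@le_trans _ _ ((m.+2)%:R * k%:R * (C * k%:R ^+ m))).
  by apply: ler_pM => //; exact: IH.
by rewrite exprS le_eqVlt; apply/orP; left; apply/eqP; ring.
Qed.

(** The absorption identity (m+2) C(k+m+2, m+2) = (k+m+2) C(k+m+1, m+1) carries the estimate from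
    one m to the next. *)
Lemma binomial_asymp m : exists C : R, forall k, (0 < k)%N ->
  `|'C(k + m.+1, m.+1)%:R - k%:R ^+ m.+1 / (m.+1)`!%:R| <= C * k%:R ^+ m.
Proof.
elim: m => [|m [C IH]].
  exists 1 => k _; rewrite addn1 bin1 factS fact0 muln1 divr1 expr1 expr0 mulr1.
  by rewrite -natr1 addrAC subrr add0r normr1.
have [B B0 hB] := binomial_growth m.+1.
exists (C + B) => k k0.
have m2 : (m.+2)%:R != 0 :> R by rewrite pnatr_eq0.
have e : ('C(k + m.+2, m.+2)%:R : R) = 'C(k + m.+1, m.+1)%:R * (k + m.+2)%:R / (m.+2)%:R.
  apply: (mulIf m2); rewrite divfK // -!natrM; congr (_%:R).
  by have := mul_bin_diag (k + m.+1).+1 m.+1; rewrite -addnS /= addnS /= mulnC [RHS]mulnC => ->.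
have -> : 'C(k + m.+2, m.+2)%:R - k%:R ^+ m.+2 / (m.+2)`!%:R =
   ('C(k + m.+1, m.+1)%:R - k%:R ^+ m.+1 / (m.+1)`!%:R) * (k%:R / (m.+2)%:R)
   + 'C(k + m.+1, m.+1)%:R :> R.
  rewrite e factS natrM natrD [k%:R ^+ m.+2]exprS; field.
  by rewrite -natrD !pnatr_eq0 /= -lt0n fact_gt0.
apply: (le_trans (ler_normD _ _)); rewrite [leRHS]mulrDl; apply: lerD; last first.
  by rewrite ger0_norm //; exact: hB.
rewrite normrM [_ ^+ m.+1 in leRHS]exprSr [leRHS]mulrA; apply: ler_pM => //; first exact: IH.
rewrite ger0_norm ?divr_ge0 // ler_pdivrMr ?ltr0n // ler_peMr //.
by rewrite ler1n.
Qed.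

(** The coefficients of (1 - z / p)^-n. *)
Definition geo n p : nat -> R[i] := fun k =>
  if n is n'.+1 then 'C(k + n', n')%:R * p ^- k else coefs 1 k.

Lemma conv_lin_geo n p : p != 0 -> conv (coefs (lin p)) (geo n.+1 p) = geo n p.
Proof.
move=> p0; apply/funext => -[|k]; rewrite ?conv_lin0 ?conv_linS.
  rewrite /geo add0n binn expr0 invr1 mulr1; case: n => [|n].
    by rewrite /coefs coef1.
  by rewrite add0n binn mulr1.
rewrite /geo exprS invfM; case: n => [|n].
  by rewrite /coefs coef1 /= !bin0 !mul1r subrr.
have -> : (k.+1 + n.+1 = (k + n.+1).+1)%N by rewrite addSn.
by rewrite binS natrD addSnnS; ring.
Qed.

Lemma conv_geo n p : p != 0 -> conv (coefs (lin p ^+ n)) (geo n p) = coefs 1.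
Proof.
move=> p0; elim: n => [|n IH]; first by rewrite expr0 conv1.
by rewrite exprSr -conv_coefs -convA conv_lin_geo.
Qed.

Definition polesP S : {poly R[i]} := \prod_(p <- S) lin p.
Definition polesPx S p : {poly R[i]} := \prod_(q <- S | q != p) lin q.

Lemma polesP_D1 S p : uniq S -> p \in S -> polesP S = lin p * polesPx S p.
Proof. by move=> uS pS; rewrite /polesP (bigD1_seq p). Qed.

Lemma lin_root p : p != 0 -> (lin p).[p] = 0.
Proof. by move=> p0; rewrite horner_lin divff // subrr. Qed.

Lemma polesPx_eq0 S p q : p != 0 -> p \in S -> p != q -> (polesPx S q).[p] = 0.
Proof.
move=> p0 pS pq; rewrite /polesPx horner_prod (big_rem p) //= pq.
by rewrite lin_root // mul0r.
Qed.

Lemma polesPx_neq0 S p : (forall q, q \in S -> q != 0) -> (polesPx S p).[p] != 0.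
Proof.
move=> S0; rewrite /polesPx horner_prod prodf_seq_neq0; apply/allP => q qS; apply/implyP => qp.
rewrite horner_lin subr_eq0; apply: contraNneq qp => /(congr1 (fun w => w * q)).
by rewrite mul1r divfK ?S0 // => ->.
Qed.

Lemma conv_lins_inj S n a b :
  conv (coefs (polesP S ^+ n)) a = conv (coefs (polesP S ^+ n)) b -> a = b.
Proof.
elim: n a b => [|n IH] a b; first by rewrite expr0 !conv1.
rewrite exprSr -conv_coefs -!convA => /IH; rewrite /polesP.
elim: S {IH} a b => [|p S IH] a b; first by rewrite big_nil !conv1.
by rewrite big_cons -conv_coefs -!convA => /conv_lin_inj/IH.
Qed.

Lemma divide_roots S s h : 0 < s -> uniq S -> (forall p, p \in S -> p != 0 /\ nc p < s) ->
  decay s h -> (forall p, p \in S -> ev h p = 0) ->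
  exists2 g, decay s g & h = conv (coefs (polesP S)) g.
Proof.
move=> s0; elim: S h => [|p S IH] h uS hS hh h0.
  by exists h => //; rewrite /polesP big_nil conv1.
move: uS => /= /andP[pS uS]; have [p0 ps] := hS p (mem_head _ _).
have [g hg hE] := divide_root s0 p0 ps hh (h0 p (mem_head _ _)).
have [||f hf gE] := IH g uS _ hg.
- by move=> q qS; apply: hS; rewrite inE qS orbT.
- move=> q qS; have [q0 qs] : q != 0 /\ nc q < s by apply: hS; rewrite inE qS orbT.
  have := h0 q; rewrite inE qS orbT => /(_ isT); rewrite hE (ev_lin p s0 qs hg) => /eqP.
  rewrite mulf_eq0 => /orP[|/eqP //]; rewrite subr_eq0 => /eqP e.
  have qp : q = p by rewrite -[q](divfK p0) -e mul1r.
  by move: pS; rewrite -qp qS.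
- by exists f => //; rewrite hE gE /polesP big_cons -conv_coefs convA.
Qed.

Section Poles.
Variables (S : seq R[i]) (r s : R).
Hypotheses (r0 : 0 < r) (rs : r < s) (uS : uniq S) (Sr : forall p, p \in S -> nc p = r).

Let s0 : 0 < s. Proof. exact: lt_trans rs. Qed.
Let S0 p : p \in S -> p != 0. Proof. by move=> /Sr e; rewrite -nc_gt0 e. Qed.

(* The coefficient of [(1 - z / p)^-n] in the partial fractions of [ev h / polesP S ^ n]. *)
Definition pf_coef n h p := ev h p / (polesPx S p).[p] ^+ n.

(** The top-order terms of all poles are removed at once. Over the common denominator the term of q
    has numerator ([polesPx S q])^(n+1), which vanishes at the other poles; the choice of [pf_coef]
    thus makes the new numerator vanish on all of [S], and one factor [polesP S] cancels. *)
Lemma partial_fraction_step n y h : decay s h -> conv (coefs (polesP S ^+ n.+1)) y = h ->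
  exists2 h', decay s h' & conv (coefs (polesP S ^+ n))
    (fun k => y k - \sum_(p <- S) pf_coef n.+1 h p * geo n.+1 p k) = h'.
Proof.
move=> hh yE; set c := pf_coef n.+1 h; set y' := fun k => _.
pose h1 k := h k - \sum_(p <- S) c p * coefs (polesPx S p ^+ n.+1) k.
have h1d : decay s h1.
  by apply: decayB; rewrite ?ltW //; apply: decay_sum => [|p _]; [exact: ltW | exact/decayZ/decay_coefs].
have h1E : conv (coefs (polesP S ^+ n.+1)) y' = h1.
  rewrite /y' convBr yE conv_sumr; apply/funext => k; rewrite /h1; congr (_ - _).
  apply: eq_big_seq => p pS; rewrite convZr; congr (_ * _).
  rewrite (polesP_D1 uS pS) exprMn mulrC -conv_coefs -convA conv_geo ?S0 //.
  by rewrite convC conv1.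
have [||h2 h2d h2E] := @divide_roots S s h1 s0 uS _ h1d.
- by move=> p pS; rewrite S0 // Sr.
- move=> p pS; have ps : nc p < s by rewrite Sr.
  rewrite (evB s0 ps hh); last by apply: decay_sum => [|q _]; [exact: ltW | exact/decayZ/decay_coefs].
  rewrite (ev_sum _ s0 ps); last by move=> q _; exact/decayZ/decay_coefs.
  rewrite (bigD1_seq p) //= big1_seq ?addr0; last first.
    move=> q /andP[qp qS]; rewrite (evZ _ s0 ps (decay_coefs _ _)) ev_coefs horner_exp.
    by rewrite polesPx_eq0 ?S0 // 1?eq_sym // expr0n mulr0.
  rewrite (evZ _ s0 ps (decay_coefs _ _)) ev_coefs horner_exp /c /pf_coef divfK ?subrr //.
  by rewrite expf_neq0 // polesPx_neq0.
exists h2 => //; move: h1E; rewrite h2E exprS -conv_coefs -convA.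
rewrite -[polesP S in LHS]expr1 -[polesP S in RHS]expr1.
by move/conv_lins_inj.
Qed.

Lemma nc_geo n p k : p \in S -> nc (geo n.+1 p k) = 'C(k + n, n)%:R * r ^- k.
Proof.
by move=> pS; rewrite /geo ncM ncV ncX (Sr pS) nc_nat.
Qed.

Lemma growth_of_poles n y : decay s (conv (coefs (polesP S ^+ n.+1)) y) ->
  exists C : R, forall k, (0 < k)%N -> nc (y k) <= C * (k%:R ^+ n * r ^- k).
Proof.
elim: n y => [|n IH] y hy; have [h' hh' E] := partial_fraction_step hy erefl.
  set c := pf_coef 1 _ in E; rewrite expr0 conv1 in E.
  have [C C0 hC] := decay_pos hh'.
  exists (\sum_(p <- S) nc (c p) + C) => k k0; rewrite expr0 mul1r.
  have -> : y k = \sum_(p <- S) c p * geo 1 p k + h' k by rewrite -E addrC subrK.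
  apply: (le_trans (ncD _ _)); rewrite mulrDl; apply: lerD.
    apply: (le_trans (nc_sum _ _ _)); rewrite mulr_suml big_seq [leRHS]big_seq.
    by apply: ler_sum => p pS; rewrite ncM nc_geo // bin0 mul1r.
  rewrite ler_pdivlMr ?exprn_gt0 //; apply: le_trans (hC k).
  by rewrite ler_wpM2l ?nc_ge0 // lerXn2r // ?nnegrE ?ltW.
move: (hh'); rewrite -E => /IH[C hC].
set c := pf_coef n.+2 _ in E hC.
have [B B0 hB] := binomial_growth n.+1.
exists (\sum_(p <- S) nc (c p) * B + `|C|) => k k0.
have -> : y k = \sum_(p <- S) c p * geo n.+2 p k +
    (y k - \sum_(p <- S) c p * geo n.+2 p k) by rewrite addrC subrK.
have rk0 : 0 <= r ^- k by rewrite invr_ge0 exprn_ge0 // ltW.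
apply: (le_trans (ncD _ _)); rewrite mulrDl; apply: lerD.
  apply: (le_trans (nc_sum _ _ _)); rewrite mulr_suml big_seq [leRHS]big_seq.
  apply: ler_sum => p pS; rewrite ncM nc_geo // -mulrA ler_wpM2l ?nc_ge0 //.
  by rewrite mulrA ler_wpM2r // hB.
apply: (le_trans (hC k k0)); apply: (@le_trans _ _ (`|C| * (k%:R ^+ n * r ^- k))).
  by rewrite ler_wpM2r ?ler_norm // mulr_ge0 // exprn_ge0.
rewrite ler_wpM2l // ler_wpM2r // exprS ler_peMl ?exprn_ge0 //.
by rewrite ler1n.
Qed.

(** Removing the leading terms lowers the pole order by one. At order 1 nothing but a series of
    larger radius remains, whence an exponentially smaller error. At higher order the remaining
    poles, and the replacement of a binomial coefficient by its leading monomial, each cost one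
    power of k. *)
Lemma leading_asymp n y h : decay s h -> conv (coefs (polesP S ^+ n.+1)) y = h ->
  exists C : R, forall k, (0 < k)%N ->
  nc (y k - (k%:R ^+ n / n`!%:R * r ^- k)%:C * \sum_(p <- S) pf_coef n.+1 h p * (r%:C / p) ^+ k)
    <= C * (if n is n'.+1 then k%:R ^+ n' * r ^- k else s ^- k).
Proof.
move=> hh yE; have [h' hh' E] := partial_fraction_step hh yE.
set c := pf_coef n.+1 h in E *.
have rC : r%:C != 0 :> R[i] by rewrite -nc_eq0 nc_real normr_eq0 gt_eqF.
have rCk k : (r ^- k)%:C * (r%:C) ^+ k = 1 :> R[i].
  by rewrite -rmorphXn /= -rmorphM /= mulVf // expf_neq0 // gt_eqF.
case: n => [|n] in c E yE *.
  have [C C0 hC] := decay_pos hh'; exists C => k k0.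
  rewrite expr0 fact0 divr1 mul1r mulr_sumr.
  have -> : y k - \sum_(p <- S) (r ^- k)%:C * (c p * (r%:C / p) ^+ k) = h' k.
    rewrite -E expr0 conv1; congr (_ - _); apply: eq_bigr => p _.
    by rewrite /geo bin0 mul1r expr_div_n -[in RHS](mulr1 (c p)) -(rCk k); ring.
  by rewrite ler_pdivlMr ?exprn_gt0.
have [C hC] : exists C : R, forall k, (0 < k)%N ->
   nc (y k - \sum_(p <- S) c p * geo n.+2 p k) <= C * (k%:R ^+ n * r ^- k).
  by move: hh'; rewrite -E => /growth_of_poles.
have [B hB] := binomial_asymp n.
exists (C + \sum_(p <- S) nc (c p) * B) => k k0.
have rk0 : 0 <= r ^- k by rewrite invr_ge0 exprn_ge0 // ltW.
set G := \sum_(p <- S) c p * geo n.+2 p k.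
rewrite -(subrK G (y k)) -addrA; apply: (le_trans (ncD _ _)).
rewrite mulrDl; apply: lerD; first exact: hC.
rewrite /G mulr_sumr -sumrB; apply: (le_trans (nc_sum _ _ _)).
rewrite mulr_suml big_seq [leRHS]big_seq; apply: ler_sum => p pS.
have -> : c p * geo n.+2 p k - (k%:R ^+ n.+1 / (n.+1)`!%:R * r ^- k)%:C * (c p * (r%:C / p) ^+ k)
   = c p * (('C(k + n.+1, n.+1)%:R - k%:R ^+ n.+1 / (n.+1)`!%:R : R)%:C * p ^- k).
  rewrite /geo [X in _ = _ * (X * _)]rmorphB /= rmorph_nat mulrBl mulrBr; congr (_ - _).
  by rewrite rmorphM expr_div_n -[RHS]mulr1 -(rCk k); ring.
rewrite ncM -mulrA ler_wpM2l ?nc_ge0 // ncM ncV ncX (Sr pS) nc_real mulrA ler_wpM2r //.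
exact: hB.
Qed.

End Poles.
End PartialFractions.

(** * Real series and their link with [ev] and [decay] *)

Section RealSeries.
Context {R : realType}.
Implicit Types (u v : nat -> R) (a b c : R).

Lemma series_cvgD u v a b : series u @ \oo --> a -> series v @ \oo --> b ->
  series (fun k => u k + v k) @ \oo --> a + b.
Proof.
move=> hu hv; rewrite (_ : series _ = series u + series v); first exact: cvgD.
by apply/funext => n; rewrite /series /= fctE big_split.
Qed.

Lemma series_cvgZ c u a : series u @ \oo --> a -> series (fun k => c * u k) @ \oo --> c * a.
Proof.
move=> hu; rewrite (_ : series _ = cst c * series u).
  by apply: cvgM => //; exact: cvg_cst.
by apply/funext => n; rewrite /series /= fctE mulr_sumr.
Qed.

Lemma series_cvg_sum (I : Type) (r : seq I) (P : pred I) (F : I -> nat -> R) (a : I -> R) :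
  (forall i, P i -> series (F i) @ \oo --> a i) ->
  series (fun k => \sum_(i <- r | P i) F i k) @ \oo --> \sum_(i <- r | P i) a i.
Proof.
move=> h; elim: r => [|i r IH].
  rewrite big_nil; under [X in series X]eq_fun do rewrite big_nil.
  rewrite (_ : series _ = cst 0); first exact: cvg_cst.
  by apply/funext => n; rewrite /series /= big1.
rewrite big_cons; under [X in series X]eq_fun do rewrite big_cons.
by case: ifP => // Pi; apply: series_cvgD => //; exact: h.
Qed.

Lemma series_limE u a : series u @ \oo --> a -> limn (series u) = a.
Proof. by move=> h; apply: cvg_lim. Qed.

Lemma series_partial_le u a : (forall k, 0 <= u k) -> series u @ \oo --> a ->
  forall n, \sum_(k < n) u k <= a.
Proof.
move=> u0 ua n; rewrite -(series_limE ua).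
have := @nondecreasing_cvgn_le R (series u) _ _ n; rewrite seriesEord /=; apply.
  apply/nondecreasing_seqP => m; rewrite /= !big_ord_recr /= lerDl; exact: u0.
by apply/cvg_ex; exists a; rewrite -[X in X @ _]seriesEord.
Qed.

Lemma series_term_le u a : (forall k, 0 <= u k) -> series u @ \oo --> a ->
  forall k, u k <= a.
Proof.
move=> u0 ua k; apply: le_trans (series_partial_le u0 ua k.+1).
by rewrite big_ord_recr /= lerDr sumr_ge0.
Qed.

Lemma series_cvg_ge0 u a : (forall k, 0 <= u k) -> series u @ \oo --> a -> 0 <= a.
Proof. by move=> u0 ua; have := series_partial_le u0 ua 0; rewrite big_ord0. Qed.

Lemma series_cvg_le u v a b : (forall k, u k <= v k) ->
  series u @ \oo --> a -> series v @ \oo --> b -> a <= b.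
Proof.
move=> uv ua vb; rewrite -subr_ge0.
apply: (@series_cvg_ge0 (fun k => v k + (-1) * u k)).
  by move=> k; rewrite mulN1r subr_ge0.
by rewrite -[- a]mulN1r; apply: series_cvgD => //; exact: series_cvgZ.
Qed.

Lemma series_cvg_lt u v a b k0 : (forall k, u k <= v k) -> u k0 < v k0 ->
  series u @ \oo --> a -> series v @ \oo --> b -> a < b.
Proof.
move=> uv uv0 ua vb; rewrite -subr_gt0; apply: (@lt_le_trans _ _ (v k0 - u k0)).
  by rewrite subr_gt0.
rewrite -[u k0]mul1r -mulNr -[a]mul1r -mulNr.
apply: (@series_term_le (fun k => v k + (-1) * u k)).
  by move=> k; rewrite mulN1r subr_ge0.
by apply: series_cvgD => //; exact: series_cvgZ.
Qed.

Lemma ev_real (u : nat -> R) (r a : R) : series (fun k => u k * r ^+ k) @ \oo --> a ->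
  ev (fun k => (u k)%:C) r%:C = a%:C.
Proof.
move=> h; apply: limn_series => e e0.
have /cvgrPdist_lt/(_ _ e0)[N _ hN] := h; exists N => n Nn.
rewrite (_ : \sum_(k < n) _ = (\sum_(k < n) u k * r ^+ k)%:C).
  by rewrite -rmorphB nc_real distrC; have := hN n Nn; rewrite /= seriesEord.
by rewrite rmorph_sum; apply: eq_bigr => k _; rewrite rmorphM rmorphXn.
Qed.

Lemma cvg_decay (u : nat -> R) (r : R) : cvgn (series (fun k => u k * r ^+ k)) -> 0 <= r ->
  decay r (fun k => (u k)%:C).
Proof.
move=> h r0; have h0 := cvg_series_cvg_0 h.
have [B hB] : exists B : R, forall k, `|u k * r ^+ k| <= B.
  have /cvg_seq_bounded[B [_ hB]] : cvgn (fun k => u k * r ^+ k) by apply/cvg_ex; exists 0.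
  exists (B + 1) => k; apply: (hB (B + 1)) => //; by rewrite ltrDl.
by exists B => k; rewrite nc_real; have := hB k; rewrite normrM [`|r ^+ k|]ger0_norm // exprn_ge0.
Qed.

Lemma decay_cvg (u : nat -> R) (r s : R) : 0 <= r -> r < s -> decay s (fun k => (u k)%:C) ->
  cvgn (series (fun k => u k * r ^+ k)).
Proof.
move=> r0 rs [C hC]; have s0 : 0 < s by exact: le_lt_trans rs.
have q01 : 0 <= r / s < 1 by rewrite divr_ge0 ?(ltW s0) //= ltr_pdivrMr // mul1r.
apply: (real_normed_geo_cvg (C := C) q01) => k.
have := decay_term (r%:C) s0 hC k; rewrite ncM ncX !nc_real (ger0_norm r0) normrM.
by rewrite [`|r ^+ k|]ger0_norm // exprn_ge0.
Qed.

End RealSeries.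

(** * Perron-Frobenius theory of nonnegative matrices *)

Section Perron.
Context {R : realType} {M : nat}.
Implicit Types (X : 'M[R]_M) (v w y : 'I_M -> R) (s : R).

Definition mact X w (i : 'I_M) : R := \sum_j X i j * w j.
(** The action of I + X. The identity summand makes iterates monotone on nonnegative vectors, so
    positivity once gained is kept and irreducibility alone spreads it to every coordinate. *)
Definition smooth X w (i : 'I_M) : R := w i + mact X w i.

Lemma mactD X v w i : mact X (fun j => v j + w j) i = mact X v i + mact X w i.
Proof. by rewrite /mact -big_split; apply: eq_bigr => j _; rewrite mulrDr. Qed.

Lemma mactZ X s w i : mact X (fun j => s * w j) i = s * mact X w i.
Proof. by rewrite /mact mulr_sumr; apply: eq_bigr => j _; rewrite mulrCA. Qed.

Lemma mact_ge0 X w i : nonneg_mx X -> (forall j, 0 <= w j) -> 0 <= mact X w i.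
Proof. by move=> X0 w0; apply: sumr_ge0 => j _; apply: mulr_ge0. Qed.

(** Pairing with [w] gives s (y w) <= y X w < s (y w) as soon as y has a positive entry. It is
    applied to moduli of null vectors and to negative parts of solutions. *)
Lemma row_subsolution0 X s w y : (forall i, 0 < w i) -> (forall i, mact X w i < s * w i) ->
  (forall j, 0 <= y j) -> (forall j, s * y j <= \sum_i y i * X i j) -> forall j, y j = 0.
Proof.
move=> w0 hw y0 hy j; apply/eqP; rewrite eq_le y0 andbT leNgt; apply/negP => yj.
have : \sum_j s * y j * w j < \sum_j s * y j * w j.
  apply: (@le_lt_trans _ _ (\sum_i y i * mact X w i)).
    apply: (@le_trans _ _ (\sum_j (\sum_i y i * X i j) * w j)).
      by apply: ler_sum => i _; rewrite ler_wpM2r ?(ltW (w0 i)).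
    under eq_bigr => l _ do rewrite mulr_suml.
    rewrite exchange_big /=; apply: ler_sum => i _; rewrite /mact mulr_sumr.
    by apply: ler_sum => l _; rewrite mulrA.
  rewrite (bigD1 j) //= [ltRHS](bigD1 j) //=; apply: ltr_leD.
    by rewrite -mulrA mulrCA ltr_pM2l.
  by apply: ler_sum => i _; rewrite -mulrA mulrCA ler_wpM2l // ltW.
by rewrite ltxx.
Qed.

Lemma smooth_ge X w i : nonneg_mx X -> (forall j, 0 <= w j) -> w i <= smooth X w i.
Proof. by move=> X0 w0; rewrite /smooth lerDl mact_ge0. Qed.

Lemma iter_smooth_ge0 X w n : nonneg_mx X -> (forall j, 0 <= w j) ->
  forall i, 0 <= iter n (smooth X) w i.
Proof.
move=> X0 w0; elim: n => [//|n IH] i /=.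
by apply: (le_trans (IH i)); exact: smooth_ge.
Qed.

Lemma iter_smooth_mono X w n m i : nonneg_mx X -> (forall j, 0 <= w j) -> (n <= m)%N ->
  iter n (smooth X) w i <= iter m (smooth X) w i.
Proof.
move=> X0 w0; elim: m => [|m IH]; first by rewrite leqn0 => /eqP->.
rewrite leq_eqVlt => /orP[/eqP->//|]; rewrite ltnS => /IH h; apply: (le_trans h).
by rewrite iterS; apply: smooth_ge => //; exact: iter_smooth_ge0.
Qed.

Lemma iter_smooth_comb X s v n i :
  iter n (smooth X) (fun i => s * v i - mact X v i) i =
  s * iter n (smooth X) v i - mact X (iter n (smooth X) v) i.
Proof.
elim: n i => [//|n IH] i; rewrite !iterS {1}/smooth IH.
have -> : mact X (iter n (smooth X) (fun i => s * v i - mact X v i)) i =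
    mact X (fun j => s * iter n (smooth X) v j + (-1) * mact X (iter n (smooth X) v) j) i.
  by apply: eq_bigr => j _; rewrite IH mulN1r.
rewrite mactD !mactZ /smooth mactD; ring.
Qed.

Lemma smooth_gt0 X y : nonneg_mx X -> irreducible_mx X -> (forall i, 0 <= y i) ->
  (exists i, 0 < y i) -> exists n, forall i, 0 < iter n (smooth X) y i.
Proof.
move=> X0 irr y0 [j yj].
have h i : exists n, 0 < iter n (smooth X) y i.
  elim: (irr i j) yj => [a ya|a b c Xab _ IH yc]; first by exists 0%N.
  have [n hn] := IH yc; exists n.+1 => /=.
  apply: ltr_wpDl; first exact: iter_smooth_ge0.
  rewrite /mact (bigD1 b) //=; apply: ltr_wpDr; last exact: mulr_gt0.
  by apply: sumr_ge0 => k _; apply: mulr_ge0; [exact: X0 | exact: iter_smooth_ge0].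
have [f hf] := choice h.
exists (\max_i f i) => i; apply: (lt_le_trans (hf i)).
by apply: iter_smooth_mono => //; exact: leq_bigmax.
Qed.

Lemma uniform_gap (f g : 'I_M -> R) : (forall i, f i < g i) -> (forall i, 0 < g i) ->
  exists2 e : R, 0 < e < 1 & forall i, f i <= (1 - e) * g i.
Proof.
move=> fg g0.
have h : \forall e \near (0 : R)^'+, forall i, f i <= (1 - e) * g i.
  apply: filter_forall => i.
  have c0 : 0 < (g i - f i) / g i by rewrite divr_gt0 ?subr_gt0.
  near=> e; rewrite mulrBl mul1r lerBrDr -lerBrDl -ler_pdivlMr //.
  by near: e; exact: nbhs_right_le.
near (0 : R)^'+ => e; exists e; last by near: e.
apply/andP; split; first by near: e; exact: nbhs_right_gt.
by near: e; exact: nbhs_right_lt.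
Unshelve. all: by end_near. Qed.

(** Powers of I + X commute with s I - X. Applied to [w] they spread the nonzero defect s w - X w to
    all coordinates. *)
Lemma strict_supersolution X s w : nonneg_mx X -> irreducible_mx X -> (forall i, 0 < w i) ->
  (forall i, mact X w i <= s * w i) -> (exists i, mact X w i < s * w i) ->
  exists2 w', (forall i, 0 < w' i) & forall i, mact X w' i < s * w' i.
Proof.
move=> X0 irr w0 h [i0 hi0].
have [||n hn] := @smooth_gt0 X (fun i => s * w i - mact X w i) X0 irr.
- by move=> i; rewrite subr_ge0.
- by exists i0; rewrite subr_gt0.
exists (iter n (smooth X) w) => i; last by have := hn i; rewrite iter_smooth_comb subr_gt0.
apply: (lt_le_trans (w0 i)); apply: (@iter_smooth_mono X w 0 n) => // j; exact: ltW.
Qed.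

(* Collatz-Wielandt: minimise [s] subject to [X v <= s v] over the probability vectors [v]. *)
Lemma perron_vector X : (0 < M)%N -> nonneg_mx X -> irreducible_mx X ->
  exists s v, (forall i, 0 < v i) /\ forall i, mact X v i = s * v i.
Proof.
move=> M0 X0 irr.
pose ok s v := [/\ forall i, 0 <= v i, \sum_i v i = 1 & forall i, mact X v i <= s * v i].
pose L := [set s : R | exists v, ok s v].
have i0 : 'I_M := Ordinal M0.
have MR : 0 < M%:R :> R by rewrite ltr0n.
have L0 : L !=set0.
  exists (\sum_i \sum_j X i j); exists (fun=> M%:R^-1); split.
  - by move=> i; rewrite invr_ge0 ltW.
  - by rewrite sumr_const card_ord -[LHS]mulr_natr mulVf // gt_eqF.
  - move=> i; rewrite /mact -mulr_suml ler_wpM2r ?invr_ge0 ?(ltW MR) //.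
    rewrite [leRHS](bigD1 i) //= lerDl sumr_ge0 // => k _; apply: sumr_ge0 => j _; exact: X0.
have Lb s : L s -> 0 <= s.
  move=> [v [v0 v1 hv]]; have -> : s = \sum_i s * v i by rewrite -mulr_sumr v1 mulr1.
  by apply: sumr_ge0 => i _; apply: le_trans (hv i); exact: mact_ge0.
have Linf : has_inf L by split=> //; exists 0 => s /Lb.
pose s0 := inf L.
have s0le s : L s -> s0 <= s by move=> Ls; apply: ge_inf => //; case: Linf.
have ex n : exists v : 'rV[R]_M, ok (s0 + n.+1%:R^-1) (fun j => v 0 j).
  have [|s Ls hs] := @inf_adherent R L n.+1%:R^-1 _ Linf; first by rewrite invr_gt0.
  have [v [v0 v1 hv]] := Ls; exists (\row_j v j).
  have vE : (fun j => (\row_j v j) 0 j) = v by apply/funext => j; rewrite mxE.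
  rewrite vE; split => // i; apply: (le_trans (hv i)); apply: ler_wpM2r => //.
  exact: ltW.
have [vv hvv] := choice ex.
have v01 n j : `[0, 1]%classic (vv n 0 j).
  have [v0 v1 _] := hvv n; rewrite /= in_itv /= v0 /=.
  by rewrite -v1 (bigD1 j) //= lerDl sumr_ge0.
have cK := @rV_compact R M (fun=> `[0, 1]%classic) (fun=> @segment_compact R 0 1).
have [|p [pK pcl]] := cK (vv @ \oo) _ _.
  by exists 0%N => // n _ /= j; exact: v01.
(* Closed conditions pass to the cluster point [p]. The slack e absorbs the excess 1 / (n + 1) of
   the minimising sequence. *)
have lim_le (phi : 'rV[R]_M -> R) (y : R) : continuous phi ->
    (forall e : R, 0 < e -> \forall n \near \oo, phi (vv n) <= y + e) -> phi p <= y.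
  move=> phic h; apply/ler_addgt0Pr => e /h he.
  move: pcl; rewrite clusterE => /(_ [set v | phi v <= y + e] he).
  by move/continuous_closedP: phic => /(_ _ (@closed_le R (y + e))); apply.
have coordc j : continuous (fun v : 'rV[R]_M => v 0 j) by exact: coord_continuous.
have sumc (c : 'I_M -> R) : continuous (fun v : 'rV[R]_M => \sum_j c j * v 0 j).
  apply: continuous_big => [|j _]; first exact: add_continuous.
  by move=> v; exact: (cvgM (cvg_cst _) (coordc j v)).
have pos j : 0 <= p 0 j by have := pK j; rewrite /= in_itv /= => /andP[].
have psum : \sum_j p 0 j = 1.
  have vsum n : \sum_j vv n 0 j = 1 by have [] := hvv n.
  apply/eqP; rewrite eq_le; apply/andP; split; last rewrite -lerN2.
    have := lim_le _ 1 (sumc (fun=> 1)); under eq_bigr do rewrite mul1r; apply => e e0.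
    by apply: nearW => n; under eq_bigr do rewrite mul1r; rewrite vsum lerDl ltW.
  have := lim_le _ (-1) (sumc (fun=> -1)); under eq_bigr do rewrite mulN1r; rewrite sumrN; apply => e e0.
  by apply: nearW => n; under eq_bigr do rewrite mulN1r; rewrite sumrN vsum lerDl ltW.
have psub i : mact X (fun j => p 0 j) i <= s0 * p 0 i.
  rewrite -subr_le0; apply: (lim_le (fun v : 'rV[R]_M => mact X (fun j => v 0 j) i - s0 * v 0 i) 0).
    by move=> v; exact: (cvgB (sumc _ v) (cvgM (cvg_cst _) (coordc i v))).
  move=> e e0; near=> n; have [_ _ /(_ i)] := hvv n; rewrite add0r lerBlDl => h; apply: (le_trans h).
  rewrite mulrDl lerD2l; apply: (@le_trans _ _ (e * 1)); last by rewrite mulr1.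
  have := v01 n i; rewrite /= in_itv /= => /andP[v0 v1].
  apply: ler_pM => //; near: n.
  have /cvgrPdist_le/(_ _ e0) := @cvg_harmonic R; apply: filterS => n.
  by rewrite /= sub0r normrN ger0_norm.
have pgt0 i : 0 < p 0 i.
  have [j pj] : exists j, 0 < p 0 j.
    apply: contrapT => /forallNP h; have : \sum_j p 0 j <= 0.
      by apply: sumr_le0 => j _; rewrite leNgt; apply/negP; exact: h.
    by rewrite psum ler10.
  elim: (irr i j) pj => [//|a b c Xab _ IH pc].
  have pb := IH pc; rewrite lt_def pos andbT; apply/eqP => pa.
  have := psub a; rewrite pa mulr0 leNgt => /negP; apply.
  rewrite /mact (bigD1 b) //=; apply: ltr_wpDr; last exact: mulr_gt0.
  by apply: sumr_ge0 => k _; apply: mulr_ge0; [exact: X0 | exact: pos].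
(* A strict inequality in one coordinate could be made strict in all of them, and then s0 could be
   lowered by a factor 1 - e, against its minimality. *)
exists s0, (fun j => p 0 j); split => // i; apply/eqP; rewrite eq_le psub /= leNgt; apply/negP => lti.
have [|w w0 hw] := strict_supersolution X0 irr pgt0 psub; first by exists i.
have s0gt : 0 < s0.
  by have := le_lt_trans (mact_ge0 i X0 (fun j => ltW (w0 j))) (hw i); rewrite pmulr_lgt0.
have [|e /andP[e0 e1] he] := uniform_gap hw; first by move=> k; exact: mulr_gt0.
have W0 : 0 < \sum_k w k.
  rewrite (bigD1 i0) //=; apply: ltr_wpDr => //; apply: sumr_ge0 => k _; exact: ltW.
have : L ((1 - e) * s0).
  exists (fun k => (\sum_k w k)^-1 * w k); split.
  - by move=> k; rewrite mulr_ge0 ?invr_ge0 ?ltW.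
  - by rewrite -mulr_sumr mulVf // gt_eqF.
  - move=> k; rewrite mactZ mulrCA ler_wpM2l ?invr_ge0 ?(ltW W0) // -mulrA; exact: he.
move/s0le; rewrite leNgt => /negP; apply; rewrite gtr_pMl //; lra.
Unshelve. all: by end_near. Qed.

(** [eigenvalue] refers to row vectors, the Perron vector is a column. Were the left kernel of X - s
    trivial, this square matrix would be invertible and could not kill the column. *)
Lemma real_right_eigenvalue X s v : (forall i, 0 < v i) -> (0 < M)%N ->
  (forall i, mact X v i = s * v i) -> eigenvalue (map_mx (real_complex R) X) s%:C.
Proof.
move=> v0 M0 hv; rewrite /eigenvalue /eigenspace kermx_eq0 row_free_unit.
apply/negP => /mulKmx h.
pose c : 'cV[R[i]]_M := \col_i (v i)%:C.
have Ac : (map_mx (real_complex R) X - (s%:C)%:M) *m c = 0.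
  rewrite mulmxBl mul_scalar_mx; apply/matrixP => i j; rewrite !mxE -rmorphM -hv rmorph_sum.
  rewrite (eq_bigr (fun k => (X i k * v k)%:C)) ?subrr // => k _.
  by rewrite !mxE rmorphM.
have := h _ c; rewrite Ac mulmx0 => /matrixP/(_ (Ordinal M0) 0); rewrite !mxE => /esym/eqP.
by rewrite -nc_eq0 nc_real normr_eq0 gt_eqF.
Qed.

End Perron.

(** * Strict supersolutions between 1 and theta *)

Section Supersolution.
Context {R : realType}.

(** With m the right-hand side, average the inequality exp(u) >= 1 + u at u = y - ln m and u = - ln
    m with weights t and 1 - t: the left sides average to 1, so t y <= ln m. If y is nonzero, one of
    the two points is nonzero and the inequality there is strict. *)
Lemma young_expR (t y : R) : 0 < t < 1 -> expR (t * y) <= 1 + t * (expR y - 1)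
  /\ (y != 0 -> expR (t * y) < 1 + t * (expR y - 1)).
Proof.
move=> /andP[t0 t1].
pose m := 1 + t * (expR y - 1).
have mE : m = t * expR y + (1 - t) by rewrite /m; ring.
have m0 : 0 < m by rewrite mE addr_gt0 ?mulr_gt0 ?expR_gt0 ?subr_gt0.
have e1 : 1 + (y - ln m) <= expR y / m.
  by have := expR_ge1Dx (y - ln m); rewrite expRB lnK.
have e2 : 1 + (0 - ln m) <= m^-1.
  by have := expR_ge1Dx (0 - ln m); rewrite expRB lnK // expR0 div1r.
have sum1 : t * (expR y / m) + (1 - t) * m^-1 = 1.
  by rewrite mulrA -mulrDl -mE divff // gt_eqF.
rewrite -/m -[m]lnK // ler_expR ltr_expR.
have h1 : t * (1 + (y - ln m)) <= t * (expR y / m) by rewrite ler_pM2l.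
have h2 : (1 - t) * (1 + (0 - ln m)) <= (1 - t) * m^-1 by rewrite ler_pM2l // subr_gt0.
split; first by nra.
move=> y0; have [lm|lm] := eqVneq (ln m) 0.
  have e3 : 1 + (y - ln m) < expR y / m.
    by have := @expR_gt1Dx R (y - ln m); rewrite expRB lnK // lm subr0; apply.
  have : t * (1 + (y - ln m)) < t * (expR y / m) by rewrite ltr_pM2l.
  by nra.
have e3 : 1 + (0 - ln m) < m^-1.
  have := @expR_gt1Dx R (0 - ln m); rewrite expRB lnK // expR0 div1r; apply.
  by rewrite sub0r oppr_eq0.
have : (1 - t) * (1 + (0 - ln m)) < (1 - t) * m^-1 by rewrite ltr_pM2l // subr_gt0.
by nra.
Qed.

Definition genR (m n : nat) (F : nat -> 'M[R]_(m, n)) (r : R) : 'M[R]_(m, n) :=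
  \matrix_(i, j) limn (series (fun k => F k i j * r ^+ k)).

Lemma genR_cvg (m n : nat) (F : nat -> 'M[R]_(m, n)) (r s : R) i j : 0 <= r -> r < s ->
  decay s (fun k => (F k i j)%:C) ->
  series (fun k => F k i j * r ^+ k) @ \oo --> genR F r i j.
Proof. by move=> r0 rs hs; rewrite mxE; exact: decay_cvg hs. Qed.

Lemma gen_fun_real (m n : nat) (F : nat -> 'M[R]_(m, n)) (r s : R) : 0 <= r -> r < s ->
  (forall i j, decay s (fun k => (F k i j)%:C)) ->
  gen_fun F r%:C = map_mx (real_complex R) (genR F r).
Proof.
move=> r0 rs hs; apply/matrixP => i j; rewrite !mxE.
have := ev_real (genR_cvg r0 rs (hs i j)); rewrite /ev => ->.
by rewrite mxE.
Qed.

Variables (M : nat) (A : nat -> 'M[R]_M) (pi_ : 'rV[R]_M) (theta s : R).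
Hypotheses (M0 : (0 < M)%N) (A0 : forall k, nonneg_mx (A k))
  (Asto : forall i, \sum_j mx_series_sum A i j = 1)
  (piA : pi_ *m mx_series_sum A = pi_) (pi1 : \sum_j pi_ 0 j = 1)
  (irr : irreducible_mx (mx_series_sum A))
  (drift : limn (series (fun k => k%:R * (pi_ *m A k *m (const_mx 1 : 'cV[R]_M)) 0 0)) < 1)
  (theta1 : 1 < theta) (thetas : theta < s)
  (As : forall i j, decay s (fun k => (A k i j)%:C))
  (Atheta : is_delta (gen_fun A theta%:C) theta%:C).

Let theta0 : 0 < theta. Proof. exact: lt_trans ltr01 theta1. Qed.

Lemma series_A i j : series (fun k => A k i j) @ \oo --> mx_series_sum A i j.
Proof.
have := genR_cvg ler01 (lt_trans theta1 thetas) (As i j).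
by rewrite !mxE; under eq_fun do rewrite expr1n mulr1.
Qed.

Lemma genR_ge0 r : 0 <= r -> r < s -> nonneg_mx (genR A r).
Proof.
move=> r0 rs i j; apply: (@series_cvg_ge0 _ (fun k => A k i j * r ^+ k)).
  by move=> k; rewrite mulr_ge0 ?exprn_ge0 //; exact: A0.
exact: genR_cvg (As i j).
Qed.

Lemma genR_gt0 r i j : 0 < r -> r < s -> (exists k, 0 < A k i j) -> 0 < genR A r i j.
Proof.
move=> r0 rs [k hk]; apply: (@lt_le_trans _ _ (A k i j * r ^+ k)).
  by rewrite mulr_gt0 ?exprn_gt0.
apply: (@series_term_le _ (fun k => A k i j * r ^+ k)).
  by move=> n; rewrite mulr_ge0 ?exprn_ge0 ?(ltW r0) //; exact: A0.
exact: genR_cvg (ltW r0) rs (As i j).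
Qed.

(** A positive entry of A comes from a positive entry of some A(k), which stays positive in
    A^*(r). *)
Lemma genR_irreducible r : 0 < r -> r < s -> irreducible_mx (genR A r).
Proof.
move=> r0 rs i j; elim: (irr i j) => [a|a b c ab _ IH]; first exact: Relation_Operators.rt1n_refl.
apply: Relation_Operators.rt1n_trans IH; apply: genR_gt0 => //; apply: contrapT => /forallNP h.
have Aab k : A k a b = 0.
  apply/eqP; rewrite eq_le; apply/andP; split; last exact: A0.
  by rewrite leNgt; apply/negP; exact: h.
move: ab; rewrite mxE; under eq_fun do rewrite Aab.
rewrite (@series_limE _ _ 0) ?ltxx //.
rewrite (_ : series _ = cst 0); first exact: cvg_cst.
by apply/funext => n; rewrite /series /= big1.
Qed.

(** The Perron root of A^*(theta) is one of its eigenvalues, and [is_delta] says that no eigenvalue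
    exceeds theta in modulus. *)
Lemma theta_supersolution : exists2 v, (forall i, 0 < v i) &
  forall i, mact (genR A theta) v i <= theta * v i.
Proof.
have [s0 [v [v0 hv]]] := perron_vector M0 (genR_ge0 (ltW theta0) thetas) (genR_irreducible theta0 thetas).
exists v => // i; rewrite hv ler_wpM2r ?(ltW (v0 i)) //.
have [_ _ hmax _] := Atheta.
have := hmax s0%:C; rewrite (gen_fun_real (ltW theta0) thetas As).
move=> /(_ (real_right_eigenvalue v0 M0 hv)).
rewrite !normcC lecR !nc_real (gtr0_norm theta0) => h.
by apply: le_trans h; exact: ler_norm.
Qed.

(* Along [r = theta ^ t] the vector [w = v ^ t] is a supersolution, by Young's inequality
   applied to [theta ^ (k - 1) * v j / v i]; equality everywhere would force this ratio to be 1
   whenever [A k i j > 0], hence unit drift. *)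
Lemma interior_supersolution r : 1 < r < theta ->
  exists2 w, (forall i, 0 < w i) & forall i, mact (genR A r) w i < r * w i.
Proof.
move=> /andP[r1 rtheta]; have r0 : 0 < r by exact: lt_trans r1.
have rs : r < s by exact: lt_trans thetas.
have [v v0 hv] := theta_supersolution.
pose L := ln theta; pose l i := ln (v i); pose t := ln r / L.
have L0 : 0 < L by rewrite ln_gt0.
have t01 : 0 < t < 1.
  by rewrite divr_gt0 ?ln_gt0 //= ltr_pdivrMr // mul1r ltr_ln.
have tL : t * L = ln r by rewrite divfK // gt_eqF.
have [t0 t1] := andP t01.
pose w i := expR (t * l i).
have w0 i : 0 < w i by exact: expR_gt0.
(* The logarithm of theta^(k-1) v_j / v_i. Multiplied by t it becomes the logarithm of r^(k-1) w_j /
   w_i, since theta^t = r. *)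
pose yy k i j := k%:R * L - L + l j - l i.
have expk (x : R) k : 0 < x -> expR (k%:R * ln x) = x ^+ k.
  by move=> x0; rewrite mulrC expRM_natr lnK.
have eyy k i j : expR (yy k i j) = theta ^+ k * v j / (theta * v i).
  rewrite /yy expRB expRD expRB expk // !lnK ?posrE //.
  by field; rewrite !gt_eqF.
have etyy k i j : expR (t * yy k i j) = r ^+ k * w j / (r * w i).
  rewrite /yy mulrBr mulrDr mulrBr mulrCA tL expRB expRD expRB expk // lnK ?posrE //.
  by rewrite /w; field; rewrite !gt_eqF ?expR_gt0.
pose B k i j := A k i j * (1 + t * (expR (yy k i j) - 1)).
have le1 k i j : A k i j * expR (t * yy k i j) <= B k i j.
  by apply: ler_wpM2l; [exact: A0 | have [] := young_expR (yy k i j) t01].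
have cvB i : series (fun k => \sum_j B k i j) @ \oo -->
    1 + t * (mact (genR A theta) v i / (theta * v i) - 1).
  have -> : 1 + t * (mact (genR A theta) v i / (theta * v i) - 1) =
     \sum_j ((1 - t) * mx_series_sum A i j + (t * v j / (theta * v i)) * genR A theta i j).
    rewrite big_split /= -mulr_sumr Asto mulr1 /mact mulr_suml.
    rewrite mulrBr mulr1 mulr_sumr addrA addrAC; congr (_ + _).
    by apply: eq_bigr => j _; ring.
  apply: series_cvg_sum => j _.
  rewrite (_ : (fun k => _) = (fun k => (1 - t) * A k i j + (t * v j / (theta * v i)) * (A k i j * theta ^+ k))).
    apply: series_cvgD; first by apply: series_cvgZ; exact: series_A.
    by apply: series_cvgZ; exact: genR_cvg (ltW theta0) thetas (As i j).
  by apply/funext => k; rewrite /B eyy; ring.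
have cvE i : series (fun k => \sum_j A k i j * expR (t * yy k i j)) @ \oo -->
    mact (genR A r) w i / (r * w i).
  rewrite /mact mulr_suml; apply: series_cvg_sum => j _.
  rewrite (_ : (fun k => _) = (fun k => (w j / (r * w i)) * (A k i j * r ^+ k))).
    have -> : genR A r i j * w j / (r * w i) = (w j / (r * w i)) * genR A r i j by ring.
    by apply: series_cvgZ; exact: genR_cvg (ltW r0) rs (As i j).
  by apply/funext => k; rewrite etyy; ring.
have ub i : 1 + t * (mact (genR A theta) v i / (theta * v i) - 1) <= 1.
  rewrite gerDl pmulr_rle0 // subr_le0 ler_pdivrMr ?mul1r //; exact: mulr_gt0.
have rw0 i : 0 < r * w i by exact: mulr_gt0.
have weak i : mact (genR A r) w i <= r * w i.
  rewrite -[leRHS]mul1r -ler_pdivrMr //; apply: le_trans (ub i).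
  by apply: series_cvg_le (cvE i) (cvB i) => k; apply: ler_sum => j _; exact: le1.
apply: (strict_supersolution (genR_ge0 (ltW r0) rs) (genR_irreducible r0 rs) w0 weak).
apply: contrapT => /forallNP noS.
have yy0 k i j : 0 < A k i j -> yy k i j = 0.
  move=> Ak; apply/eqP; apply: contraT => ny; exfalso; apply: (noS i).
  rewrite -[ltRHS]mul1r -ltr_pdivrMr //; apply: lt_le_trans (ub i).
  apply: (@series_cvg_lt _ _ _ _ _ k _ _ (cvE i) (cvB i)).
    by move=> n; apply: ler_sum => j' _; exact: le1.
  rewrite (bigD1 j) //= [ltRHS](bigD1 j) //=; apply: ltr_leD; last by apply: ler_sum => j' _; exact: le1.
  by rewrite ltr_pM2l //; have [_] := young_expR (yy k i j) t01; apply.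
(* The equation [yy k i j = 0] reads k = 1 + (l i - l j) / L wherever A(k) has a positive entry. *)
have kA k i j : k%:R * A k i j = (1 + (l i - l j) / L) * A k i j.
  have [Ak|Ak] := ltP 0 (A k i j); last first.
    by have -> : A k i j = 0; rewrite ?mulr0 //; apply/eqP; rewrite eq_le Ak; exact: A0.
  congr (_ * _); have := yy0 k i j Ak; rewrite /yy => e.
  by apply: (mulIf (lt0r_neq0 L0)); rewrite mulrDl mul1r divfK ?gt_eqF //; lra.
have : series (fun k => k%:R * (pi_ *m A k *m (const_mx 1 : 'cV[R]_M)) 0 0) @ \oo -->
   \sum_j \sum_i pi_ 0 i * (1 + (l i - l j) / L) * mx_series_sum A i j.
  rewrite (_ : (fun k => _) = (fun k => \sum_j \sum_i pi_ 0 i * (1 + (l i - l j) / L) * A k i j)).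
    apply: series_cvg_sum => j _; apply: series_cvg_sum => i _; apply: series_cvgZ; exact: series_A.
  apply/funext => k; rewrite mxE mulr_sumr; apply: eq_bigr => j _.
  rewrite !mxE mulr1 mulr_sumr; apply: eq_bigr => i _.
  by rewrite mulrCA kA mulrA.
move/series_limE => dl; move: drift; rewrite dl.
have piE j : \sum_i pi_ 0 i * mx_series_sum A i j = pi_ 0 j.
  by rewrite -[in RHS]piA mxE.
(* Summed against pi, the differences l i - l j cancel: pi A = pi handles one part and the unit row
   sums the other. The drift would then be the sum of pi, namely 1. *)
have -> : \sum_j \sum_i pi_ 0 i * (1 + (l i - l j) / L) * mx_series_sum A i j =
   \sum_j (pi_ 0 j - pi_ 0 j * l j / L) + \sum_j \sum_i (pi_ 0 i * l i / L) * mx_series_sum A i j.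
  rewrite -big_split; apply: eq_bigr => j _ /=.
  rewrite -[in RHS](piE j) -mulrA mulr_suml -sumrB -big_split; apply: eq_bigr => i _ /=.
  ring.
rewrite exchange_big /=.
under [X in _ + X]eq_bigr => i _ do rewrite -mulr_sumr Asto mulr1.
by rewrite -big_split /=; under eq_bigr do rewrite subrK; rewrite pi1 ltxx.
Qed.

End Supersolution.

(** * Geometric decay and positivity of the stationary vector *)

Section StationaryDecay.
Context {R : realType}.

Lemma series_truncate_le (f g : nat -> R) (a : R) N : series f @ \oo --> a ->
  (forall k, f k <= g k) -> (forall k, (N <= k)%N -> g k = 0) -> a <= \sum_(k < N) g k.
Proof.
move=> fa fg gN; apply: (series_cvg_le fg fa).
apply/cvgrPdist_lt => e e0; exists N => // n /= Nn; rewrite seriesEord /=.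
rewrite -!(big_mkord xpredT g) (big_cat_nat (n := N) (p := n)) //=.
rewrite [X in _ - (_ + X)]big1_seq ?addr0 ?subrr ?normr0 // => k.
by rewrite mem_index_iota => /andP[_ /andP[Nk _]]; exact: gN.
Qed.

Lemma series_shift (u : nat -> R) (a : R) : series (fun k => u k.+1) @ \oo --> a ->
  series u @ \oo --> u 0%N + a.
Proof.
move=> h; rewrite -cvg_shiftS.
rewrite (_ : (fun n => series u n.+1) = cst (u 0%N) + series (fun k => u k.+1)).
  by apply: cvgD => //; exact: cvg_cst.
by apply/funext => n; rewrite fctE /= !seriesEord /= big_ord_recl.
Qed.

Lemma series_unshift (u : nat -> R) (a : R) : series u @ \oo --> a ->
  series (fun k => u k.+1) @ \oo --> a - u 0%N.
Proof.
rewrite -cvg_shiftS => h.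
rewrite (_ : series _ = (fun n => series u n.+1) - cst (u 0%N)).
  by apply: cvgB => //; exact: cvg_cst.
apply/funext => n; rewrite fctE /= !seriesEord /= big_ord_recl /= (_ : (- cst (u 0%N)) n = - u 0%N) //.
by rewrite addrAC subrr add0r.
Qed.

Variables (M0 M : nat) (B0 : 'M[R]_M0) (B : nat -> 'M[R]_(M0, M)) (C0 : 'M[R]_(M, M0))
  (A : nat -> 'M[R]_M) (x0 : 'rV[R]_M0) (x : nat -> 'rV[R]_M).
Hypotheses (B00 : nonneg_mx B0) (B_0 : forall k, (0 < k)%N -> nonneg_mx (B k))
  (C00 : nonneg_mx C0) (A0 : forall k, nonneg_mx (A k))
  (Acvg : forall i j, cvgn (series (fun k => A k i j)))
  (Asto : forall i, \sum_j mx_series_sum A i j = 1)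
  (Bcvg : forall i j, cvgn (series (fun k => B k.+1 i j)))
  (Bsto : forall i, \sum_j B0 i j + \sum_j mx_series_sum (fun k => B k.+1) i j = 1)
  (Csto : forall i, \sum_j C0 i j + \sum_j mx_series_sum (fun k => A k.+1) i j = 1)
  (xstat : stationary_prob B0 B C0 A x0 x).

Let x0_ge0 i : 0 <= x0 0 i.
Proof. by case: xstat => -[h _] _ _ _ _; exact: h. Qed.
Let x_ge0 k j : (0 < k)%N -> 0 <= x k 0 j.
Proof. by move=> k0; case: xstat => -[_ h] _ _ _ _; exact: h. Qed.

Lemma Bext_ge0 k : nonneg_mx (Bext B k).
Proof. by case: k => [|k] i j; [rewrite mxE | exact: B_0]. Qed.

Lemma series_Bext i j : series (fun k => Bext B k i j) @ \oo --> mx_series_sum (fun k => B k.+1) i j.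
Proof.
have := @series_shift (fun k => Bext B k i j) (mx_series_sum (fun k => B k.+1) i j).
rewrite /= (_ : (0 : 'M[R]_(M0, M)) i j = 0) ?mxE // add0r; apply; rewrite ?mxE; exact: Bcvg.
Qed.

(** Flow balance across the cut between level 0 and level 1. The rows of C(0) and of A(0) have equal
    sums because both complete the same A(k), k >= 1, to total mass 1. *)
Lemma balance : \sum_i x0 0 i * \sum_j mx_series_sum (fun k => B k.+1) i j =
  \sum_i x 1 0 i * \sum_j A 0 i j.
Proof.
have Ce i : \sum_j C0 i j = \sum_j A 0 i j.
  apply: (addIr (\sum_j mx_series_sum (fun k => A k.+1) i j)); rewrite Csto -(Asto i) -big_split.
  apply: eq_bigr => j _ /=; rewrite !mxE.
  have /series_limE <- : series (fun k => A k i j) @ \oo --> A 0%N i j + limn (series (fun k => A k.+1 i j)).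
    apply: series_shift; have /cvg_ex[l /series_unshift hl] := @Acvg i j.
    by apply/cvg_ex; exists (l - A 0%N i j).
  by [].
have [_ h0 _ _ _] := xstat.
have Be i : \sum_j mx_series_sum (fun k => B k.+1) i j = 1 - \sum_j B0 i j.
  by rewrite -(Bsto i) addrC addKr.
under eq_bigr => i _ do rewrite Be mulrBr mulr1.
under [RHS]eq_bigr => i _ do rewrite -Ce.
rewrite sumrB.
have -> : \sum_i x0 0 i * \sum_j B0 i j = \sum_j (x0 *m B0) 0 j.
  under [RHS]eq_bigr => j _ do rewrite mxE.
  by rewrite exchange_big /=; apply: eq_bigr => i _; rewrite mulr_sumr.
have -> : \sum_i x 1%N 0 i * \sum_j C0 i j = \sum_j (x 1%N *m C0) 0 j.
  under [RHS]eq_bigr => j _ do rewrite mxE.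
  by rewrite exchange_big /=; apply: eq_bigr => i _; rewrite mulr_sumr.
apply/eqP; rewrite subr_eq addrC -big_split; apply/eqP; apply: eq_bigr => j _ /=.
by rewrite {1}h0 mxE.
Qed.

(** One-step lower bound for a truncated Lyapunov function: [H] dominates n - c r^k w, and
    integrating this minorant against the transition blocks [G] produces their total mass and their
    generating function at r. Vanishing of [H] from K on keeps the right side finite. *)
Lemma truncated_test (G : nat -> 'I_M -> R) (S g w : 'I_M -> R) (H : nat -> 'I_M -> R) (r n c : R) K :
  (forall k j, 0 <= G k j) -> (forall j, series (fun k => G k j) @ \oo --> S j) ->
  (forall j, series (fun k => G k j * r ^+ k) @ \oo --> g j) ->
  (forall k j, n - c * r ^+ k * w j <= H k j) -> (forall k j, (K <= k)%N -> H k j = 0) ->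
  n * \sum_j S j - c * \sum_j g j * w j <= \sum_(k < K) \sum_j G k j * H k j.
Proof.
move=> G0 GS Gg hH H0.
have -> : n * \sum_j S j - c * \sum_j g j * w j = \sum_j (n * S j + - (c * w j) * g j).
  by rewrite big_split /= !mulr_sumr -sumrN; congr (_ + _); apply: eq_bigr => j _; ring.
apply: (@series_truncate_le (fun k => \sum_j (n * G k j + - (c * w j) * (G k j * r ^+ k)))
  (fun k => \sum_j G k j * H k j)).
- by apply: series_cvg_sum => j _; apply: series_cvgD; apply: series_cvgZ.
- move=> k; apply: ler_sum => j _; rewrite mulrC [_ * (G k j * _)]mulrCA -mulrDr ler_wpM2l //.
  by apply: le_trans (hH k j); rewrite mulNr mulrAC.
- by move=> k Kk; rewrite big1 // => j _; rewrite H0 ?mulr0.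
Qed.

(* Foster-Lyapunov bound: the stationary equations are tested against the finitely supported
   truncations [max 0 (n - r ^ k * w)] of the Lyapunov function, so every sum is finite. *)
Lemma stationary_decay (r : R) (w : 'I_M -> R) : 1 < r -> (forall i, 0 < w i) ->
  (forall i j, cvgn (series (fun k => A k i j * r ^+ k))) ->
  (forall i j, cvgn (series (fun k => Bext B k i j * r ^+ k))) ->
  (forall i, mact (genR A r) w i < r * w i) ->
  exists C : R, forall k j, x k.+1 0 j * r ^+ k.+1 <= C.
Proof.
move=> r1 w0 Ar Br hw; have r0 : 0 < r by exact: lt_trans r1.
have [|eta /andP[eta0 eta1] heta] := uniform_gap hw; first by move=> i; exact: mulr_gt0.
pose b := \sum_i x0 0 i * \sum_j genR (Bext B) r i j * w j.
suff h k j : x k.+1 0 j * (eta * (r ^+ k.+1 * w j)) <= b.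
  exists (\sum_j `|b / (eta * w j)|) => k j.
  apply: (@le_trans _ _ (b / (eta * w j))).
    by rewrite ler_pdivlMr ?mulr_gt0 //; apply: le_trans (h k j); rewrite le_eqVlt; apply/orP; left; apply/eqP; ring.
  by rewrite (bigD1 j) //=; apply: (le_trans (ler_norm _)); rewrite lerDl sumr_ge0.
(* The truncation height is the Lyapunov value of the very state to be bounded: there [H] vanishes,
   while [T] below equals eta * n. *)
pose n := r ^+ k.+1 * w j.
have n0 : 0 < n by rewrite mulr_gt0 ?exprn_gt0.
pose H q i := Num.max 0 (n - r ^+ q * w i).
have H0 q i : 0 <= H q i by rewrite le_max lexx.
have Hge q i : n - r ^+ q * w i <= H q i by rewrite le_max lexx orbT.
have ri01 : 0 <= r^-1 < 1 by rewrite invr_ge0 ltW //= invf_lt1.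
have exK i : exists K, forall q, (K <= q)%N -> n * r^-1 ^+ q < w i by exact: geo_to0.
have [Kf hKf] := choice exK.
pose K := maxn k.+1 (\max_i Kf i).
have HK q i : (K < q)%N -> H q i = 0.
  move=> Kq; apply/eqP; rewrite eq_le H0 andbT ge_max lexx /= subr_le0.
  have := hKf i q; rewrite exprVn ltr_pdivrMr ?exprn_gt0 // mulrC => h; apply/ltW/h.
  by apply: (leq_trans _ (ltnW Kq)); rewrite leq_max leq_bigmax orbT.
have kK : (k < K)%N by rewrite leq_max leqnn.
have partA l i : n - r ^+ l * mact (genR A r) w i <= \sum_(m < K.+1) \sum_j A m i j * H (m + l)%N j.
  rewrite -[X in X - _]mulr1 -(Asto i).
  apply: (@truncated_test (fun m j => A m i j) _ (fun j => genR A r i j) w (fun m j => H (m + l)%N j) r).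
  - by move=> m j'; exact: A0.
  - by move=> j'; rewrite mxE; exact: Acvg.
  - by move=> j'; rewrite mxE; exact: Ar.
  - by move=> m j'; apply: le_trans (Hge _ _); rewrite -exprD addnC.
  - by move=> m j' Km; rewrite HK // ltn_addr.
have partB i : n * (\sum_j mx_series_sum (fun k => B k.+1) i j) - \sum_j genR (Bext B) r i j * w j
     <= \sum_(m < K.+1) \sum_j Bext B m i j * H m j.
  rewrite -[X in _ - X]mul1r; apply: (@truncated_test (fun m j => Bext B m i j) _ _ w H r).
  - by move=> m j'; exact: Bext_ge0.
  - by move=> j'; exact: series_Bext.
  - by move=> j'; rewrite mxE; exact: Br.
  - by move=> m j'; rewrite mul1r.
  - by move=> m j'; exact: HK.
have [_ _ xE _ _] := xstat.
(* The equations of levels 1 to K are paired with [H]. To reorder the double sum, the row q = 0,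
   which has no equation of this form, is added; its only term is x(1) A(0) H(0), subtracted
   again. *)
have test : \sum_(l < K) \sum_j x l.+1 0 j * H l.+1 j =
   \sum_i x0 0 i * \sum_(m < K.+1) \sum_j Bext B m i j * H m j
   + (\sum_(l < K.+1) \sum_i x l.+1 0 i * \sum_(q < K.+1 | (l <= q)%N) \sum_j A (q - l)%N i j * H q j
      - \sum_i x 1%N 0 i * \sum_j A 0 i j * H 0%N j).
  pose F (q : nat) (l : nat) := \sum_j (\sum_i x l.+1 0 i * A (q - l)%N i j) * H q j.
  have FE q l : F q l = \sum_i x l.+1 0 i * \sum_j A (q - l)%N i j * H q j.
    rewrite /F; under eq_bigr => j' _ do rewrite mulr_suml.
    rewrite exchange_big /=; apply: eq_bigr => i _; rewrite mulr_sumr.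
    by apply: eq_bigr => j' _; rewrite mulrA.
  have -> : \sum_(l < K.+1) \sum_i x l.+1 0 i * \sum_(q < K.+1 | (l <= q)%N) \sum_j A (q - l)%N i j * H q j
      = \sum_(q < K.+1) \sum_(l < q.+1) F q l.
    under [RHS]eq_bigr => q _.
      rewrite (big_ord_widen K.+1 (fun l => F q l)) //.
      over.
    rewrite [RHS](exchange_big_dep xpredT) //=; apply: eq_bigr => l _.
    under eq_bigr => i _ do rewrite mulr_sumr.
    rewrite exchange_big /=; apply: eq_big => q; first by rewrite ltnS.
    by move=> _; rewrite FE.
  rewrite big_ord_recl /= big_ord1 FE subnn [X in _ + (X - _)]addrC addrK addrC.
  have -> : \sum_i x0 0 i * \sum_(m < K.+1) \sum_j Bext B m i j * H m j
      = \sum_(l < K) \sum_j (x0 *m B l.+1) 0 j * H l.+1 j.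
    under eq_bigr => i _ do rewrite mulr_sumr.
    rewrite exchange_big /= big_ord_recl big1 ?add0r; last first.
      by move=> i _; rewrite big1 ?mulr0 // => j' _; rewrite mxE mul0r.
    apply: eq_bigr => l _; under [RHS]eq_bigr => j' _ do rewrite mxE mulr_suml.
    rewrite exchange_big /=; apply: eq_bigr => i _; rewrite mulr_sumr.
    by apply: eq_bigr => j' _; rewrite mulrA.
  rewrite -big_split; apply: eq_bigr => l _ /=; rewrite /F exchange_big /= -big_split.
  apply: eq_bigr => j' _ /=; rewrite -mulr_suml -mulrDl; congr (_ * _).
  rewrite xE // mxE addrC; congr (_ + _); rewrite summxE; apply: eq_bigr => q _.
  by rewrite mxE.
have reA l i : (l <= K)%N -> \sum_(q < K.+1 | (l <= q)%N) \sum_j A (q - l)%N i j * H q j =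
    \sum_(m < K.+1) \sum_j A m i j * H (m + l)%N j.
  move=> lK; rewrite -!(big_mkord (fun q => (l <= q)%N) (fun q => \sum_j A (q - l)%N i j * H q j)).
  rewrite -(big_mkord xpredT (fun m => \sum_j A m i j * H (m + l)%N j)).
  rewrite (big_cat_nat (n := l)) //=; last by apply: leqW.
  rewrite big_nat_cond big1 ?add0r; last by move=> q /andP[/andP[_ ql] lq]; rewrite leqNgt ql in lq.
  rewrite -{1}[l]add0n big_addn (big_cat_nat (n := (K.+1 - l)%N) (p := K.+1)) //=; last exact: leq_subr.
  rewrite [X in _ = _ + X]big_nat_cond [X in _ = _ + X]big1 ?addr0.
    by apply: eq_big => q; [rewrite leq_addl | rewrite addnK].
  move=> q /andP[/andP[q1 _] _]; apply: big1 => j' _; rewrite HK ?mulr0 //.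
  by rewrite -leq_subLR in q1 *; lia.
(* A lower bound for the expected value of [H] after one step from level l + 1; the factor 1 - eta
   is the uniform contraction provided by the supersolution. *)
pose T l i := Num.max 0 (n - (1 - eta) * (r ^+ l.+1 * w i)).
have Tle l i : (l <= K)%N -> T l i <= \sum_(q < K.+1 | (l <= q)%N) \sum_j A (q - l)%N i j * H q j.
  move=> lK; rewrite ge_max; apply/andP; split.
    by apply: sumr_ge0 => q _; apply: sumr_ge0 => j' _; rewrite mulr_ge0 //; exact: A0.
  rewrite reA //; apply: le_trans (partA l i); rewrite lerD2l lerN2.
  rewrite exprSr -mulrA mulrCA ler_wpM2l ?exprn_ge0 ?(ltW r0) //; exact: heta.
have s1 : n * (\sum_i x0 0 i * \sum_j mx_series_sum (fun k => B k.+1) i j) - b <=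
   \sum_i x0 0 i * \sum_(m < K.+1) \sum_j Bext B m i j * H m j.
  rewrite /b mulr_sumr -sumrB; apply: ler_sum => i _.
  by rewrite mulrCA -mulrBr ler_wpM2l.
have s2 : \sum_(l < K) \sum_i x l.+1 0 i * T l i <=
   \sum_(l < K.+1) \sum_i x l.+1 0 i * \sum_(q < K.+1 | (l <= q)%N) \sum_j A (q - l)%N i j * H q j.
  rewrite [leRHS]big_ord_recr /=; apply: ler_wpDr.
    apply: sumr_ge0 => i _; rewrite mulr_ge0 ?x_ge0 //; apply: le_trans (Tle K i (leqnn _)).
    by rewrite le_max lexx.
  apply: ler_sum => l _; apply: ler_sum => i _; rewrite ler_wpM2l ?x_ge0 //.
  by apply: Tle; exact: ltnW.
have s3 : \sum_i x 1%N 0 i * \sum_j A 0 i j * H 0%N j <= n * (\sum_i x 1%N 0 i * \sum_j A 0 i j).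
  rewrite mulr_sumr; apply: ler_sum => i _; rewrite mulrCA ler_wpM2l ?x_ge0 //.
  rewrite mulr_sumr; apply: ler_sum => j' _; rewrite mulrC ler_wpM2r //; first exact: A0.
  by rewrite ge_max (ltW n0) /= expr0 mul1r gerBl ltW.
(* The two terms proportional to n, inflow from level 0 and outflow from level 1, cancel by
   [balance]. What remains is [b], independent of the state and of K. *)
have key : \sum_(l < K) \sum_i x l.+1 0 i * (T l i - H l.+1 i) <= b.
  have -> : \sum_(l < K) \sum_i x l.+1 0 i * (T l i - H l.+1 i) =
     \sum_(l < K) \sum_i x l.+1 0 i * T l i - \sum_(l < K) \sum_j x l.+1 0 j * H l.+1 j.
    rewrite -sumrB; apply: eq_bigr => l _; rewrite -sumrB; apply: eq_bigr => i _.
    by rewrite mulrBr.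
  by rewrite test; move: s1 s2 s3; rewrite balance; lra.
have TH l i : 0 <= T l i - H l.+1 i.
  rewrite subr_ge0 /T /H ge_max le_max lexx /= le_max; apply/orP; right.
  rewrite lerD2l lerN2 ler_piMl ?mulr_ge0 ?exprn_ge0 ?(ltW r0) ?(ltW (w0 i)) //; lra.
apply: le_trans key; rewrite (bigD1 (Ordinal kK)) //= (bigD1 j) //=.
apply: ler_wpDr.
  by apply: sumr_ge0 => l _; apply: sumr_ge0 => i _; rewrite mulr_ge0 ?x_ge0.
apply: ler_wpDr; first by apply: sumr_ge0 => i _; rewrite mulr_ge0 ?x_ge0.
rewrite ler_wpM2l ?x_ge0 // /T /H -/n subrr maxxx subr0 le_max; apply/orP; right.
by rewrite mulrBl mul1r opprB addrCA subrr addr0.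
Qed.

(** Stationarity carries positive mass along every transition of positive probability; total mass 1
    supplies a starting state and irreducibility reaches all of level 0. *)
Lemma x0_gt0 : irreducible_T B0 B C0 A -> forall i, 0 < x0 0 i.
Proof.
move=> irrT.
pose m (s : state M0 M) := match s with inl i => x0 0 i | inr (k, j) => x k.+1 0 j end.
have [_ h0 hk hc h1] := xstat.
have m0 s : 0 <= m s by case: s => [i|[k j]] /=; [exact: x0_ge0 | exact: x_ge0].
have stepm s t : 0 < Tmat B0 B C0 A s t -> 0 < m s -> 0 < m t.
  move=> Tst ms; apply: (lt_le_trans (mulr_gt0 ms Tst)) => {Tst ms}.
  case: s t => [i|[k j]] [i'|[l j']] /=.
  - rewrite {2}h0 !mxE; apply: ler_wpDr; first by apply: sumr_ge0 => j _; rewrite mulr_ge0 ?x_ge0.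
    by rewrite (bigD1 i) //= lerDl; apply: sumr_ge0 => j _; rewrite mulr_ge0.
  - rewrite hk // !mxE; apply: ler_wpDr.
      rewrite summxE; apply: sumr_ge0 => q _; rewrite mxE; apply: sumr_ge0 => j _.
      by rewrite mulr_ge0 ?x_ge0 //; exact: A0.
    by rewrite (bigD1 i) //= lerDl; apply: sumr_ge0 => j _; rewrite mulr_ge0 //; exact: B_0.
  - case: eqP => [->|_]; last by rewrite mulr0.
    rewrite h0 !mxE; apply: ler_wpDl; first by apply: sumr_ge0 => q _; rewrite mulr_ge0.
    by rewrite (bigD1 j) //= lerDl; apply: sumr_ge0 => q _; rewrite mulr_ge0 ?x_ge0.
  - case: ifP => [kl|_]; last by rewrite mulr0 x_ge0.
    rewrite (hk l.+1) // !mxE; apply: ler_wpDl.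
      by apply: sumr_ge0 => q _; rewrite mulr_ge0 //; exact: B_0.
    rewrite summxE (bigD1 (Ordinal (kl : (k < l.+2)%N))) //=; apply: ler_wpDr.
      apply: sumr_ge0 => q _; rewrite mxE; apply: sumr_ge0 => q' _.
      by rewrite mulr_ge0 ?x_ge0 //; exact: A0.
    rewrite mxE (bigD1 j) //= lerDl; apply: sumr_ge0 => q _.
    by rewrite mulr_ge0 ?x_ge0 //; exact: A0.
have [s ms] : exists s, 0 < m s.
  apply: contrapT => /forallNP h.
  have mz s : m s = 0 by apply/eqP; rewrite eq_le m0 andbT leNgt; apply/negP; exact: h.
  move: h1; rewrite big1; last by move=> j _; exact: (mz (inl j)).
  rewrite (@series_limE _ _ 0) ?addr0; first by move/eqP; rewrite eq_sym oner_eq0.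
  rewrite (_ : series _ = cst 0); first exact: cvg_cst.
  apply/funext => n; rewrite /series /= big1 // => k _; rewrite big1 // => j _.
  exact: (mz (inr (k, j))).
move=> i; change (0 < m (inl i)); elim: (irrT s (inl i)) ms => [//|a b c ab _ IH ma].
by apply: IH; exact: stepm ab ma.
Qed.

End StationaryDecay.

(** * Poles of B^* on the circle of radius r_B *)

Section BoundaryPoles.
#[local] Opaque ev ComplexField.Normc.normc.
Context {R : realType}.
Implicit Types (z w p : R[i]) (S : seq R[i]).

Lemma cvg_dnbhs_unique (f : cfun R) (p l l' : (R[i])^o) :
  f @ p^' --> l -> f @ p^' --> l' -> l = l'.
Proof.
exact: (cvg_unique (@norm_hausdorff _ (R[i])^o)).
Qed.

Lemma cvg_dnbhs_eq (f g : cfun R) (p l : (R[i])^o) (r : R) : 0 < r ->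
  (forall w, nc (w - p) < r -> w != p -> f w = g w) -> f @ p^' --> l -> g @ p^' --> l.
Proof.
move=> r0 fg /cvg_dnbhsC h; apply/cvg_dnbhsC => e /h[d d0 hd].
exists (Num.min r d); first by rewrite lt_min r0.
by move=> w; rewrite lt_min => /andP[wr wd] wp; rewrite -fg //; exact: hd.
Qed.

Lemma cvg_dnbhs_mul (f g : cfun R) (p l l' : (R[i])^o) :
  f @ p^' --> l -> g @ p^' --> l' ->
  (fun w => f w * g w : (R[i])^o) @ p^' --> ((l : R[i]) * l' : (R[i])^o).
Proof. by move=> hf hg; exact: cvgM hf hg. Qed.

Lemma ceps_cvg_dnbhs (f : cfun R) (p : (R[i])^o) :
  ceps f p -> f @ p^' --> f p.
Proof.
by move=> h; apply/cvg_dnbhsC => e /h[r r0 hr]; exists r => // w wr _; exact: hr.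
Qed.

Lemma derivable_exp_sub p (n : nat) (z : (R[i])^o) :
  derivable ((fun w => (w - p) ^+ n) : cfun R) z 1.
Proof.
have := @derivable_horner R (('X - p%:P) ^+ n) z.
by congr (derivable _ z 1); apply/funext => w; rewrite horner_exp hornerXsubC.
Qed.

Lemma seq_isolated S z : exists2 r : R, 0 < r & forall w, nc (w - z) < r -> w != z -> w \notin S.
Proof.
elim: S => [|p S [r r0 hr]]; first by exists 1.
have [->|pz] := eqVneq p z.
  by exists r => // w wr wz; rewrite inE negb_or wz hr.
exists (Num.min r (nc (p - z))); first by rewrite lt_min r0 nc_gt0 subr_eq0.
move=> w; rewrite lt_min => /andP[wr wp] wz; rewrite inE negb_or hr // andbT.
by apply: contraTneq wp => ->; rewrite ltxx.
Qed.

Lemma nonneg_ev_le (b : nat -> R) (s : R) z : (forall k, 0 <= b k) -> 0 < s -> nc z < s ->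
  decay s (fun k => (b k)%:C) ->
  nc (ev (fun k => (b k)%:C) z) <= nc (ev (fun k => (b k)%:C) (nc z)%:C).
Proof.
move=> b0 s0 zs hb; apply/ler_addgt0Pr => e e0; have e2 : 0 < e / 2 by rewrite divr_gt0.
have zs' : nc (nc z)%:C < s by rewrite nc_real ger0_norm ?nc_ge0.
have [N1 h1] := ev_eps s0 zs hb e2; have [N2 h2] := ev_eps s0 zs' hb e2.
have {}h1 := h1 (maxn N1 N2) (leq_maxl _ _); have {}h2 := h2 (maxn N1 N2) (leq_maxr _ _).
set n := maxn N1 N2 in h1 h2.
have h3 : nc (\sum_(k < n) (b k)%:C * z ^+ k) <= nc (\sum_(k < n) (b k)%:C * (nc z)%:C ^+ k).
  have -> : \sum_(k < n) (b k)%:C * (nc z)%:C ^+ k = (\sum_(k < n) b k * nc z ^+ k)%:C.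
    by rewrite rmorph_sum; apply: eq_bigr => k _; rewrite rmorphM rmorphXn.
  apply: (le_trans (nc_sum _ _ _)); rewrite nc_real; apply: le_trans (ler_norm _).
  by apply: ler_sum => k _; rewrite ncM ncX nc_real ger0_norm.
apply: (le_trans (nc_le_sub _ (\sum_(k < n) (b k)%:C * z ^+ k))); rewrite ncBC.
apply: (@le_trans _ _ (e / 2 + (e / 2 + nc (ev (fun k => (b k)%:C) (nc z)%:C)))).
  apply: lerD; first exact: (ltW h1).
  apply: (le_trans h3); apply: (le_trans (nc_le_sub _ (ev (fun k => (b k)%:C) (nc z)%:C))).
  rewrite lerD2r; exact: (ltW h2).
by rewrite addrA -splitr addrC.
Qed.

(** Evaluates at a boundary point a function that is controlled only inside the disc: approach along
    the radius, then use continuity. *)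
Lemma radial_zero (f : cfun R) p (K t0 : R) : ceps f p -> t0 < 1 ->
  (forall t : R, t0 < t < 1 -> nc (f (t%:C * p)) <= K * (1 - t)) -> f p = 0.
Proof.
move=> hf t01 hK; apply/eqP; apply: contraT => hp.
have c2 : 0 < nc (f p) / 2 by rewrite divr_gt0 // nc_gt0.
have [d d0 hd] := hf _ c2.
have K0 : 0 < `|K| + 1 by rewrite ltr_wpDl.
have n0 : 0 < nc p + 1 by rewrite ltr_wpDl ?nc_ge0.
have [u [u0 u1 u2 u3]] : exists u : R, [/\ 0 < u, u < 1 - t0, u * (nc p + 1) < d &
    u * (`|K| + 1) < nc (f p) / 2].
  near (0 : R)^'+ => u; exists u; rewrite -!ltr_pdivlMr //; split.
  - by near: u; exact: nbhs_right_gt.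
  - by near: u; apply: nbhs_right_lt; rewrite subr_gt0.
  - by near: u; apply: nbhs_right_lt; rewrite divr_gt0.
  - by near: u; apply: nbhs_right_lt; rewrite divr_gt0.
have := hK (1 - u); have -> : 1 - (1 - u) = u by ring.
have /hd : nc ((1 - u)%:C * p - p) < d.
  have -> : (1 - u)%:C * p - p = - (u%:C * p) by rewrite rmorphB /=; ring.
  by rewrite ncN ncM nc_real gtr0_norm //; move: u2; rewrite mulrDr mulr1; lra.
rewrite ncBC => h1 h2; have := nc_le_sub (f p) (f ((1 - u)%:C * p)).
have : K * u <= u * (`|K| + 1) by rewrite mulrC ler_wpM2l ?(ltW u0) // (le_trans (ler_norm _)) // lerDl.
have : t0 < 1 - u < 1 by lra.
by move/h2; lra.
Unshelve. all: by end_near. Qed.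

Lemma exists_gap (r d : R) S : r < d -> exists2 s, r < s <= d &
  forall p, p \in S -> r < nc p -> s <= nc p.
Proof.
move=> rd; elim: S => [|p S [s /andP[rs sd] hs]]; first by exists d; rewrite ?rd ?lexx.
have [rp|pr] := ltP r (nc p); last first.
  exists s; first by rewrite rs.
  by move=> q; rewrite inE => /orP[/eqP->|/hs //]; rewrite ltNge pr.
exists (Num.min s (nc p)); first by rewrite lt_min rs rp ge_min sd.
move=> q; rewrite inE => /orP[/eqP-> _|qS rq]; first by rewrite ge_min lexx orbT.
by rewrite ge_min hs.
Qed.

Variables (M0 M N mB : nat) (b : 'I_M0 -> 'I_M -> nat -> R) (rB : R)
  (F : R[i] -> 'M[R[i]]_(M0, M)) (U : set (R[i])^o) (ang : 'I_N -> R)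
  (Bt : 'I_N -> 'M[R[i]]_(M0, M)).
Hypotheses (b0 : forall i j k, 0 <= b i j k) (rB0 : 0 < rB)
  (bdec : forall r i j, 0 < r -> r < rB -> decay r (fun k => (b i j k)%:C))
  (Uopen : open U) (UB : forall z : R[i], nc z <= rB -> U z)
  (Fmer : forall i j, meromorphic_on U (fun z => F z i j))
  (FE : forall z i j, nc z < rB -> F z i j = ev (fun k => (b i j k)%:C) z)
  (N0 : (0 < N)%N) (mB0 : (0 < mB)%N)
  (ang0 : forall n : 'I_N, nat_of_ord n = 0%N -> ang n = 0)
  (FBt : forall n : 'I_N, pole_coef F (rB%:C * expi (ang n)) mB (Bt n))
  (Fother : forall zeta : R[i], nc zeta = 1 ->
     (exists L, L != 0 /\ pole_coef F (rB%:C * zeta) mB L) -> exists n : 'I_N, zeta = expi (ang n)).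

Let bC i j k : R[i] := (b i j k)%:C.

(** The exceptional sets of the entries are discrete in [U], so compactness of the circle leaves
    finitely many exceptional points in a thin ring around it. *)
Lemma finite_boundary_poles : exists s (S : seq R[i]), [/\ rB < s, uniq S,
  forall p, p \in S -> nc p = rB, forall n, rB%:C * expi (ang n) \in S &
  forall z : R[i], rB <= nc z < s -> z \notin S ->
     forall i j, derivable ((fun w => F w i j) : cfun R) z 1].
Proof.
have [P hP] := choice (fun ij : 'I_M0 * 'I_M => Fmer ij.1 ij.2).
pose Q (x y hx hy : R) := exists2 d : R, 0 < d & exists S : seq R[i], forall r t,
  `|r - rB| < d -> y <= t <= y + hy ->
  U (r%:C * expi t) /\ forall ij, P ij (r%:C * expi t) -> r%:C * expi t \in S.
have [d d0 [S hS]] : Q 0 0 0 (pi *+ 2).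
  apply: rectangle_induction => //; first by rewrite mulrn_wge0 ?pi_ge0.
    move=> x y hx hy [d1 d10 [S1 h1]] _ [d2 d20 [S2 h2]] _.
    exists (Num.min d1 d2); first by rewrite lt_min d10.
    exists (S1 ++ S2) => r t; rewrite lt_min => /andP[r1 r2] ht.
    have [ty|ty] := leP t (y + hy / 2).
      have [|Ur Pr] := h1 r t r1; first by lra.
      by split=> // ij /Pr; rewrite mem_cat => ->.
    have [|Ur Pr] := h2 r t r2; first by lra.
    by split=> // ij /Pr; rewrite mem_cat => ->; rewrite orbT.
  move=> x y _ _; set z := rB%:C * expi y.
  have nz : nc z = rB by rewrite /z ncM nc_expi mulr1 nc_real gtr0_norm.
  have Uz : U z by apply: UB; rewrite nz.
  have [e1 e10 he1] : exists2 e : R, 0 < e & forall w, nc (w - z) < e -> U w.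
    apply/(nearC z U); exact: open_nbhs_nbhs.
  have [e2 e20 he2] : exists2 e : R, 0 < e & forall w, nc (w - z) < e -> w != z ->
       forall ij, ~ P ij w.
    apply/(dnearC z (fun w => forall ij, ~ P ij w)).
    apply: filter_forall => ij; have [_ h _ _] := hP ij; exact: h.
  have e0 : 0 < Num.min e1 e2 by rewrite lt_min e10.
  have [d d0 hd] := circle_pt_continuous rB y e0.
  exists d => // x' y' hx hy _ /andP[hy0 hyd] _ yy.
  exists d => //; exists [:: z] => r t rd ht.
  have td : `|t - y| < d by rewrite ltr_norml; lra.
  have := hd _ _ rd td; rewrite lt_min -/z => /andP[w1 w2].
  split; first exact: he1.
  move=> ij Pw; rewrite inE; apply: contraT => wz.
  by case: (he2 _ w2 wz ij).
(* The ring is thinned further so that exceptional points of modulus above r_B fall outside it. *)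
have [|s /andP[rs sd] hs] := @exists_gap rB (rB + d) S _.
  by rewrite ltrDl.
(* Adding the points r_B zeta_n makes their membership immediate. Clearing a regular point is
   harmless. *)
pose S1 := [seq p <- S | nc p == rB] ++ [seq rB%:C * expi (ang n) | n <- enum 'I_N].
exists s, (undup S1); split => //.
- exact: undup_uniq.
- move=> p; rewrite mem_undup mem_cat mem_filter => /orP[/andP[/eqP //]|/mapP[n _ ->]].
  by rewrite ncM nc_expi mulr1 nc_real gtr0_norm.
- move=> n; rewrite mem_undup mem_cat; apply/orP; right; apply/mapP.
  by exists n; rewrite ?mem_enum.
- move=> z /andP[z1 z2]; rewrite mem_undup mem_cat negb_or mem_filter => /andP[zS _] i j.
  have [t ht zE] := polar z.
  have [||Uz Pz] := hS (nc z) t.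
  + by rewrite ltr_norml; apply/andP; split; lra.
  + by rewrite add0r.
  rewrite -zE in Uz Pz.
  have [_ _ hder _] := hP (i, j); apply: hder => // Pzz.
  have zSS := Pz _ Pzz; rewrite zSS andbT in zS.
  have : rB < nc z by rewrite lt_neqAle eq_sym zS.
  by move/(hs _ zSS); rewrite leNgt z2.
Qed.

Section FixedPoles.
Variables (s : R) (S : seq R[i]).
Hypotheses (rs : rB < s) (uS : uniq S) (Sr : forall p, p \in S -> nc p = rB)
  (Fder : forall z : R[i], rB <= nc z < s -> z \notin S ->
     forall i j, derivable ((fun w => F w i j) : cfun R) z 1).

Let S0 p : p \in S -> p != 0. Proof. by move=> /Sr e; rewrite -nc_gt0 e. Qed.
Let s0 : 0 < s. Proof. exact: lt_trans rs. Qed.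

Lemma pole_order_bound : exists n : nat, forall p i j, p \in S -> exists L : (R[i])^o,
  (fun z : (R[i])^o => (z - p) ^+ n * F z i j : (R[i])^o) @ (p : (R[i])^o)^' --> L.
Proof.
have h (q : R[i] * 'I_M0 * 'I_M) : exists m : nat, q.1.1 \in S -> exists L : (R[i])^o,
   (fun z : (R[i])^o => (z - q.1.1) ^+ m * F z q.1.2 q.2 : (R[i])^o) @ (q.1.1 : (R[i])^o)^' --> L.
  case: q => [[p i] j] /=; have [pS|pS] := boolP (p \in S); last by exists 0%N.
  have [P [PU Piso Pder Pm]] := Fmer i j.
  have Up : U p by apply: UB; rewrite Sr.
  have [Pp|Pp] := pselect (P p); first by have [m [L hL]] := Pm p Pp; exists m => _; exists L.
  exists 0%N => _; exists (F p i j).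
  under eq_fun do rewrite expr0 mul1r.
  apply: (@ceps_cvg_dnbhs (fun z => F z i j)).
  exact/ceps_derivable/Pder.
have [m hm] := choice h.
pose n := (\sum_(p <- S) \sum_i \sum_j m (p, i, j))%N; exists n => p i j pS.
have mn : (m (p, i, j) <= n)%N.
  rewrite /n (big_rem p) //= (bigD1 i) //= (bigD1 j) //= -!addnA leq_addr //.
have [L hL] := hm (p, i, j) pS; rewrite /= in hL.
exists ((p - p) ^+ (n - m (p, i, j)) * L).
have -> : (fun z : (R[i])^o => (z - p) ^+ n * F z i j) =
   (fun z => (z - p) ^+ (n - m (p, i, j)) * ((z - p) ^+ m (p, i, j) * F z i j)).
  by apply/funext => z; rewrite mulrA -exprD subnK.
apply: cvg_dnbhs_mul; last exact: hL.
apply: (@ceps_cvg_dnbhs (fun z => (z - p) ^+ (n - m (p, i, j)))).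
by apply: ceps_derivable; exact: derivable_exp_sub.
Qed.

Lemma ev_conv_bC P i j z : nc z < rB ->
  ev (conv (coefs P) (bC i j)) z = P.[z] * F z i j.
Proof.
move=> zr; have [zr' rr] := midf_lt zr; set r := _ / 2 in zr' rr.
have r0 : 0 < r by apply: le_lt_trans zr'; exact: nc_ge0.
by rewrite (ev_poly _ r0 zr') ?FE //; exact: bdec.
Qed.

Lemma cleared_poles : exists n : nat, (mB <= n)%N /\ forall i j, exists2 s', rB < s' <= s &
   decay s' (conv (coefs (polesP S ^+ n)) (bC i j)) /\
   forall z, nc z < s' -> z \notin S ->
     (polesP S ^+ n).[z] * F z i j = ev (conv (coefs (polesP S ^+ n)) (bC i j)) z.
Proof.
(* One power beyond the pole orders: the cleared function, set to 0 on [S], has at each pole the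
   difference quotient [G] below, whose limit exists and is the derivative. The maximum with [mB]
   lets [order_reduction] descend from n. *)
have [n0 hn0] := pole_order_bound; pose n := maxn n0.+1 mB.
have n0n : (n0 < n)%N by rewrite leq_maxl.
exists n; split; first by rewrite leq_maxr.
move=> i j; pose D := polesP S ^+ n.
pose f : cfun R := fun z => if z \in S then 0 else D.[z] * F z i j.
have fd z : nc z < s -> derivable f z 1.
  move=> zs; have [r r0 hr] := seq_isolated S z.
  have [zS|zS] := boolP (z \in S); last first.
    have dF : derivable ((fun w => F w i j) : cfun R) z 1.
      have [zr|rz] := ltP (nc z) rB; last by apply: Fder => //; rewrite rz.
      have [zr' rr'] := midf_lt zr; set r' := _ / 2 in zr' rr'.
      have r'0 : 0 < r' by apply: le_lt_trans zr'; exact: nc_ge0.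
      apply: (@eq_near_derivable _ (ev (bC i j)) _ z (rB - nc z)).
      - by rewrite subr_gt0.
      - move=> w wz; rewrite FE //; have := nc_le_sub w z; lra.
      - by apply: derivable_ev zr' _ => //; exact: bdec.
    apply: (@eq_near_derivable _ (fun w => D.[w] * F w i j) f z r); first exact: r0.
      move=> w wr; rewrite /f ifN //; have [->|wz] := eqVneq w z; [exact: zS | exact: hr].
    by apply: derivable_mul; [exact: derivable_horner | exact: dF].
  have zr := Sr zS; have z0 := S0 zS.
  have [L hL] := hn0 z i j zS.
  pose G : cfun R := fun w =>
    ((- z^-1) ^+ n * (polesPx S z ^+ n).[w]) * ((w - z) ^+ (n.-1 - n0) * ((w - z) ^+ n0 * F w i j)).
  have [L' hL'] : exists L' : (R[i])^o, G @ (z : (R[i])^o)^' --> L'.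
    exists (((- z^-1) ^+ n * (polesPx S z ^+ n).[z]) * ((z - z) ^+ (n.-1 - n0) * L)).
    apply: cvg_dnbhs_mul.
      apply: (@ceps_cvg_dnbhs (fun w => (- z^-1) ^+ n * (polesPx S z ^+ n).[w])).
      apply: ceps_derivable; apply: derivable_mul; first exact: derivable_cst.
      exact: derivable_horner.
    apply: cvg_dnbhs_mul; last exact: hL.
    apply: (@ceps_cvg_dnbhs (fun w => (w - z) ^+ (n.-1 - n0))).
    by apply: ceps_derivable; exact: derivable_exp_sub.
  apply/derivable_epsP; exists L' => e e0.
  have [r2 r20 hr2] := (cvg_dnbhsC _ _ _).1 hL' e e0.
  exists (Num.min r r2); first by rewrite lt_min r0.
  move=> w; rewrite lt_min => /andP[w1 w2].
  have [->|wz] := eqVneq w z; first by rewrite !subrr mulr0 subrr nc0 mulr0.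
  rewrite /f zS subr0 ifN ?hr //.
  have -> : D.[w] * F w i j = (w - z) * G w.
    rewrite /D (polesP_D1 uS zS) exprMn hornerM !horner_exp horner_lin /G horner_exp.
    have -> : 1 - w / z = - z^-1 * (w - z) by field.
    rewrite exprMn; have -> : (w - z) ^+ n = (w - z) * (w - z) ^+ (n.-1 - n0) * (w - z) ^+ n0.
      rewrite -mulrA -exprD -exprS; congr (_ ^+ _).
      by rewrite subnK ?prednK // ?(leq_ltn_trans _ n0n) // -ltnS prednK // (leq_ltn_trans _ n0n).
    ring.
  rewrite [L' * _]mulrC -mulrBr ncM mulrC ler_wpM2r ?nc_ge0 // ltW //; exact: hr2.
pose h := conv (coefs D) (bC i j).
have fE z : nc z < rB -> f z = ev h z.
  move=> zr; rewrite /f ifN ?ev_conv_bC //.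
  by apply/negP => /Sr e; rewrite e ltxx in zr.
have [rs' s's] := midf_lt rs; set s' := _ / 2 in rs' s's.
have s'0 : 0 < s' by exact: lt_trans rs'.
have hB2 : 0 < rB / 2 by rewrite divr_gt0.
have hBB : rB / 2 < rB by rewrite ltr_pdivrMr // ltr_pMr // ltr1n.
have hd : decay s' h.
  apply: (@cauchy_decay _ f h (rB / 4) (rB / 2) s 0); rewrite ?s'0 //.
  - by rewrite divr_gt0.
  - by rewrite ltr_pM2l // ltf_pV2 ?posrE // ltr_nat.
  - by apply: decay_poly => //; exact: bdec.
  - by move=> z /andP[_ zs]; exact/ceps_derivable/fd.
  - by move=> z /andP[_ zs] _; exact: fd.
  - by move=> z /andP[_ zs]; apply: fE; exact: lt_trans hBB.
exists s'; first by rewrite rs' ltW.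
split => // z zs zS.
have fz : f z = D.[z] * F z i j by rewrite /f ifN.
rewrite -fz; apply/eqP; rewrite -subr_eq0; apply/eqP.
apply: (@identity_theorem _ (fun w => f w - ev h w) (rB / 2) s' hB2 _ _ _ z zs).
- by apply: ltW; exact: lt_trans rs'.
- move=> w ws; apply: derivableB; first by apply: fd; exact: lt_trans s's.
  exact: derivable_ev hd.
- by move=> w wr; rewrite fE ?subrr //; exact: lt_trans hBB.
Qed.

(* Since the [b i j k] are nonnegative, [F] is largest in modulus on the positive ray, where its
   growth has order [mB]: no boundary pole has a larger order. *)
Lemma radial_bound i j : exists (K t0 : R), t0 < 1 /\ forall t : R, t0 < t < 1 -> forall p, nc p = rB ->
   (1 - t) ^+ mB * nc (F (t%:C * p) i j) <= K.
Proof.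
pose n0 : 'I_N := Ordinal N0.
have := @FBt n0 i j; rewrite ang0 // expi0 mulr1 => /cvg_dnbhsC/(_ 1 ltr01)[d d0 hd].
exists (nc (Bt n0 i j) + 1), (Num.max 0 (1 - d / rB)); split.
  by rewrite gt_max ltr01 /= gtrDl oppr_lt0 divr_gt0.
move=> t; rewrite gt_max => /andP[/andP[t0 td] t1] p pr.
have pt : nc (t%:C * p) = t * rB by rewrite ncM pr nc_real gtr0_norm.
have trB : t * rB < rB by rewrite gtr_pMl.
have [tr rr] := midf_lt trB; set r := _ / 2 in tr rr.
have r0 : 0 < r by apply: lt_trans tr; exact: mulr_gt0.
have le1 : nc (F (t%:C * p) i j) <= nc (F (t * rB)%:C i j).
  have h1 : nc (t%:C * p) < rB by rewrite pt.
  have h2 : nc (t * rB)%:C < rB by rewrite nc_real gtr0_norm // mulr_gt0.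
  have h3 : nc (t%:C * p) < r by rewrite pt.
  have := @nonneg_ev_le (b i j) r (t%:C * p) (b0 i j) r0 h3 (bdec _ _ r0 rr).
  by rewrite {1}pt (FE i j h1) (FE i j h2).
apply: (@le_trans _ _ (nc ((1 - (t * rB)%:C / rB%:C) ^+ mB * F (t * rB)%:C i j))).
  rewrite ncM ncX rmorphM /= mulfK; last by rewrite -nc_eq0 nc_real normr_eq0 gt_eqF.
  have -> : nc (1 - t%:C) = 1 - t.
    by rewrite -[1 in LHS](rmorph1 (real_complex R)) -rmorphB nc_real ger0_norm // subr_ge0 ltW.
  by rewrite -rmorphM ler_wpM2l // exprn_ge0 // subr_ge0 ltW.
have := hd (t * rB)%:C; rewrite -rmorphB nc_real => h.
apply: (le_trans (nc_le_sub _ (Bt n0 i j))); rewrite addrC lerD2l ltW //; apply: h.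
  rewrite ltr0_norm ?subr_lt0 // opprB -{1}[rB]mul1r -mulrBl -ltr_pdivlMr //; lra.
by apply: contraTneq trB => /complexI ->; rewrite ltxx.
Qed.

(** As long as the exponent exceeds [mB], the radial bound makes the numerator O(1 - t) at t p, so
    it vanishes at every p in [S] and one factor [polesP S] divides out. *)
Lemma order_reduction i j s' n : rB < s' -> (mB <= n)%N ->
  decay s' (conv (coefs (polesP S ^+ n)) (bC i j)) ->
  decay s' (conv (coefs (polesP S ^+ mB)) (bC i j)).
Proof.
move=> rs' mn; have s'0 : 0 < s' by exact: lt_trans rs'.
rewrite -(subnK mn); elim: (n - mB)%N => [//|m IH] hd; apply: IH.
move: hd; rewrite addSn; set k := (m + mB)%N => hd.
have [K [t0 [t01 hK]]] := radial_bound i j.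
have [||q qd qE] := @divide_roots R S s' _ s'0 uS _ hd.
- by move=> p pS; rewrite S0 // Sr.
- move=> p pS; have pr := Sr pS.
  have ps : nc p < s' by rewrite pr.
  pose B1 := \prod_(q <- S | q != p) (1 + rB / rB).
  have B10 : 0 <= B1 by apply: prodr_ge0 => q _; rewrite divff ?gt_eqF.
  apply: (@radial_zero _ _ (B1 ^+ k.+1 * `|K|) (Num.max t0 0)).
    exact/ceps_derivable/(derivable_ev s'0 ps hd).
    by rewrite gt_max t01 ltr01.
  move=> t; rewrite gt_max => /andP[/andP[tt0 t00] t1].
  have zr : nc (t%:C * p) < rB by rewrite ncM pr nc_real gtr0_norm // gtr_pMl.
  rewrite ev_conv_bC // (polesP_D1 uS pS) exprMn hornerM !horner_exp horner_lin mulfK ?S0 //.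
  rewrite !ncM !ncX.
  have -> : nc (1 - t%:C) = 1 - t.
    by rewrite -[1 in LHS](rmorph1 (real_complex R)) -rmorphB nc_real ger0_norm // subr_ge0 ltW.
  have hB1 : nc (polesPx S p).[t%:C * p] ^+ k.+1 <= B1 ^+ k.+1.
    apply: lerXn2r; rewrite ?nnegrE ?nc_ge0 //.
    rewrite /polesPx horner_prod nc_prod; rewrite big_seq_cond [leRHS]big_seq_cond.
    apply: ler_prod => q /andP[qS qp]; rewrite nc_ge0 /= horner_lin.
    apply: (le_trans (ncB _ _)); rewrite nc1 lerD2l ncM ncV (Sr qS).
    by rewrite ler_wpM2r ?invr_ge0 ?(ltW rB0) // ltW.
  have hF : (1 - t) ^+ mB * nc (F (t%:C * p) i j) <= `|K|.
    by apply: le_trans (ler_norm _); apply: hK => //; rewrite tt0.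
  have u0 : 0 <= 1 - t by rewrite subr_ge0 ltW.
  have u1 : 1 - t <= 1 by rewrite gerBl ltW.
  have -> : (1 - t) ^+ k.+1 = (1 - t) * (1 - t) ^+ m * (1 - t) ^+ mB.
    by rewrite -mulrA -exprD -exprS.
  have -> : (1 - t) * (1 - t) ^+ m * (1 - t) ^+ mB * nc (polesPx S p).[t%:C * p] ^+ k.+1 * nc (F (t%:C * p) i j)
     = nc (polesPx S p).[t%:C * p] ^+ k.+1 * ((1 - t) ^+ mB * nc (F (t%:C * p) i j)) * ((1 - t) ^+ m * (1 - t)).
    ring.
  apply: ler_pM; rewrite ?mulr_ge0 ?exprn_ge0 ?nc_ge0 //.
    by apply: ler_pM => //; rewrite ?mulr_ge0 ?exprn_ge0 ?nc_ge0.
  by rewrite ler_piMl // exprn_ile1.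
- suff -> : conv (coefs (polesP S ^+ k)) (bC i j) = q by [].
  apply: (@conv_lins_inj _ S 1); rewrite expr1 -qE exprS -conv_coefs convA //.
Qed.

End FixedPoles.

(** The limit of (1 - z / p)^mB F(z) at p is the algebraic coefficient [pf_coef]. Uniqueness of
    limits identifies it with [Bt n] at r_B zeta_n; at any other p a nonzero value would make p /
    r_B one of the zeta_n. *)
Lemma boundary_structure : exists (s : R) (S : seq R[i]) (h : 'I_M0 -> 'I_M -> nat -> R[i]),
 [/\ [/\ rB < s, uniq S & forall p, p \in S -> nc p = rB],
     forall i j, decay s (h i j),
     forall i j, conv (coefs (polesP S ^+ mB)) (bC i j) = h i j,
     forall n, rB%:C * expi (ang n) \in S /\
        forall i j, pf_coef S mB (h i j) (rB%:C * expi (ang n)) = Bt n i j &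
     forall p, p \in S -> (forall n, p != rB%:C * expi (ang n)) ->
        forall i j, pf_coef S mB (h i j) p = 0].
Proof.
have [s1 [S [rs1 uS Sr Szeta Fder]]] := finite_boundary_poles.
have S0 p : p \in S -> p != 0 by move=> /Sr e; rewrite -nc_gt0 e.
have [n [mn hn]] := cleared_poles rs1 uS Sr Fder.
pose h i j := conv (coefs (polesP S ^+ mB)) (bC i j).
have hn' (ij : 'I_M0 * 'I_M) : exists s', [/\ rB < s' <= s1,
    decay s' (conv (coefs (polesP S ^+ n)) (bC ij.1 ij.2)) &
    forall z, nc z < s' -> z \notin S -> (polesP S ^+ n).[z] * F z ij.1 ij.2 =
      ev (conv (coefs (polesP S ^+ n)) (bC ij.1 ij.2)) z].
  by have [s' h1 [h2 h3]] := hn ij.1 ij.2; exists s'.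
have [sf hsf] := choice hn'.
have sf0 : forall ij, rB < sf ij <= s1 by move=> ij; have [] := hsf ij.
have sfd ij : decay (sf ij) (conv (coefs (polesP S ^+ n)) (bC ij.1 ij.2)) by have [] := hsf ij.
have hdec ij : decay (sf ij) (h ij.1 ij.2).
  by apply: (order_reduction uS Sr _ mn (sfd ij)); have /andP[] := sf0 ij.
have lim p i j : p \in S -> (fun z : (R[i])^o => ((1 - z / p) ^+ mB * F z i j : (R[i])^o))
     @ (p : (R[i])^o)^' --> (pf_coef S mB (h i j) p : (R[i])^o).
  move=> pS; have [_ _ hF] := hsf (i, j); have /andP[rsf _] := sf0 (i, j).
  have hd := hdec (i, j); rewrite /= in hF hd.
  have sp : 0 < sf (i, j) by exact: lt_trans rsf.
  have [r r0 hr] := seq_isolated S p.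
  pose Dx := (polesPx S p ^+ mB).
  have Dxp : Dx.[p] != 0 by rewrite horner_exp expf_neq0 // polesPx_neq0.
  have ps : nc p < sf (i, j) by rewrite Sr.
  apply: (@cvg_dnbhs_eq (fun z => ev (h i j) z * (Dx.[z])^-1) _ p _ (Num.min r (sf (i, j) - nc p))).
  - by rewrite lt_min r0 subr_gt0.
  - move=> z; rewrite lt_min => /andP[zr zs] zp.
    have zS := hr _ zr zp.
    have zsf : nc z < sf (i, j) by have := nc_le_sub z p; lra.
    have Dz : (polesP S).[z] != 0.
      rewrite /polesP horner_prod prodf_seq_neq0; apply/allP => q qS /=.
      rewrite horner_lin subr_eq0; apply: contraNneq zS => /(congr1 (fun w => w * q)).
      by rewrite mul1r divfK ?S0 // => <-.
    have Dxz : Dx.[z] != 0.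
      by move: Dz; rewrite (polesP_D1 uS pS) hornerM mulf_eq0 negb_or horner_exp => /andP[_ ?]; rewrite expf_neq0.
    apply: (mulIf Dxz); rewrite divfK //.
    have := hF z zsf zS; rewrite -[in X in _ -> _ = X]horner_lin.
    rewrite -{1 2}(subnK mn) exprD -conv_coefs -convA (ev_poly _ sp zsf hd) hornerM -mulrA.
    have Dzn : (polesP S ^+ (n - mB)).[z] != 0 by rewrite horner_exp expf_neq0.
    move/(mulfI Dzn) => <-; rewrite /Dx (polesP_D1 uS pS) exprMn hornerM !horner_exp.
    by rewrite horner_lin; ring.
  - rewrite /pf_coef -horner_exp -/Dx; apply: cvg_dnbhs_mul.
      by apply: ceps_cvg_dnbhs; apply: ceps_derivable; exact: derivable_ev hd.
    apply: (@ceps_cvg_dnbhs (fun z => Dx.[z]^-1)); apply: ceps_derivable.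
    by apply: derivableV => //; exact: derivable_horner.
have [s [rs sle]] : exists s, rB < s /\ forall ij, s <= sf ij.
  have gap : \forall e \near (0 : R)^'+, forall ij : 'I_M0 * 'I_M, rB + e <= sf ij.
    apply: filter_forall => ij; near=> e.
    rewrite -lerBrDl; near: e; apply: nbhs_right_le; rewrite subr_gt0.
    by have /andP[] := sf0 ij.
  near (0 : R)^'+ => e; exists (rB + e); split; last by near: e.
  by rewrite ltrDl; near: e; exact: nbhs_right_gt.
exists s, S, h; split => //.
- move=> i j; apply: (decay_le _ (sle (i, j)) (hdec (i, j))).
  by apply: ltW; exact: lt_trans rs.
- move=> k; split => // i j; apply: cvg_dnbhs_unique (lim _ i j (Szeta k)) _.
  exact: FBt.
- move=> p pS pn i j.
  pose L : 'M[R[i]]_(M0, M) := \matrix_(i, j) pf_coef S mB (h i j) p.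
  have rC : rB%:C != 0 :> R[i] by rewrite -nc_eq0 nc_real normr_eq0 gt_eqF.
  have pE : p = rB%:C * (p / rB%:C) by rewrite mulrC divfK.
  have [L0|L0] := eqVneq L 0; first by move/matrixP: L0 => /(_ i j); rewrite !mxE.
  have [||k hk] := @Fother (p / rB%:C).
  + by rewrite ncM ncV nc_real gtr0_norm // Sr // divff // gt_eqF.
  + exists L; split => //; rewrite -pE => i' j'; rewrite mxE; exact: lim.
  by move: (pn k); rewrite -hk -pE eqxx.
Unshelve. all: by end_near. Qed.

End BoundaryPoles.

(** * Generating functions of levels and tails *)

Section TailAsymptotics.
Context {R : realType}.
#[local] Opaque ev ComplexField.Normc.normc.

Lemma gen_funE (m n : nat) (G : nat -> 'M[R]_(m, n)) (z : R[i]) i j :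
  gen_fun G z i j = ev (fun k => (G k i j)%:C) z.
Proof. by rewrite mxE. Qed.

Variables (M0 M : nat) (B : nat -> 'M[R]_(M0, M)) (A : nat -> 'M[R]_M)
  (x0 : 'rV[R]_M0) (x : nat -> 'rV[R]_M) (rB theta sA : R).
Hypotheses (A0 : forall k, nonneg_mx (A k))
  (x_ge0 : forall k j, (0 < k)%N -> 0 <= x k 0 j)
  (xE : forall k, (0 < k)%N -> x k = x0 *m B k + \sum_(l < k.+1) x l.+1 *m A (k - l)%N)
  (rB1 : 1 < rB) (rBtheta : rB < theta) (thetas : theta < sA)
  (As : forall i j, decay sA (fun k => (A k i j)%:C))
  (super : forall r, 1 < r < theta ->
     exists2 w, (forall i, 0 < w i) & forall i, mact (genR A r) w i < r * w i)
  (xd : forall r, 1 < r < rB -> exists C : R, forall k j, x k.+1 0 j * r ^+ k.+1 <= C)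
  (Bdec : forall r i j, 0 < r -> r < rB -> decay r (fun k => (Bext B k i j)%:C)).

Let rB0 : 0 < rB. Proof. exact: lt_trans ltr01 rB1. Qed.

(** Index 0 gets a default: [x 0] is unconstrained, level 0 being [x0]. *)
Definition levels (j : 'I_M) (k : nat) : R[i] := (if k is 0 then 0 else x k 0 j)%:C.
Definition tails (j : 'I_M) (k : nat) : R[i] := (xbar x k 0 j)%:C.
Definition kernel_mx (z : R[i]) : 'M[R[i]]_M := z%:M - gen_fun A z.

Lemma decay_levels r j : 0 < r -> r < rB -> decay r (levels j).
Proof.
move=> r0 rrB; have [r1|r1] := leP r 1.
  have [h1 h2] := midf_lt rB1; set r2 := _ / 2 in h1 h2.
  have [|C hC] := xd (r := r2); first by rewrite h1.
  apply: (@decay_le _ r r2); [exact: ltW | exact: le_trans r1 (ltW h1) |].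
  exists `|C| => -[|k]; rewrite nc_real; first by rewrite normr0 mul0r.
  by rewrite ger0_norm ?x_ge0 //; apply: le_trans (hC k j) (ler_norm _).
have [|C hC] := xd (r := r); first by rewrite r1.
exists `|C| => -[|k]; rewrite nc_real; first by rewrite normr0 mul0r.
by rewrite ger0_norm ?x_ge0 //; apply: le_trans (hC k j) (ler_norm _).
Qed.

Lemma cvg_levels j k : series (fun n => x (n + k.+1)%N 0 j) @ \oo --> xbar x k 0 j.
Proof.
rewrite mxE; have [h1 h2] := midf_lt rB1; set r2 := _ / 2 in h1 h2.
have r20 : 0 < r2 by exact: lt_trans h1.
have [|C hC] := xd (r := r2); first by rewrite h1.
apply: (@real_normed_geo_cvg _ _ (`|C|) r2^-1).
  by rewrite invr_ge0 (ltW r20) /= invf_lt1.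
move=> n; rewrite ger0_norm ?x_ge0 ?addnS // exprVn ler_pdivlMr ?exprn_gt0 //.
apply: (@le_trans _ _ (x (n + k).+1 0 j * r2 ^+ (n + k).+1)).
  rewrite ler_wpM2l ?x_ge0 // ler_weXn2l ?(ltW h1) //.
  by rewrite -addnS leq_addr.
exact: le_trans (hC _ j) (ler_norm _).
Qed.

Lemma xbarS j k : xbar x k 0 j = x k.+1 0 j + xbar x k.+1 0 j.
Proof.
have h := @cvg_levels j k.
have h' : series (fun n => x (n + k.+1)%N 0 j) @ \oo --> x (0 + k.+1)%N 0 j + xbar x k.+1 0 j.
  apply: series_shift; have := @cvg_levels j k.+1.
  by under eq_fun do rewrite addnS -addSn.
by rewrite -(series_limE h) (series_limE h').
Qed.

Lemma xbar_ge0 j k : 0 <= xbar x k 0 j.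
Proof.
apply: (@series_cvg_ge0 _ (fun n => x (n + k.+1)%N 0 j)); last exact: cvg_levels.
by move=> n; apply: x_ge0; rewrite addnS.
Qed.

Lemma decay_tails r j : 1 < r -> r < rB -> decay r (tails j).
Proof.
move=> r1 rrB; have r0 : 0 < r by exact: lt_trans r1.
have [|C hC] := xd (r := r); first by rewrite r1.
have ri01 : `|r^-1| < 1 by rewrite gtr0_norm ?invr_gt0 // invf_lt1.
exists (`|C| / (1 - r^-1)) => k; rewrite nc_real ger0_norm ?xbar_ge0 //.
rewrite -ler_pdivlMr ?exprn_gt0 //.
rewrite (_ : _ / _ = `|C| / r ^+ k * (1 - r^-1)^-1); last by rewrite mulrAC.
apply: (@series_cvg_le _ (fun n => x (n + k.+1)%N 0 j) (geometric (`|C| / r ^+ k) r^-1));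
  [|exact: cvg_levels|exact: cvg_geometric_series].
move=> n /=; rewrite exprVn -mulrA -invfM ler_pdivlMr ?mulr_gt0 ?exprn_gt0 //.
rewrite -exprD addnS addnC; apply: (@le_trans _ _ (x (k + n).+1 0 j * r ^+ (k + n).+1)).
  by rewrite ler_wpM2l ?x_ge0 // ler_weXn2l // ltW.
exact: le_trans (hC _ j) (ler_norm _).
Qed.

Lemma ev_tails j z : nc z < rB -> (1 - z) * ev (tails j) z = tails j 0 - ev (levels j) z.
Proof.
move=> zr; have m1 : Num.max 1 (nc z) < rB by rewrite gt_max rB1.
have [h1 h2] := midf_lt m1; set r := _ / 2 in h1 h2.
move: h1; rewrite gt_max => /andP[r1 zr1]; have r0 : 0 < r by exact: lt_trans r1.
have e : conv (coefs (lin 1)) (tails j) = fun k => coefs (tails j 0)%:P k - levels j k.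
  apply/funext => -[|k]; first by rewrite conv_lin0 /coefs coefC /= subr0.
  rewrite conv_linS /coefs coefC /= invr1 mul1r sub0r /tails [in X in _ - X]xbarS.
  by rewrite rmorphD /=; ring.
have := ev_lin 1 r0 zr1 (decay_tails j r1 h2); rewrite divr1 => <-.
by rewrite e (evB r0 zr1 (decay_coefs _ _) (decay_levels j r0 h2)) ev_coefs hornerC.
Qed.

(* The convolution of the levels with [A] has the extra term [x 1 *m A 0] at index 1. *)
Definition exitc (j : 'I_M) : R[i] := (\sum_i x 1%N 0 i * A 0%N i j)%:C.

(** The factor z aligns the indices: coefficient k + 1 of the convolution of [levels] with [A] is
    the sum of x(l+1) A(k-l), as in the equation of level k. At k = 0 there is no such equation, and
    the surplus x(1) A(0) is what [exitc] removes. *)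
Lemma ev_levels j z : nc z < rB ->
  z * ev (levels j) z = \sum_i ev (levels i) z * gen_fun A z i j
   + z * (\sum_a (x0 0 a)%:C * gen_fun (Bext B) z a j - exitc j).
Proof.
move=> zr; have [zr1 rr] := midf_lt zr; set r := _ / 2 in zr1 rr.
have r0 : 0 < r by apply: le_lt_trans zr1; exact: nc_ge0.
have Ad i : decay r (fun k => (A k i j)%:C).
  by apply: (decay_le _ _ (As i j)); rewrite ltW // (lt_trans rr) // (lt_trans rBtheta).
have dx i : decay r (levels i) by exact: decay_levels.
have db a : decay r (fun k => (Bext B k a j)%:C) by exact: Bdec.
have [zr2 rr2] := midf_lt zr1; set r' := _ / 2 in zr2 rr2.
have r'0 : 0 < r' by apply: le_lt_trans zr2; exact: nc_ge0.
have dconv i : decay r' (conv (levels i) (fun k => (A k i j)%:C)).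
  by apply: (decay_conv r'0 rr2 _ (Ad i)); apply: decay_le (dx i); exact: ltW.
pose T1 k := \sum_i conv (levels i) (fun k => (A k i j)%:C) k.
pose T2 k := \sum_a (x0 0 a)%:C * (Bext B k a j)%:C.
have dT2 : decay r T2 by apply: decay_sum => [|a _]; [exact: ltW | exact: decayZ].
have dT2' : decay r' (conv (coefs 'X) T2).
  by apply: decay_poly => //; apply: decay_le dT2; exact: ltW.
have dT1 : decay r' T1 by apply: decay_sum => [|a _]; [exact: ltW | exact: dconv].
have e : conv (coefs 'X) (levels j) =
   fun k => T1 k + (conv (coefs 'X) T2 k - coefs (exitc j *: 'X) k).
  have cX u k : conv (coefs 'X) u k = if k is k'.+1 then u k' else 0.
    case: k => [|k]; rewrite /conv /coefs.
      by rewrite big_ord_recl big_ord0 coefX mul0r addr0.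
    rewrite !big_ord_recl !coefX /= mul0r mul1r big1 ?addr0 ?add0r.
      by rewrite /bump /= addn0 subn1.
    by move=> i _; rewrite coefX mul0r.
  apply/funext => -[|k]; rewrite !cX.
    rewrite /T1 big1 ?add0r /coefs ?coefZ ?coefX ?mulr0 ?subr0 ?oppr0 // => i _.
    by rewrite /conv big_ord_recl big_ord0 mul0r addr0.
  have T1E : T1 k.+1 = (\sum_(l < k.+1) (x l.+1 *m A (k - l)%N) 0 j)%:C.
    rewrite /T1 /conv.
    under eq_bigr => i _ do rewrite big_ord_recl mul0r add0r.
    rewrite exchange_big /= rmorph_sum; apply: eq_bigr => l _; rewrite mxE rmorph_sum.
    by apply: eq_bigr => i _; rewrite rmorphM /= /bump /= add1n subSS.
  rewrite T1E /coefs coefZ coefX; case: k {T1E} => [|k] /=.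
    have T20 : T2 0%N = 0 by rewrite /T2 big1 // => a _; rewrite mxE mulr0.
    by rewrite big_ord1 subnn mxE T20 sub0r mulr1 /exitc subrr.
  rewrite mulr0 subr0 /levels (xE (k := k.+1)) // mxE summxE rmorphD addrC; congr (_ + _).
  by rewrite /T2 mxE rmorph_sum; apply: eq_bigr => a _; rewrite rmorphM.
have -> : z * ev (levels j) z = ev (conv (coefs 'X) (levels j)) z.
  by rewrite (ev_poly _ r0 zr1 (dx j)) hornerX.
rewrite e (evD r'0 zr2 dT1); last by apply: decayB => //; [exact: ltW | exact: decay_coefs].
rewrite (evB r'0 zr2 dT2' (decay_coefs _ _)) ev_coefs hornerZ hornerX.
rewrite (ev_poly _ r0 zr1 dT2) hornerX mulrBr [exitc j * z]mulrC.
have -> : ev T1 z = \sum_i ev (levels i) z * gen_fun A z i j.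
  rewrite (ev_sum _ r'0 zr2) //; apply: eq_bigr => i _.
  by rewrite (ev_conv r0 zr1 (dx i) (Ad i)) gen_funE.
have -> : ev T2 z = \sum_a (x0 0 a)%:C * gen_fun (Bext B) z a j.
  rewrite (ev_sum _ r0 zr1); last by move=> a _; exact: decayZ.
  by apply: eq_bigr => a _; rewrite (evZ _ r0 zr1 (db a)) gen_funE.
ring.
Qed.

(** For a null row vector v, the moduli satisfy |z| |v_j| <= sum_i |v_i| A^*(|z|)_ij. They form a
    row subsolution at r = |z|, which the strict supersolution forces to be 0. *)
Lemma kernel_unit z : 1 < nc z < theta -> kernel_mx z \in unitmx.
Proof.
move=> /andP[z1 zt]; rewrite unitmxE unitfE; apply/det0P => -[v vn0 vQ].
have z0 : 0 < nc z by exact: lt_trans z1.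
have zs : nc z < sA by exact: lt_trans thetas.
have sA0 : 0 < sA by exact: lt_trans zs.
have [|w w0 hw] := super (r := nc z); first by rewrite z1.
have gle i j : nc (gen_fun A z i j) <= genR A (nc z) i j.
  rewrite gen_funE; apply: (le_trans (nonneg_ev_le (fun k => A0 k i j) sA0 zs (As i j))).
  rewrite (ev_real (genR_cvg (nc_ge0 z) zs (As i j))) nc_real ger0_norm //.
  exact: (genR_ge0 A0 As (nc_ge0 z) zs).
move/eqP: vn0; apply; apply/rowP => j; rewrite mxE; apply/eqP; rewrite -nc_eq0; apply/eqP.
apply: (row_subsolution0 w0 hw (y := fun j => nc (v 0 j))) => {}j; first exact: nc_ge0.
have : v 0 j * z = \sum_i v 0 i * gen_fun A z i j.
  move/matrixP: vQ => /(_ 0 j); rewrite /kernel_mx mulmxBr mul_mx_scalar !mxE => /eqP.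
  by rewrite subr_eq0 mulrC => /eqP.
move/(congr1 nc); rewrite ncM mulrC => ->.
apply: (le_trans (nc_sum _ _ _)); apply: ler_sum => i _; rewrite ncM.
by rewrite ler_wpM2l ?nc_ge0.
Qed.

Lemma kernel_solution j z : 1 < nc z < rB ->
  ev (levels j) z = \sum_i z * (\sum_a (x0 0 a)%:C * gen_fun (Bext B) z a i - exitc i)
     * ((\det (kernel_mx z))^-1 * \adj (kernel_mx z) i j).
Proof.
move=> /andP[z1 zr].
have Qu : kernel_mx z \in unitmx by apply: kernel_unit; rewrite z1 (lt_trans zr).
pose V : 'rV[R[i]]_M := \row_i ev (levels i) z.
pose W : 'rV[R[i]]_M := \row_i (z * (\sum_a (x0 0 a)%:C * gen_fun (Bext B) z a i - exitc i)).
have VQ : V *m kernel_mx z = W.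
  apply/rowP => i; rewrite /kernel_mx mulmxBr mul_mx_scalar !mxE (ev_levels i zr).
  under [X in _ - X]eq_bigr => l _ do rewrite mxE.
  by rewrite addrAC subrr add0r.
have : V = W *m invmx (kernel_mx z) by rewrite -VQ mulmxK.
move/rowP => /(_ j); rewrite !mxE => ->; apply: eq_bigr => i _.
by rewrite !mxE /invmx Qu !mxE.
Qed.

Section WithPoles.
Variables (mB : nat) (s : R) (S : seq R[i]) (h : 'I_M0 -> 'I_M -> nat -> R[i]).
Hypotheses (mB0 : (0 < mB)%N) (rs : rB < s) (uS : uniq S)
  (Sr : forall p, p \in S -> nc p = rB)
  (hd : forall i j, decay s (h i j))
  (hE : forall i j, conv (coefs (polesP S ^+ mB)) (fun k => (Bext B k i j)%:C) = h i j).

Let s0 : 0 < s. Proof. exact: lt_trans rs. Qed.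
Let S0 p : p \in S -> p != 0. Proof. by move=> /Sr e; rewrite -nc_gt0 e. Qed.

(* Agrees with the generating function of [conv (polesP S ^ mB) (tails j)] for [1 < |z| < rB]
   (cleared_tailE), but makes sense up to [|z| < min s theta]. *)
Definition cleared_tail (j : 'I_M) (z : R[i]) : R[i] :=
  ((polesP S ^+ mB).[z] * tails j 0 -
   \sum_i z * (\sum_a (x0 0 a)%:C * ev (h a i) z - (polesP S ^+ mB).[z] * exitc i)
     * ((\det (kernel_mx z))^-1 * \adj (kernel_mx z) i j)) * (1 - z)^-1.

Lemma cleared_tail_derivable j z : 1 < nc z -> nc z < s -> nc z < theta ->
  derivable (cleared_tail j : cfun R) z 1.
Proof.
move=> z1 zs zt.
have zsA : nc z < sA by exact: lt_trans thetas.
have sA0 : 0 < sA by apply: lt_trans zsA; exact: lt_trans z1.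
have z1n : 1 - z != 0.
  by rewrite subr_eq0; apply: contraTneq z1 => <-; rewrite nc1 ltxx.
have dQ i l : derivable ((fun w => kernel_mx w i l) : cfun R) z 1.
  rewrite (_ : (fun w => _) = (fun w => (('X : {poly R[i]}) *+ (i == l)).[w] - ev (fun k => (A k i l)%:C) w)).
    apply: derivableB; first exact: derivable_horner.
    exact: derivable_ev zsA (As i l).
  by apply/funext => w; rewrite -gen_funE !mxE hornerMn hornerX.
apply: derivable_mul; last first.
  apply: derivableV; first exact: z1n.
  by apply: derivableB; [exact: derivable_cst | exact: derivable_id].
apply: derivableB.
  by apply: derivable_mul; [exact: derivable_horner | exact: derivable_cst].
apply: derivable_bigsum => i _; apply: derivable_mul; last first.
  by apply: derivable_invmx => //; apply: kernel_unit; rewrite z1.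
apply: derivable_mul; first exact: derivable_id.
apply: derivableB.
  apply: derivable_bigsum => a _; apply: derivable_mul; first exact: derivable_cst.
  exact: derivable_ev zs (hd a i).
by apply: derivable_mul; [exact: derivable_horner | exact: derivable_cst].
Qed.

Lemma cleared_tailE j z : 1 < nc z < rB ->
  cleared_tail j z = ev (conv (coefs (polesP S ^+ mB)) (tails j)) z.
Proof.
move=> /andP[z1 zr].
have z1n : 1 - z != 0.
  by rewrite subr_eq0; apply: contraTneq z1 => <-; rewrite nc1 ltxx.
have [zr1 rr] := midf_lt zr; set r := _ / 2 in zr1 rr.
have r1 : 1 < r by exact: lt_trans zr1.
have r0 : 0 < r by exact: lt_trans r1.
rewrite (ev_poly _ r0 zr1 (decay_tails j r1 rr)).
have -> : ev (tails j) z = (tails j 0 - ev (levels j) z) * (1 - z)^-1.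
  by apply: (mulfI z1n); rewrite ev_tails // mulrCA divff // mulr1.
rewrite kernel_solution ?z1 // /cleared_tail mulrA mulrBr mulr_sumr; congr ((_ - _) * _).
apply: eq_bigr => i _; rewrite [RHS]mulrA; congr (_ * _).
rewrite mulrCA; congr (_ * _); rewrite mulrBr mulr_sumr; congr (_ - _).
apply: eq_bigr => a _; rewrite -hE (ev_poly _ r0 zr1 (Bdec a i r0 rr)) gen_funE.
by rewrite mulrCA.
Qed.

(** Past r_B the cleared tail is limited by [s], where the numerators of B^* stop, and by theta,
    where the kernel may become singular. Cauchy's estimate on the annulus starting at 1 applies
    because the decay of [tails] at a radius between 1 and r_B is already known. *)
Lemma cleared_tail_decay : exists2 s', rB < s' & forall j,
  decay s' (conv (coefs (polesP S ^+ mB)) (tails j)).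
Proof.
pose s1 := Num.min s theta.
have rs1 : rB < s1 by rewrite lt_min rs.
have [rs' s's] := midf_lt rs1; set s' := _ / 2 in rs' s's.
exists s' => // j.
have [r01 r0r] := midf_lt rB1; set r0 := _ / 2 in r01 r0r.
apply: (@cauchy_decay _ (cleared_tail j) _ 1 r0 s1 0) => //.
- by apply: decay_poly; [exact: lt_trans r01 | exact: decay_tails].
- move=> z /andP[z1]; rewrite lt_min => /andP[zs zt].
  by apply: ceps_derivable; exact: cleared_tail_derivable.
- by move=> z /andP[z1]; rewrite lt_min => /andP[zs zt] _; exact: cleared_tail_derivable.
- by move=> z /andP[z1 zr]; apply: cleared_tailE; rewrite z1 (lt_trans zr).
- by rewrite (lt_trans rB0).
Qed.

(** At a pole [polesP S] vanishes and removes the terms with [tails j 0] and [exitc]; only x(0)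
    times the numerators of B^* survives. The kernel is p (I - Gamma_A^*(p)), and this p cancels the
    factor z of the numerator. *)
Lemma pf_coef_tails j p : p \in S ->
  pf_coef S mB (conv (coefs (polesP S ^+ mB)) (tails j)) p =
  ((\row_i \sum_a (x0 0 a)%:C * pf_coef S mB (h a i) p) *m
     invmx (1%:M - p^-1 *: gen_fun A p)) 0 j / (p - 1).
Proof.
move=> pS; have pr := Sr pS; have p0 := S0 pS.
have [s' rs' hs'] := cleared_tail_decay.
have p1 : 1 < nc p by rewrite pr.
have s'0 : 0 < s' by exact: lt_trans rs'.
have ps' : nc p < s' by rewrite pr.
have evp : ev (conv (coefs (polesP S ^+ mB)) (tails j)) p = cleared_tail j p.
  apply/eqP; rewrite -subr_eq0; apply/eqP.
  (* The two functions are known to agree for 1 < |z| < r_B, that is at t p with 1 / r_B < t < 1;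
     continuity extends this to the pole p on the circle. *)
  apply: (@radial_zero _ (fun z => ev _ z - cleared_tail j z) p 0 rB^-1).
  - apply: ceps_derivable; apply: derivableB; first exact: derivable_ev (hs' j).
    by apply: cleared_tail_derivable; rewrite ?pr.
  - by rewrite invf_lt1.
  - move=> t /andP[t0 t1]; rewrite cleared_tailE ?subrr ?nc0 ?mul0r // ncM pr nc_real gtr0_norm; last first.
      by apply: lt_trans t0; rewrite invr_gt0.
    by rewrite gtr_pMl // t1 andbT -ltr_pdivrMr // mul1r.
have Dp : (polesP S ^+ mB).[p] = 0.
  by rewrite (polesP_D1 uS pS) exprMn hornerM !horner_exp lin_root // expr0n eqn0Ngt mB0 mul0r.
have Qu : kernel_mx p \in unitmx by apply: kernel_unit; rewrite p1 pr.
have QE : kernel_mx p = p *: (1%:M - p^-1 *: gen_fun A p).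
  by rewrite scalerBr scalerA divff // scale1r scale_scalar_mx mulr1.
have Yu : 1%:M - p^-1 *: gen_fun A p \in unitmx.
  by move: Qu; rewrite QE unitmxZ ?unitfE.
have iE : invmx (1%:M - p^-1 *: gen_fun A p) = p *: invmx (kernel_mx p).
  by move: (Qu); rewrite QE => Zu; rewrite (invmxZ Zu) scalerA divff // scale1r.
have p1n : p - 1 != 0.
  by rewrite subr_eq0; apply: contraTneq p1 => ->; rewrite nc1 ltxx.
have p1n' : 1 - p != 0 by rewrite -oppr_eq0 opprB.
rewrite /pf_coef evp /cleared_tail Dp mul0r sub0r.
have -> : (1 - p)^-1 = - (p - 1)^-1 by rewrite -invrN opprB.
rewrite mulrNN mulrAC; congr (_ / _).
rewrite iE mxE mulr_suml; apply: eq_bigr => i _.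
rewrite !mxE /invmx Qu !mxE mul0r subr0.
have -> : \sum_a (x0 0 a)%:C * (ev (h a i) p / (polesPx S p).[p] ^+ mB) =
    (\sum_a (x0 0 a)%:C * ev (h a i) p) / (polesPx S p).[p] ^+ mB.
  by rewrite mulr_suml; apply: eq_bigr => a _; rewrite mulrA.
ring.
Qed.

End WithPoles.
End TailAsymptotics.

(** * Recurrence and trigonometric sums *)

Section AlmostPeriodic.
Context {R : realType}.
#[local] Opaque ComplexField.Normc.normc.

(** Dirichlet's pigeonhole argument: among sufficiently many exponents, two send all the u n to the
    same cells of a grid, and their difference is the recurrence time. *)
Lemma unit_recurrence_pos (N : nat) (u : 'I_N -> R[i]) (e : R) : (forall n, nc (u n) = 1) -> 0 < e ->
  exists2 m, (0 < m)%N & forall n, nc (u n ^+ m - 1) <= e.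
Proof.
move=> u1 e0; pose Q := (Num.truncn (2 / e)).+1.
have hQ : 2 / e < Q%:R by exact: truncnS_gt.
have Q0 : 0 < Q%:R :> R by rewrite ltr0n.
have lt1 (a : R) : `|a| <= 1 -> (Num.truncn ((a + 1) * Q%:R) < (2 * Q).+1)%N.
  rewrite ler_norml => /andP[a1 a2]; rewrite ltnS truncn_le_nat.
  apply: (@le_lt_trans _ _ (2 * Q%:R)); first by rewrite ler_wpM2r ?(ltW Q0) //; lra.
  by rewrite -natrM ltr_nat.
have Re1 n k : `|complex.Re (u n ^+ k)| <= 1.
  by apply: (le_trans (Re_le_nc _)); rewrite ncX u1 expr1n.
have Im1 n k : `|complex.Im (u n ^+ k)| <= 1.
  by apply: (le_trans (Im_le_nc _)); rewrite ncX u1 expr1n.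
pose T := {ffun 'I_N -> 'I_((2 * Q).+1) * 'I_((2 * Q).+1)}.
pose f (k : 'I_(#|{: T}|.+1)) : T := [ffun n => (Ordinal (lt1 _ (Re1 n k)), Ordinal (lt1 _ (Im1 n k)))].
have [k [l [kl fkl]]] : exists k l : 'I_(#|{: T}|.+1), (k < l)%N /\ f k = f l.
  apply: contrapT => h.
  have : injective f.
    move=> k l fkl; apply/val_inj/eqP; apply: contraT; rewrite neq_ltn => /orP[kl|lk].
      by case: h; exists k, l.
    by case: h; exists l, k.
  by move/leq_card; rewrite card_ord ltnn.
have trunc_close (a b : R) : `|a| <= 1 -> `|b| <= 1 ->
    Num.truncn ((a + 1) * Q%:R) = Num.truncn ((b + 1) * Q%:R) -> `|a - b| <= e / 2.
  move=> a1 b1 ab.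
  have pos (c : R) : `|c| <= 1 -> 0 <= (c + 1) * Q%:R.
    by rewrite ler_norml => /andP[c1 _]; rewrite mulr_ge0 // -lerBlDr sub0r.
  have /andP[ha1 ha2] := truncn_itv (pos _ a1).
  have /andP[hb1 hb2] := truncn_itv (pos _ b1).
  rewrite -ab in hb1 hb2; rewrite -natr1 in ha2 hb2.
  have eQ : 1 <= e / 2 * Q%:R.
    move: hQ; rewrite ltr_pdivrMr // => hQ.
    by rewrite mulrAC ler_pdivlMr // mul1r mulrC ltW.
  rewrite -(ler_pM2r Q0) -[X in _ * X <= _](gtr0_norm Q0) -normrM ler_norml.
  have -> : (a - b) * Q%:R = (a + 1) * Q%:R - (b + 1) * Q%:R by ring.
  by apply/andP; split; lra.
exists (l - k)%N; first by rewrite subn_gt0.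
move=> n; have := congr1 (fun g : T => g n) fkl; rewrite /f !ffunE.
move=> /(congr1 (fun q => (nat_of_ord q.1, nat_of_ord q.2))) /= [hr hi].
have dr := trunc_close _ _ (Re1 n l) (Re1 n k) (esym hr).
have di := trunc_close _ _ (Im1 n l) (Im1 n k) (esym hi).
have -> : nc (u n ^+ (l - k) - 1) = nc (u n ^+ l - u n ^+ k).
  have -> : u n ^+ l - u n ^+ k = u n ^+ k * (u n ^+ (l - k) - 1).
    by rewrite mulrBr mulr1 -exprD subnKC // ltnW.
  by rewrite ncM ncX u1 expr1n mul1r.
apply: (le_trans (nc_le_ReIm _)); rewrite [leRHS]splitr.
move: dr di; case: (u n ^+ l) => a b; case: (u n ^+ k) => c d /=; exact: lerD.
Qed.

(** Recurrence of the powers u^(K+1) yields an exponent beyond K. *)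
Lemma unit_recurrence (N : nat) (u : 'I_N -> R[i]) (e : R) K : (forall n, nc (u n) = 1) -> 0 < e ->
  exists2 m, (K <= m)%N & forall n, nc (u n ^+ m - 1) <= e.
Proof.
move=> u1 e0; have [|m m0 hm] := @unit_recurrence_pos N (fun n => u n ^+ K.+1) e _ e0.
  by move=> n; rewrite ncX u1 expr1n.
exists (K.+1 * m)%N; first by apply: leq_trans (leqnSn K) _; rewrite leq_pmulr.
by move=> n; rewrite exprM.
Qed.

Section TrigSum.
Variables (N : nat) (c u : 'I_N -> R[i]).
Hypothesis (u1 : forall n, nc (u n) = 1).
Let f (k : nat) : R[i] := \sum_(n < N) c n * u n ^+ k.

Lemma trigsum_ge0 : (forall e : R, 0 < e -> exists K, forall k, (K <= k)%N ->
    - e <= complex.Re (f k) /\ `|complex.Im (f k)| <= e) -> forall k, 0 <= f k.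
Proof.
move=> h k.
pose C := \sum_(n < N) nc (c n); have C0 : 0 <= C by apply: sumr_ge0 => n _; exact: nc_ge0.
have key (e : R) : 0 < e -> - e <= complex.Re (f k) /\ `|complex.Im (f k)| <= e.
  move=> e0; have e2 : 0 < e / 2 by rewrite divr_gt0.
  have [K hK] := h _ e2.
  have e3 : 0 < e / 2 / (C + 1) by rewrite divr_gt0 // ltr_wpDl.
  have [m Km hm] := @unit_recurrence N u _ K u1 e3.
  have [|h1 h2] := hK (k + m)%N; first by rewrite (leq_trans Km) // leq_addl.
  have d : nc (f (k + m)%N - f k) <= e / 2.
    rewrite /f -sumrB; apply: (le_trans (nc_sum _ _ _)).
    apply: (@le_trans _ _ (\sum_(n < N) nc (c n) * (e / 2 / (C + 1)))).
      apply: ler_sum => n _; rewrite -mulrBr ncM ler_wpM2l ?nc_ge0 //.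
      have -> : u n ^+ (k + m) - u n ^+ k = u n ^+ k * (u n ^+ m - 1) by rewrite exprD; ring.
      by rewrite ncM ncX u1 expr1n mul1r.
    rewrite -mulr_suml -/C mulrA ler_pdivrMr ?ltr_wpDl // mulrC ler_wpM2l ?(ltW e2) //.
    by rewrite lerDl.
  have dr := le_trans (Re_le_nc _) d; have di := le_trans (Im_le_nc _) d.
  move: h1 h2 dr di; case: (f (k + m)%N) => a b; case: (f k) => a' b' /= h1 h2.
  rewrite !ler_norml => /andP[? ?] /andP[? ?]; move: h2; rewrite ler_norml => /andP[? ?].
  by split; [lra | apply/andP; split; lra].
rewrite lecE /=; apply/andP; split.
  rewrite -normr_le0; apply/ler_addgt0Pr => e e0; rewrite add0r.
  by have [] := key e e0.
by apply/ler_addgt0Pr => e e0; have [] := key e e0; rewrite -lerBlDr sub0r.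
Qed.

(* The Cesaro means of [f] tend to [c n0]. *)
Lemma trigsum_limsup_gt0 n0 : u n0 = 1 -> (forall n, n != n0 -> u n != 1) ->
  0 < complex.Re (c n0) -> (0 < limn_esup (fun k => (complex.Re (f k))%:E))%E.
Proof.
move=> un0 un1 c0; set d := complex.Re (c n0) in c0 *.
have frequently K : exists2 k, (K <= k)%N & d / 2 <= complex.Re (f k).
  apply: contrapT => h.
  have lt k : (K <= k)%N -> complex.Re (f k) <= d / 2.
    by move=> Kk; rewrite leNgt; apply/negP => /ltW hk; apply: h; exists k.
  (* The geometric sums of the u n other than 1 are bounded by 2 / |u n - 1|. If the real part
     stayed below d / 2, sums of length L would give d L <= d L / 2 + E, false for large L. *)
  pose E := \sum_(n < N | n != n0) nc (c n) * (2 / nc (u n - 1)).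
  have sumK L : nc (\sum_(k < L) f (K + k)%N - c n0 *+ L) <= E.
    rewrite exchange_big /= (bigD1 n0) //=.
    rewrite (eq_bigr (fun=> c n0)) => [|k _]; last by rewrite un0 expr1n mulr1.
    rewrite sumr_const card_ord addrAC subrr add0r; apply: (le_trans (nc_sum _ _ _)).
    apply: ler_sum => n nn0; have u0 : u n - 1 != 0 by rewrite subr_eq0 un1.
    have -> : \sum_(k < L) c n * u n ^+ (K + k) = c n * u n ^+ K * ((u n ^+ L - 1) / (u n - 1)).
      rewrite subrX1 [(u n - 1) * _]mulrC mulfK // mulr_sumr; apply: eq_bigr => k _.
      by rewrite exprD mulrA.
    rewrite !ncM ncX u1 expr1n mulr1 ncV ler_wpM2l ?nc_ge0 // ler_wpM2r ?invr_ge0 ?nc_ge0 //.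
    by apply: (le_trans (ncB _ _)); rewrite ncX u1 expr1n nc1.
  have bound L : d * L%:R <= d / 2 * L%:R + E.
    have := le_trans (Re_le_nc _) (sumK L).
    have -> : complex.Re (\sum_(k < L) f (K + k)%N - c n0 *+ L) =
        \sum_(k < L) complex.Re (f (K + k)%N) - d * L%:R.
      by rewrite raddfB raddf_sum raddfMn mulr_natr.
    have : \sum_(k < L) complex.Re (f (K + k)%N) <= \sum_(k < L) d / 2.
      by apply: ler_sum => k _; apply: lt; rewrite leq_addr.
    rewrite sumr_const card_ord -[X in _ <= X -> _]mulr_natr ler_norml => h1 /andP[h2 _].
    by move: h1 h2; move: (\sum_(k < L) _) (d / 2 * L%:R) (d * L%:R) => a b e; lra.
  have := bound (Num.truncn (E / (d / 2))).+1.
  have := truncnS_gt (E / (d / 2)); rewrite ltr_pdivrMr ?divr_gt0 //.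
  by move: (_.+1%:R) => L; lra.
have lb n : ((d / 2)%:E <= esups (fun k => (complex.Re (f k))%:E) n)%E.
  have [k nk hk] := frequently n; apply: (@le_trans _ _ (complex.Re (f k))%:E).
    by rewrite lee_fin.
  by apply: ereal_sup_ubound; exists k.
rewrite limn_esup_lim; apply: (@lt_le_trans _ _ (d / 2)%:E); first by rewrite lte_fin divr_gt0.
apply: lime_ge; first exact: is_cvg_esups.
by apply: nearW => n; exact: lb.
Qed.

End TrigSum.

(** The negative part of [v] is a row subsolution, hence 0. Then [v] is positive where [beta] is,
    and positivity spreads along the edges of [X]. *)
Lemma positive_row_solution (M : nat) (X : 'M[R]_M) (r : R) (w beta v : 'I_M -> R) :
  nonneg_mx X -> irreducible_mx X -> 0 < r -> (forall i, 0 < w i) ->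
  (forall i, mact X w i < r * w i) -> (forall j, 0 <= beta j) -> (exists j, 0 < beta j) ->
  (forall j, r * v j = r * beta j + \sum_i v i * X i j) -> forall j, 0 < v j.
Proof.
move=> X0 irr r0 w0 hw b0 [j0 bj0] hv.
pose neg j := Num.max 0 (- v j).
have neg0 j : 0 <= neg j by rewrite le_max lexx.
have negle j : - v j <= neg j by rewrite le_max lexx orbT.
have sub j : r * neg j <= \sum_i neg i * X i j.
  have h0 : 0 <= \sum_i neg i * X i j by apply: sumr_ge0 => i _; exact: mulr_ge0.
  rewrite {1}/neg; case: (leP 0 (- v j)) => _; last by rewrite mulr0.
  rewrite mulrN hv opprD -sumrN -[leRHS]add0r; apply: lerD.
    by rewrite oppr_le0 mulr_ge0 // ltW.
  by apply: ler_sum => i _; rewrite -mulNr ler_wpM2r.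
have v0 j : 0 <= v j.
  by have := negle j; rewrite (row_subsolution0 w0 hw neg0 sub) oppr_le0.
have vj0 : 0 < v j0.
  rewrite -(pmulr_rgt0 _ r0) hv; apply: ltr_wpDr; last exact: mulr_gt0.
  by apply: sumr_ge0 => i _; exact: mulr_ge0.
move=> j; elim: (irr j0 j) vj0 => [//|a b c Xab _ IH va]; apply: IH.
rewrite -(pmulr_rgt0 _ r0) hv; apply: ltr_wpDl; first by rewrite mulr_ge0 // ltW.
rewrite (bigD1 a) //=; apply: ltr_wpDr; last exact: mulr_gt0.
by apply: sumr_ge0 => i _; exact: mulr_ge0.
Qed.

End AlmostPeriodic.

(** * Distinctness of the zeta_n and comparison of error terms *)

Section FinalLemmas.
Context {R : realType}.
#[local] Opaque ev ComplexField.Normc.normc.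

Lemma expi_ang_neq (N : nat) (ang : 'I_N -> R) :
  (forall n : 'I_N, nat_of_ord n = 0%N -> ang n = 0) ->
  (forall n n' : 'I_N, (n < n')%N -> ang n < ang n') ->
  (forall n : 'I_N, ang n < 2 * pi) ->
  forall n n', n != n' -> expi (ang n) != expi (ang n') :> R[i].
Proof.
move=> a0 alt a2.
have ge0 n : 0 <= ang n.
  have [n0|] := eqVneq (n : nat) 0%N; first by rewrite a0.
  rewrite -lt0n => n0; have N0 : (0 < N)%N by exact: leq_trans (ltn_ord n).
  by rewrite -(a0 (Ordinal N0) erefl) ltW // alt.
have key (n n' : 'I_N) : (n < n')%N -> expi (ang n) != expi (ang n') :> R[i].
  move=> nn'; apply/eqP => e.
  have : expi (ang n' - ang n) = 1 :> R[i] by rewrite expiD -e -expiD subrr expi0.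
  apply/eqP/expi_neq1; rewrite subr_gt0 alt //= mulr2n.
  by have := a2 n'; have := ge0 n; lra.
move=> n n'; rewrite neq_ltn => /orP[/key //|/key]; by rewrite eq_sym.
Qed.

Lemma sum_over_image (N : nat) (S : seq R[i]) (p : 'I_N -> R[i]) (c : R[i] -> R[i]) :
  uniq S -> injective p -> (forall n, p n \in S) ->
  (forall q, q \in S -> (forall n, q != p n) -> c q = 0) ->
  \sum_(q <- S) c q = \sum_(n < N) c (p n).
Proof.
move=> uS pI pS c0; rewrite (bigID (mem (codom p))) /= addrC big_seq_cond big1 ?add0r; last first.
  move=> q /andP[qS /negP qp]; apply: c0 => // n; apply/eqP => e; apply: qp.
  by rewrite e codom_f.
rewrite -big_filter (perm_big (codom p)) /=; first by rewrite big_image.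
apply: uniq_perm; rewrite ?filter_uniq //; first by rewrite map_inj_uniq ?enum_uniq.
move=> q; rewrite mem_filter /=; apply/andP/idP => [[]//|qp]; split => //.
by have /codomP[n ->] := qp.
Qed.

(** Relative to the main term the error is of order (r / s)^k when n = 0 and of order 1 / k
    otherwise. *)
Lemma relative_error (n : nat) (r s C : R) : 0 < r -> r < s -> forall e : R, 0 < e ->
  exists K, forall k, (K <= k)%N -> (0 < k)%N /\
  `|C| * (if n is n'.+1 then k%:R ^+ n' * r ^- k else s ^- k)
     <= e * (k%:R ^+ n / n`!%:R * r ^- k).
Proof.
move=> r0 rs e e0; have s0 : 0 < s by exact: lt_trans rs.
case: n => [|n].
  have q01 : 0 <= r / s < 1 by rewrite divr_ge0 ?(ltW r0) ?(ltW s0) //= ltr_pdivrMr // mul1r.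
  have [K hK] := geo_to0 `|C| q01 e0; exists K.+1 => k Kk; split; first exact: leq_trans Kk.
  rewrite expr0 fact0 divr1 mul1r ler_pdivlMr ?exprn_gt0 //.
  rewrite -mulrA [_ * r ^+ k]mulrC -expr_div_n; exact: ltW (hK k (ltnW Kk)).
pose K := (Num.truncn (`|C| * (n.+1)`!%:R / e)).+1.
exists K => k Kk; have k0 : (0 < k)%N by exact: leq_trans Kk.
split => //; have kR : 0 < k%:R :> R by rewrite ltr0n.
have fR : 0 < (n.+1)`!%:R :> R by rewrite ltr0n fact_gt0.
have rk : 0 < r ^- k by rewrite invr_gt0 exprn_gt0.
have hk : `|C| * (n.+1)`!%:R <= e * k%:R.
  rewrite mulrC [e * _]mulrC -ler_pdivrMr // [_ * `|C|]mulrC; apply: ltW.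
  by apply: lt_le_trans (truncnS_gt _) _; rewrite ler_nat.
rewrite !mulrA ler_pM2r // ler_pdivlMr // exprS.
by rewrite mulrAC [e * _]mulrA ler_wpM2r // exprn_ge0.
Qed.

Lemma xi_trigsum (M0 M N : nat) (A : nat -> 'M[R]_M) (x0 : 'rV[R]_M0) (rB : R)
   (zeta : 'I_N -> R[i]) (Bt : 'I_N -> 'M[R[i]]_(M0, M)) k j :
  xi A x0 rB zeta Bt k 0 j = \sum_(n < N)
   ((map_mx (real_complex R) x0 *m Bt n
        *m invmx (1%:M - (rB%:C * zeta n)^-1 *: gen_fun A (rB%:C * zeta n))) 0 j
     / (rB%:C * zeta n - 1)) * (zeta n)^-1 ^+ k.
Proof.
rewrite /xi summxE; apply: eq_bigr => n _.
rewrite [LHS]mxE exprVn; set V := (_ *m invmx _) 0 j; rewrite mulrC -!mulrA; congr (_ * _).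
by rewrite mulrC.
Qed.

End FinalLemmas.

(** * Assembly: expansion, positive limsup, nonnegativity *)

Theorem theorem3p2 (R : realType) (M0 M : nat)
  (B0 : 'M[R]_M0) (B : nat -> 'M[R]_(M0, M)) (C0 : 'M[R]_(M, M0))
  (A : nat -> 'M[R]_M) (pi_ : 'rV[R]_M)
  (x0 : 'rV[R]_M0) (x : nat -> 'rV[R]_M)
  (rA : \bar R) (rB theta : R) (mB N : nat)
  (ang : 'I_N -> R) (Bt : 'I_N -> 'M[R[i]]_(M0, M)) :
  (* setting *)
  (0 < M0)%N -> (0 < M)%N ->
  nonneg_mx B0 -> (forall k, (0 < k)%N -> nonneg_mx (B k)) ->
  nonneg_mx C0 -> (forall k, nonneg_mx (A k)) ->
  (* A = sum_k A(k) is stochastic *)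
  (forall i j, cvgn (series (fun k => A k i j))) ->
  (forall i, \sum_j mx_series_sum A i j = 1) ->
  (* B(0) e + sum_{k>=1} B(k) e = e *)
  (forall i j, cvgn (series (fun k => B k.+1 i j))) ->
  (forall i, \sum_j B0 i j + \sum_j mx_series_sum (fun k => B k.+1) i j = 1) ->
  (* C(0) e + sum_{k>=1} A(k) e = e  (T is a transition matrix) *)
  (forall i, \sum_j C0 i j + \sum_j mx_series_sum (fun k => A k.+1) i j = 1) ->
  (* pi A = pi, pi e = 1 *)
  pi_ *m mx_series_sum A = pi_ -> \sum_j pi_ 0 j = 1 ->
  (* x is the stationary probability vector of T *)
  stationary_prob B0 B C0 A x0 x ->
  (* Assumption 1 *)
  irreducible_T B0 B C0 A ->
  irreducible_mx (mx_series_sum A) ->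
  cvgn (series (fun k => k%:R * (pi_ *m A k *m (const_mx 1 : 'cV[R]_M)) 0 0)) ->
  limn (series (fun k => k%:R * (pi_ *m A k *m (const_mx 1 : 'cV[R]_M)) 0 0)) < 1 ->
  (forall i j, cvgn (series (fun k => k%:R * Bext B k i j))) ->
  (* Assumption 2 (r_B is finite, as forced by Assumption 4) *)
  radius_mx A = rA -> radius_mx (Bext B) = rB%:E ->
  (1%:E < rA)%E -> 1 < rB ->
  (* Assumption 3 *)
  1 < theta -> (theta%:E < rA)%E ->
  is_delta (gen_fun A theta%:C) theta%:C ->
  (* Assumptions 4 and 5 *)
  (0 < mB)%N -> (0 < N)%N ->
  (forall n : 'I_N, nat_of_ord n = 0%N -> ang n = 0) ->
  (forall n n' : 'I_N, (n < n')%N -> ang n < ang n') ->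
  (forall n : 'I_N, ang n < 2 * pi) ->
  (forall n : 'I_N, nat_of_ord n = 0%N -> forall i j, 0 <= Bt n i j) ->
  (forall n : 'I_N, Bt n != 0) ->
  (exists (U : set (R[i])^o) (F : R[i] -> 'M[R[i]]_(M0, M)),
     [/\ open U /\ (forall z : R[i], `|z| <= rB%:C -> U z),
         (forall i j, meromorphic_on U (fun z => F z i j)),
         (forall z : R[i], `|z| < rB%:C -> F z = gen_fun (Bext B) z),
         (forall n : 'I_N, pole_coef F (rB%:C * expi (ang n)) mB (Bt n)) &
         (forall zeta : R[i], `|zeta| = 1 ->
            (exists L, L != 0 /\ pole_coef F (rB%:C * zeta) mB L) ->
            exists n : 'I_N, zeta = expi (ang n))]) ->
  (* theta > r_B *)
  rB < theta ->
  (exists eps0 : R, 0 < eps0 /\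
     exists (c : R) (K : nat), forall k : nat, (K <= k)%N -> forall j : 'I_M,
       `| (xbar x k 0 j)%:C
          - ((k%:R ^+ mB.-1 / (mB.-1)`!%:R) * rB ^- k)%:C
            * xi A x0 rB (fun n => expi (ang n)) Bt k 0 j |
       <= (c * (if mB == 1%N then (rB + eps0) ^- k
                else k%:R ^+ (mB - 2) * rB ^- k))%:C)
  /\ (forall j : 'I_M,
        (0 < limn_esup (fun k => (complex.Re (xi A x0 rB (fun n => expi (ang n)) Bt k 0 j))%:E))%E)
  /\ (forall (k : nat) (j : 'I_M),
        0 <= xi A x0 rB (fun n => expi (ang n)) Bt k 0 j).
Proof.
move=> _ Mpos B0ge B0k C0ge A0 Acvg Asto Bcvg Bsto Csto piA pi1 xstat irrT irrA _ drift _.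
move=> rAE rBE _ rB1 theta1 thetarA Atheta mB0 N0 ang0 anglt ang2pi Bt0 Btn0 [U [F [[Uopen UB] Fmer FE FBt Fother]]] rBtheta.
have rB0 : 0 < rB by exact: lt_trans rB1.
have theta0 : 0 < theta by exact: lt_trans theta1.
have [sA thetas As] : exists2 sA, theta < sA & forall i j, decay sA (fun k => (A k i j)%:C).
  move: thetarA; rewrite -rAE => /ereal_sup_gt[_ [r [r0 hr] <-]]; rewrite lte_fin => tr.
  by exists r => // i j; exact: cvg_decay (hr i j) r0.
have Bdec r i j : 0 < r -> r < rB -> decay r (fun k => (Bext B k i j)%:C).
  move=> r0 rrB; have : (r%:E < radius_mx (Bext B))%E by rewrite rBE lte_fin.
  move=> /ereal_sup_gt[_ [r' [r'0 hr'] <-]]; rewrite lte_fin => rr'.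
  by apply: decay_le (cvg_decay (hr' i j) r'0); exact: ltW.
have x_ge0 k j : (0 < k)%N -> 0 <= x k 0 j.
  by move=> k0; case: xstat => -[_ h] _ _ _ _; exact: h.
have xE : forall k, (0 < k)%N -> x k = x0 *m B k + \sum_(l < k.+1) x l.+1 *m A (k - l)%N.
  by case: xstat.
have super := interior_supersolution Mpos A0 Asto piA pi1 irrA drift theta1 thetas As Atheta.
have xd r : 1 < r < rB -> exists C : R, forall k j, x k.+1 0 j * r ^+ k.+1 <= C.
  move=> /andP[r1 rrB]; have r0 : 0 < r by exact: lt_trans r1.
  have [|w w0 hw] := super r; first by rewrite r1 (lt_trans rrB).
  apply: (stationary_decay B0k A0 Acvg Asto Bcvg Bsto Csto xstat r1 w0 _ _ hw) => i j.
    by apply: decay_cvg (As i j); [exact: ltW | rewrite (lt_trans rrB) // (lt_trans rBtheta)].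
  have [rr' r'B] := midf_lt rrB; set r' := _ / 2 in rr' r'B.
  by apply: decay_cvg (Bdec r' i j _ r'B); [exact: ltW | exact: rr' | exact: lt_trans rr'].
have x0gt0 := x0_gt0 B0ge B0k C0ge A0 xstat irrT.
have [s [S [h [[rs uS Sr] hd hE hz ho]]]] : exists (s : R) (S : seq R[i]) (h : 'I_M0 -> 'I_M -> nat -> R[i]),
 [/\ [/\ rB < s, uniq S & forall p, p \in S -> nc p = rB],
     forall i j, decay s (h i j),
     forall i j, conv (coefs (polesP S ^+ mB)) (fun k => (Bext B k i j)%:C) = h i j,
     forall n, rB%:C * expi (ang n) \in S /\
        forall i j, pf_coef S mB (h i j) (rB%:C * expi (ang n)) = Bt n i j &
     forall p, p \in S -> (forall n, p != rB%:C * expi (ang n)) ->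
        forall i j, pf_coef S mB (h i j) p = 0].
  apply: (@boundary_structure R M0 M N mB (fun i j k => Bext B k i j) rB F U ang Bt) => //.
  - by move=> i j k; exact: Bext_ge0.
  - by move=> z zr; apply: UB; rewrite normcC lecR.
  - by move=> z i j zr; rewrite FE ?normcC ?ltcR // gen_funE.
  - by move=> z z1; apply: Fother; rewrite normcC z1.
pose p n : R[i] := rB%:C * expi (ang n).
have rC : rB%:C != 0 :> R[i] by rewrite -nc_eq0 nc_real normr_eq0 gt_eqF.
have zneq := expi_ang_neq ang0 anglt ang2pi.
have pI : injective p.
  by move=> n n' /(mulfI rC) e; apply/eqP; apply: contraT => /zneq; rewrite e eqxx.
pose c j n : R[i] := (map_mx (real_complex R) x0 *m Bt n
        *m invmx (1%:M - (p n)^-1 *: gen_fun A (p n))) 0 j / (p n - 1).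
have xiE k j : xi A x0 rB (fun n => expi (ang n)) Bt k 0 j = \sum_(n < N) c j n * (expi (ang n))^-1 ^+ k.
  exact: xi_trigsum.
have pfE j q : q \in S -> pf_coef S mB (conv (coefs (polesP S ^+ mB)) (tails x j)) q =
  ((\row_i \sum_a (x0 0 a)%:C * pf_coef S mB (h a i) q) *m
     invmx (1%:M - q^-1 *: gen_fun A q)) 0 j / (q - 1).
  exact: (pf_coef_tails A0 x_ge0 xE rB1 rBtheta thetas As super xd Bdec mB0 rs uS Sr hd hE).
have [s' rs' gd] := cleared_tail_decay A0 x_ge0 xE rB1 rBtheta thetas As super xd Bdec rs hd hE.
have pfp j n : pf_coef S mB (conv (coefs (polesP S ^+ mB)) (tails x j)) (p n) = c j n.
  have [pS pB] := hz n; rewrite pfE // /c; congr ((_ *m _) 0 j / _).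
  apply/rowP => i; rewrite !mxE; apply: eq_bigr => a _; rewrite mxE; congr (_ * _); exact: pB.
have pf0 j q : q \in S -> (forall n, q != p n) ->
    pf_coef S mB (conv (coefs (polesP S ^+ mB)) (tails x j)) q = 0.
  move=> qS qp; rewrite pfE // (_ : \row_i _ = 0) ?mul0mx ?mxE ?mul0r //.
  by apply/rowP => i; rewrite !mxE big1 // => a _; rewrite ho ?mulr0.
have [m mE] : exists m, mB = m.+1 by exists mB.-1; rewrite prednK.
pose err k j := nc ((xbar x k 0 j)%:C - (k%:R ^+ m / m`!%:R * rB ^- k)%:C
      * xi A x0 rB (fun n => expi (ang n)) Bt k 0 j).
pose g k : R := if m is m'.+1 then k%:R ^+ m' * rB ^- k else s' ^- k.
have asym j : exists C : R, forall k, (0 < k)%N -> err k j <= C * g k.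
  have := @leading_asymp R S rB s' rB0 rs' uS Sr m (tails x j) _ (gd j).
  rewrite mE => /(_ erefl)[C hC]; exists C => k k0; have := hC k k0; rewrite -mE /err xiE.
  rewrite (@sum_over_image R N S p) //.
  - rewrite (eq_bigr (fun n => c j n * (expi (ang n))^-1 ^+ k)) // => n _; rewrite pfp.
    by congr (_ * _ ^+ k); rewrite /p invfM mulrA divff // mul1r.
  - by move=> n; have [] := hz n.
  - by move=> q qS qp; rewrite pf0 // mul0r.
have [Cf hCf] := choice asym.
pose C := \sum_j `|Cf j|.
have hC k j : (0 < k)%N -> err k j <= `|C| * g k.
  move=> k0; apply: (le_trans (hCf j k k0)); apply: ler_wpM2r.
    have s'0 : 0 < s' by exact: lt_trans rs'.
    by rewrite /g; case: (m) => [|m']; rewrite ?mulr_ge0 ?invr_ge0 ?exprn_ge0 // ltW.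
  apply: (le_trans (ler_norm _)); apply: le_trans (ler_norm _).
  by rewrite /C (bigD1 j) //= lerDl sumr_ge0.
have u1 n : nc (expi (ang n))^-1 = 1 by rewrite ncV nc_expi invr1.
split; [|split].
(* Here eps0 is chosen so that r_B + eps0 is the radius at which the cleared tails decay. *)
- exists (s' - rB); split; first by rewrite subr_gt0.
  exists `|C|, 1%N => k k0 j; rewrite normcC lecR.
  have := hC k j k0; rewrite /err /g mE /= [rB + _]addrC subrK.
  by case: (m) => [|m'] //=; rewrite subn2.
- move=> j; pose n0 : 'I_N := Ordinal N0.
  have z0 : expi (ang n0) = 1 by rewrite ang0 // expi0.
  rewrite (_ : (fun k => _) = (fun k => (complex.Re (\sum_(n < N) c j n * (expi (ang n))^-1 ^+ k))%:E)); last first.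
    by apply/funext => k; rewrite xiE.
  apply: (@trigsum_limsup_gt0 R N (c j) _ u1 n0).
  + by rewrite z0 invr1.
  + by move=> n nn0; rewrite invr_eq1 -z0; exact: zneq.
  have p0E : p n0 = rB%:C by rewrite /p z0 mulr1.
  rewrite /c p0E.
  pose V := map_mx (real_complex R) x0 *m Bt n0 *m invmx (1%:M - (rB%:C)^-1 *: gen_fun A rB%:C).
  have rBs : rB < sA by exact: lt_trans thetas.
  have [|w w0 hw] := super rB; first by rewrite rB1.
  have Qu : kernel_mx A rB%:C \in unitmx.
    by apply: (kernel_unit A0 thetas As super); rewrite nc_real gtr0_norm // rB1.
  have Yu : 1%:M - (rB%:C)^-1 *: gen_fun A rB%:C \in unitmx.
    move: Qu; rewrite /kernel_mx.
    have -> : (rB%:C)%:M - gen_fun A rB%:C = rB%:C *: (1%:M - (rB%:C)^-1 *: gen_fun A rB%:C).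
      by rewrite scalerBr scalerA divff // scale1r scale_scalar_mx mulr1.
    by rewrite unitmxZ ?unitfE.
  have VM : V *m (1%:M - (rB%:C)^-1 *: gen_fun A rB%:C) = map_mx (real_complex R) x0 *m Bt n0.
    by rewrite /V mulmxKV.
  (* At zeta_0 = 1 all data are real, and V = beta + r_B^-1 V A^*(r_B) with beta = x(0) Bt(r_B),
     nonnegative and nonzero because x(0) > 0. This is the equation solved in
     [positive_row_solution]. *)
  have VE l : rB%:C * V 0 l = rB%:C * (map_mx (real_complex R) x0 *m Bt n0) 0 l
      + \sum_i V 0 i * (genR A rB i l)%:C.
    move: (V) VM => W <-; rewrite mulmxBr mulmx1 -scalemxAr (gen_fun_real (ltW rB0) rBs As).
    rewrite !mxE mulrBr mulrA divff // mul1r.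
    by under [X in _ - X + _]eq_bigr => i _ do rewrite mxE; rewrite subrK.
  have BR a l : (complex.Re (Bt n0 a l))%:C = Bt n0 a l.
    by apply: RRe_real; apply: ger0_real; exact: Bt0.
  have Bge a l : 0 <= complex.Re (Bt n0 a l) by rewrite -ler0c BR; exact: Bt0.
  have bE l : (map_mx (real_complex R) x0 *m Bt n0) 0 l = (\sum_a x0 0 a * complex.Re (Bt n0 a l))%:C.
    by rewrite mxE rmorph_sum; apply: eq_bigr => a _; rewrite mxE rmorphM /= BR.
  have Vpos : 0 < complex.Re (V 0 j).
    apply: (@positive_row_solution R M (genR A rB) rB w
      (fun l => complex.Re ((map_mx (real_complex R) x0 *m Bt n0) 0 l)) (fun l => complex.Re (V 0 l))) => //.
    + exact: (genR_ge0 A0 As (ltW rB0) rBs).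
    + exact: (genR_irreducible A0 irrA As rB0 rBs).
    + by move=> l; rewrite bE; apply: sumr_ge0 => a _; rewrite mulr_ge0 // ltW.
    + have [a [l nz]] : exists a l, Bt n0 a l != 0.
        apply: contrapT => hh; have /eqP := Btn0 n0; apply.
        apply/matrixP => a l; rewrite [RHS]mxE; apply/eqP; apply: contraT => nz.
        by case: hh; exists a, l.
      exists l; rewrite bE [X in 0 < X]/= (bigD1 a) //=; apply: ltr_wpDr.
        by apply: sumr_ge0 => a' _; rewrite mulr_ge0 // ltW.
      by rewrite mulr_gt0 // lt_def Bge andbT; apply: contraNneq nz => e; rewrite -BR e.
    + move=> l.
      have ReM (a : R) (z : R[i]) : complex.Re (a%:C * z) = a * complex.Re z.
        by case: z => ? ? /=; rewrite mul0r subr0.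
      rewrite -!ReM VE raddfD raddf_sum; congr (_ + _); apply: eq_bigr => i _.
      by rewrite [RHS]mulrC -ReM mulrC.
  rewrite -/V.
  have -> : rB%:C - 1 = (rB - 1)%:C by rewrite rmorphB rmorph1.
  rewrite -fmorphV; case: (V 0 j) Vpos => a b /= a0.
  by rewrite mulr0 subr0 mulr_gt0 // invr_gt0 subr_gt0.
(* The tail divided by its scale [a] is a nonnegative real number within e of xi(l) for large l, as
   [trigsum_ge0] requires. *)
- move=> k j; rewrite xiE; apply: trigsum_ge0 => // e e0.
  have [K hK] := relative_error m C rB0 rs' e0.
  exists K => l Kl; have [l0 hl] := hK l Kl.
  set a := l%:R ^+ m / m`!%:R * rB ^- l in hl.
  have a0 : 0 < a by rewrite mulr_gt0 ?divr_gt0 ?invr_gt0 ?exprn_gt0 ?ltr0n ?fact_gt0.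
  have := le_trans (hC l j l0) hl; rewrite /err -/a xiE.
  set f := \sum_(n < N) _ => hf.
  have y0 : 0 <= xbar x l 0 j by exact: (xbar_ge0 x_ge0 rB1 xd).
  have aC : a%:C != 0 :> R[i] by rewrite -nc_eq0 nc_real normr_eq0 gt_eqF.
  have d : nc ((xbar x l 0 j / a)%:C - f) <= e.
    rewrite -(ler_pM2r a0) -[X in _ * X <= _](gtr0_norm a0) -nc_real -ncM mulrBl.
    by rewrite -rmorphM /= divfK ?gt_eqF // [f * _]mulrC.
  have dr := le_trans (Re_le_nc _) d; have di := le_trans (Im_le_nc _) d.
  have q0 : 0 <= xbar x l 0 j / a by rewrite divr_ge0 // ltW.
  move: dr di; case: (f) => f1 f2 /=; rewrite sub0r normrN => dr di; split => //.
  by move: dr; rewrite ler_norml => /andP[_]; move: q0; lra.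
Qed.
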